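(* Let $\mu>0$ and let $\tilde\nu^{(\mu)}=\nu^{(\mu)}\circ\chi^{-1}$ be the law of the spine. Let $T_0^s$ be a finite tree of height $r$ with $R$ leaves, all at height $r$, and let $\mathcal B^s_{1/r}(T_0^s)=\{T^s\in\mathcal T^s: B_r(T^s)=T_0^s\}$. Then: (i) $\tilde\nu^{(\mu)}\big(\mathcal B^s_{1/r}(T_0^s)\big)=e^{-(r-1)\mu}\frac{\mu^{R-1}}{(R-1)!}$. (ii) Identify $\chi^{-1}(\mathcal B^s_{1/r}(T_0^s))$ with $\mathcal T_\infty^R\times\mathcal T_{\rm fin}^\sigma$, $\sigma=2|T_0^s|-R-1$, via $T\mapsto$ (the $R$ infinite subtrees grafted at the leaves of $T_0^s$; the finite subtrees $T_{(i,n)}$ grafted in each sector $(i,n)$ of each vertex $i$ of $T_0^s$ at heights $1,\dots,r-1$). Then $$\nu^{(\mu)}\big(\cdot\mid\chi^{-1}(\mathcal B^s_{1/r}(T_0^s))\big)=\Big(\int_{\mu\Delta_R}d\omega\prod_{j=1}^R\nu^{(\mu_j)}\Big)\times\prod_{(i,n)}\rho_{(i,n)},\qquad\rho_{(i,n)}=\rho;$$ i.e. conditionally on $B_r(\chi(T))=T_0^s$, the finite branches $T_{(i,n)}$ are i.i.d. with law $\rho$ and independent of the infinite branches, whose joint law is $\int_{\mu\Delta_R}d\omega\prod_{j=1}^R\nu^{(\mu_j)}$.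
   Context: Rooted planar trees (root of degree 1); $D_r(T)$ = vertices at height $r$; $|T|$ = number of edges; $B_r(T)$ = subtree spanned by vertices of height $\le r$. For an infinite tree, a vertex is of infinite type if it has infinitely many descendants; these span the spine $\chi(T)$ (same root, no leaves); $\mathcal T^s=\chi(\mathcal T_\infty)$ is the set of spine trees. A vertex $i$ at height $\ge1$ of degree $\sigma_i$ has $\sigma_i$ sectors $(i,n)$, the angular gaps between consecutive edges at $i$; grafting a tree in a sector identifies its root edge with the edge from $i$ to its parent and inserts the rest in that gap. For $\nu>0$, $\nu^{(\nu)}$ is the Borel probability measure with $\nu^{(\nu)}(\{T:B_s(T)=S\})=e^{-\nu(s-1)}4^{-|S|}2^{L+1}\sum_{R=1}^L\binom LR\frac{\nu^{R-1}}{(R-1)!}$ for finite $S$ of height $s$, $L=|D_s(S)|$ (weak limit of $\nu_N^{(\nu)}(T)\propto e^{-\nu h(T)}$ on trees with $N$ edges). $\rho$ is the critical BGW tree with offspring law $2^{-(n+1)}$, $\rho(T)=2\cdot4^{-|T|}$ on finite trees. $\mu\Delta_R$ is the simplex $\{(\mu_1,\dots,\mu_R):\sum\mu_j=\mu,\mu_j>0\}$ with normalized Lebesgue measure $d\omega$, and $\int_{\mu\Delta_R}d\omega\prod_j\nu^{(\mu_j)}$ is the mixture probability measure on $\mathcal T^R$ given on products of balls $A$ by $\int\prod_j\nu^{(\mu_j)}(A)\,d\omega$. *)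

(* Defs.v *)
From HB Require Import structures.
From mathcomp Require Import all_boot all_order all_algebra finmap.
From mathcomp Require Import all_classical all_reals all_analysis.
Import Order.TTheory GRing.Theory Num.Theory.

Set Implicit Arguments.
Unset Strict Implicit.
Unset Printing Implicit Defensive.

Local Open Scope classical_set_scope.
Local Open Scope ring_scope.

(* Rooted planar trees, Ulam-Harris encoding.                          *)
(* A vertex is a word [:: k1; ...; km] : seq nat (m = height); the     *)
(* children of w are rcons w 0, rcons w 1, ... in left-to-right        *)
(* (planar) order.  The root is [::] and has degree 1 (unique child    *)
(* [:: 0]).  Trees are locally finite, possibly infinite.              *)

Definition word := seq nat.

Definition is_tree (X : set word) : Prop :=
  [/\ X [::] /\ X [:: 0%N], ~ X [:: 1%N],
      (forall w k, X (rcons w k) -> X w),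
      (forall w k, X (rcons w k.+1) -> X (rcons w k)) &
      (forall w, X w -> exists n, ~ X (rcons w n))].

Record tree := Tree { tverts :> set word ; tree_ok : is_tree tverts }.

Definition path_verts : set word := [set w | all (fun k => k == 0%N) w].

Lemma path_is_tree : is_tree path_verts.
Proof.
rewrite /is_tree /path_verts /=; split => //.
- by move=> w k; rewrite all_rcons => /andP[].
- by move=> w k; rewrite all_rcons.
- by move=> w _; exists 1%N; rewrite all_rcons.
Qed.

Definition path_tree := Tree path_is_tree.

HB.instance Definition _ := gen_eqMixin tree.
HB.instance Definition _ := gen_choiceMixin tree.
HB.instance Definition _ := isPointed.Build tree path_tree.

Definition ncard {T : choiceType} (A : set T) : nat := #|` fset_set A |%fset.

Definition Bball (s : nat) (X : set word) : set word :=
  [set w | X w /\ (size w <= s)%N].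

Definition ball_ev (s : nat) (S : set word) : set tree :=
  [set T : tree | Bball s T = S].

Definition ballsets : set (set tree) :=
  [set E | exists s S, E = ball_ev s S].

Definition Tsp := g_sigma_algebraType ballsets.

Definition tree_height (X : set word) (s : nat) : Prop :=
  (forall w, X w -> (size w <= s)%N) /\ exists w, X w /\ size w = s.

Definition leaf (X : set word) : set word :=
  [set w | X w /\ forall k, ~ X (rcons w k)].

Definition nchild (X : set word) (w : word) : nat :=
  ncard [set k | X (rcons w k)].

Definition nedges (X : set word) : nat := (ncard X).-1.

Definition spine_set (X : set word) : set word :=
  [set w | X w /\ ~ finite_set [set u | X (w ++ u)]].

(* canonical re-addressing of a sub-forest Y (the k-th child of a     *)
(* vertex gets index = number of Y-siblings to its left)              *)
Fixpoint relab_aux (Y : set word) (pre : word) (w : word) : word :=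
  match w with
  | [::] => [::]
  | k :: w' =>
      (\sum_(j < k) (`[< Y (rcons pre j) >] : nat))%N
        :: relab_aux Y (rcons pre k) w'
  end.

Definition relab (Y : set word) (w : word) : word := relab_aux Y [::] w.

Definition chi (X : set word) : set word :=
  relab (spine_set X) @` spine_set X.

(* the (planted) subtree of X at vertex w, root edge = edge parent-w *)
Definition plant (X : set word) (w : word) : set word :=
  [set u | u = [::] \/ exists u', u = 0%N :: u' /\ X (w ++ u')].

Definition nsp_before (Y : set word) (w : word) (j : nat) : nat :=
  (\sum_(i < j) (`[< Y (rcons w i) >] : nat))%N.

(* child j of w is a non-spine child lying in sector n of w *)
Definition in_gap (X Y : set word) (w : word) (n j : nat) : Prop :=
  [/\ X (rcons w j), ~ Y (rcons w j) & nsp_before Y w j = n].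

Definition gap_off (X Y : set word) (w : word) (n j : nat) : nat :=
  (\sum_(i < j) (`[< in_gap X Y w n i >] : nat))%N.

(* the finite tree T_(w,n) grafted in sector n of w: a root edge whose *)
(* lower endpoint carries the subtrees of X hanging in sector n of w  *)
Definition gap_branch (X Y : set word) (w : word) (n : nat) : set word :=
  [set u | u = [::] \/ u = [:: 0%N] \/
     exists j u', [/\ in_gap X Y w n j,
                      u = 0%N :: gap_off X Y w n j :: u' &
                      X (rcons w j ++ u')]].

Definition sectors (T0 : set word) (r : nat) : set (word * nat) :=
  [set x | [/\ T0 x.1, (1 <= size x.1 < r)%N & (x.2 <= nchild T0 x.1)%N]].

Definition branch_event (T0 : set word) (r d : nat)
  (S : word -> set word) (F : word -> nat -> set word) : set tree :=
  [set T : tree |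
     [/\ Bball r (chi T) = T0,
         (forall w, spine_set T w -> size w = r ->
            Bball d (plant T w) = S (relab (spine_set T) w)) &
         (forall w, spine_set T w -> (1 <= size w < r)%N ->
            forall n, (n <= nchild T0 (relab (spine_set T) w))%N ->
            gap_branch T (spine_set T) w n = F (relab (spine_set T) w) n)]].

Section Reals.
Variable R : realType.

(* nu^{(v)}(B_s(T) = S) for S of height s *)
Definition nu_ball (v : R) (s : nat) (S : set word) : R :=
  let L := ncard [set w | S w /\ size w = s] in
  expR (- v * (s.-1)%:R) / 4 ^+ nedges S * 2 ^+ L.+1 *
  \sum_(1 <= k < L.+1) ('C(L, k)%:R * v ^+ k.-1 / (k.-1)`!%:R).

(* the critical geometric BGW law rho(T) = 2 * 4^{-|T|} on finite trees *)
Definition rho (X : set word) : R :=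
  if `[< is_tree X /\ finite_set X >] then 2 / 4 ^+ nedges X else 0.

(* Unnormalized integral over the simplex {(m_j)_{j in l} : m_j > 0,   *)
(* sum m_j = m}, w.r.t. Lebesgue measure on the first size l - 1       *)
(* coordinates (the last one being m minus the others).                *)
Fixpoint sint (l : seq word) (m : R) (f : (word -> R) -> \bar R) : \bar R :=
  match l with
  | [::] => 0%E
  | [:: j] => f (fun _ => m)
  | j :: l' =>
      (\int[@lebesgue_measure R]_(t in [set t : R | (0 < t < m)%R])
         sint l' (m - t)%R (fun g => f (fun k => if k == j then t else g k)))%E
  end.

(* integral against the normalized Lebesgue measure d omega on m Delta_R *)
Definition simplex_int (l : seq word) (m : R) (f : (word -> R) -> \bar R)
  : \bar R :=
  ((((size l).-1)`!%:R / m ^+ (size l).-1)%:E * sint l m f)%E.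

Definition cond_prob (P : set Tsp -> \bar R) (C E : set Tsp) : \bar R :=
  (fine (P (E `&` C)) / fine (P C))%:E.

End Reals.

(* Main.v *)
Require Import Defs.
From HB Require Import structures.
From mathcomp Require Import all_boot all_order all_algebra finmap.
From mathcomp Require Import all_classical all_reals all_analysis.
From mathcomp Require Import measurable_realfun ring lra zify.
Import Order.TTheory GRing.Theory Num.Theory.
Import numFieldNormedType.Exports.
Set Implicit Arguments.
Unset Strict Implicit.
Unset Printing Implicit Defensive.
Local Open Scope classical_set_scope.
Local Open Scope ring_scope.

(** Cut a tree at a set of open vertices, all at height [s]. The ball formula,
    extended by opening one vertex at a time (the masses are coefficient
    extractions from [(1 - y)^-l (1 + y)^l'], so opening a vertex is the identity
    [sum_n 2^-n (1 + y)^n = 2 / (1 - y)]), gives the mass of every cylinder "the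
    tree cut at the open vertices is S", including those where S has closed branches
    higher than [s]. Letting an open vertex die out within [t] generations instead
    of at once multiplies the mass by [2t/(t+1)]; letting [t] tend to infinity
    gives the mass of the event that prescribed groups of open vertices each
    contain a vertex of infinite type: a factor [Lam (prod ((1 + 'X)^|G| - 1))],
    where [Lam] sends ['X^k] to [mu^(k-1) / (k-1)!]. The Dirichlet integral turns
    this into the simplex mixture, because the convolution over [0, mu] of [Lam p]
    and [Lam q] is [Lam (p * q)].
    The event of part (ii) is such a cylinder event for the tree glued from the
    spine [T0], the finite branches and the balls of the infinite branches;
    part (i) follows by summing out the finite branches, since [rho] has mass 1. *)

(** * Power series identities *)

Section Numeric.
Variable R : realType.
Implicit Types (v : R) (k l : nat).

(** The hypothesis only prescribes balls, in which every vertex that may still grow sits at the top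
    level, whereas the events of part (ii) fix finite branches of any height. A cylinder is reduced
    to balls by opening generations until the open level has passed the top of S. Finite trees
    remain as residual terms. That they are null is not part of the hypothesis; it is obtained from
    the same reduction read as an inequality. With L open vertices at one level the ball formula
    reads [Lam] of (1 + x)^L. Moving the open level up by one costs a factor e^-v, and this is
    balanced by the substitution x = y / (1 - y), which turns (1 + x)^l into (1 - y)^-l. Hence mixed
    states, with l vertices at the old level and l' at the new one, have the generating function (1
    - y)^-l (1 + y)^l'. The factor 2t/(t+1) is twice the probability that the critical geometric
    branching process is extinct within t generations. Its limit 2 equals the factor 2 that the ball
    formula gives to each open vertex, so doomed and free vertices carry the same power of 2 and
    inclusion-exclusion over a group G leaves exactly (1 + 'X)^|G| - 1. *)

Lemma eseries_EFin (f : nat -> R) (a : R) : series f @ \oo --> a ->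
  (\sum_(n <oo) (f n)%:E)%E = a%:E.
Proof.
move=> fa; rewrite -(cvg_lim _ fa)// -EFin_lim; last by apply/cvg_ex; exists a.
by apply/congr_lim/funext => n /=; rewrite /series /= sumEFin.
Qed.

(** One term of the binomial expansion of (1 + 1/2)^m. The base 3/2 lies below 2, so the remainder
    in [bin_half_series] decays like (3/4)^N. *)
Lemma bin_le_expr m i : 'C(m, i)%:R <= 2 ^+ i * (3 / 2) ^+ m :> R.
Proof.
have -> : (3 / 2 : R) = 1 + 2^-1 by lra.
have [im|mi] := leqP i m; last first.
  by rewrite bin_small// mulr_ge0// exprn_ge0//; lra.
rewrite [X in _ * X]exprDn (bigD1 (Ordinal (im : (i < m.+1)%N)))//= expr1n mul1r mulrDr.
rewrite mulrnAr exprVn mulfV ?expf_neq0// -[leLHS]addr0 lerD//.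
by rewrite mulr_ge0// sumr_ge0// => j _; rewrite mulrn_wge0// mulr_ge0.
Qed.

(** The coefficient of y^k in sum_n 2^-n (1 + y)^(l + n) = 2 (1 + y)^l / (1 - y). The truncated
    binomial sums satisfy A(m+1) = 2 A(m) - C(m, k), so the partial sums telescope. *)
Lemma bin_half_series l k :
  (\sum_(n <oo) (2^-1 ^+ n * 'C(l + n, k)%:R)%:E)%E
  = (2 * (\sum_(i < k.+1) 'C(l, i))%:R)%:E :> \bar R.
Proof.
pose A m : R := (\sum_(i < k.+1) 'C(m, i))%:R.
have AS m : A m.+1 = 2 * A m - 'C(m, k)%:R.
  rewrite /A -{1}(big_mkord xpredT (fun i => 'C(m.+1, i))) big_nat_recl//.
  rewrite big_mkord.
  under eq_bigr do rewrite binS.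
  rewrite big_split/= bin0 natrD natrD.
  have e1 : (\sum_(i < k.+1) 'C(m, i))%N = (1 + \sum_(i < k) 'C(m, i.+1))%N.
    by rewrite big_ord_recl bin0.
  have e2 : (\sum_(i < k.+1) 'C(m, i))%N = (\sum_(i < k) 'C(m, i) + 'C(m, k))%N.
    by rewrite big_ord_recr.
  by rewrite [in RHS]mulr_natl mulr2n {1}e1 e2 !natrD; ring.
apply: eseries_EFin.
have partial N : series (fun n => 2^-1 ^+ n * 'C(l + n, k)%:R : R) N
    = 2 * A l - 2 * (2^-1 ^+ N * A (l + N)%N).
  elim: N => [|N IH]; first by rewrite /series/= big_geq// addn0 expr0; ring.
  by rewrite seriesSr IH addnS AS exprS; field.
rewrite (_ : series _ = fun N => 2 * A l - 2 * (2^-1 ^+ N * A (l + N)%N)); last exact/funext.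
suff A0 : (fun N => 2^-1 ^+ N * A (l + N)%N) @ \oo --> 0.
  have := cvgB (cvg_cst (2 * A l)) (cvgM (cvg_cst (2 : R)) A0).
  by rewrite mulr0 subr0; apply.
have cv0 : geometric (k.+1%:R * 2 ^+ k * (3 / 2) ^+ l) (3 / 4 : R) @ \oo --> 0.
  by apply: cvg_geometric; rewrite ger0_norm; lra.
apply: (@squeeze_cvgr _ _ _ _ (cst 0) (geometric (k.+1%:R * 2 ^+ k * (3 / 2) ^+ l) (3 / 4 : R))).
- near=> N; apply/andP; split => //=; first by rewrite mulr_ge0.
  have -> : k.+1%:R * 2 ^+ k * (3 / 2) ^+ l * (3 / 4) ^+ N
      = 2^-1 ^+ N * (k.+1%:R * 2 ^+ k * (3 / 2) ^+ (l + N)) :> R.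
    rewrite (_ : 3 / 4 = 2^-1 * (3 / 2) :> R); last by lra.
    by rewrite [(2^-1 * (3 / 2)) ^+ N]exprMn exprD; ring.
  rewrite ler_wpM2l// /A natr_sum -mulrA mulr_natl.
  rewrite -[X in _ *+ X]card_ord -sumr_const ler_sum// => i _.
  apply: (le_trans (bin_le_expr _ _)); apply: ler_wpM2r.
    by rewrite exprn_ge0// divr_ge0.
  by apply: ler_weXn2l; [lra|rewrite -ltnS].
- exact: cvg_cst.
- exact: cv0.
Unshelve. all: end_near. Qed.

(* [cf l l' k] is the coefficient of y^k in (1 - y)^-l (1 + y)^l' *)
Fixpoint cf (l l' k : nat) : nat :=
  if l is l1.+1 then \sum_(i < k.+1) cf l1 l' i else 'C(l', k).

(** Dividing by 1 - y takes cumulative sums of coefficients, which commutes with the sum over n; the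
    case of no division is [bin_half_series]. *)
Lemma cf_half_series l l' k :
  (\sum_(n <oo) (2^-1 ^+ n * (cf l (l' + n) k)%:R)%:E)%E
  = (2 * (cf l.+1 l' k)%:R)%:E :> \bar R.
Proof.
elim: l k => [|l IH] k; first exact: bin_half_series.
transitivity (\sum_(n <oo) \sum_(i < k.+1) (2^-1 ^+ n * (cf l (l' + n) i)%:R)%:E : \bar R)%E.
  by apply: eq_eseriesr => n _; rewrite sumEFin -mulr_sumr -natr_sum.
rewrite nneseries_sum => [|i j _]; last by rewrite lee_fin mulr_ge0.
under eq_bigr do rewrite IH.
by rewrite sumEFin -mulr_sumr -natr_sum.
Qed.

Lemma cf0S l k : cf l 0 k.+1 = 'C(l + k, k.+1).
Proof.
have cf0 m : cf m 0 0 = 1%N by elim: m => //= m; rewrite big_ord1.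
elim: l k => [|l IH] k /=; first by rewrite !bin_small.
rewrite big_ord_recl cf0; under eq_bigr do rewrite IH.
elim: k => [|k IHk]; first by rewrite big_ord1 /= !addn0 !bin1 add1n.
by rewrite big_ord_recr /= addnA IHk -addSnnS addnS [in RHS]binS addnC.
Qed.

(** For k > 0 this is the volume of the simplex v Delta_k in its first k - 1 coordinates. The value
    0 at k = 0 expresses that at least one infinite branch exists; it makes cylinders without open
    vertices null. *)
Definition cw v k : R := if k is k'.+1 then v ^+ k' / k'`!%:R else 0.

Lemma cw_ge0 v k : 0 <= v -> 0 <= cw v k.
Proof. by case: k => //= k v0; rewrite divr_ge0// exprn_ge0. Qed.

Definition binw v L : R := \sum_(k < L.+1) 'C(L, k)%:R * cw v k.

Lemma eseries_exp v m : 0 <= v ->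
  (\sum_(n <oo) (cw v m.+1 * (if (m <= n)%N then v ^+ (n - m) / (n - m)`!%:R else 0))%:E)%E
  = (cw v m.+1 * expR v)%:E :> \bar R.
Proof.
move=> v0; rewrite (nneseries_split _ m); last first.
  by move=> n _; rewrite lee_fin mulr_ge0 ?cw_ge0//; case: ifP => // _; rewrite divr_ge0// exprn_ge0.
rewrite add0n big1_seq ?add0e => [|n]; last first.
  by rewrite mem_index_iota => /andP[_ /andP[_ nm]]; rewrite leqNgt nm mulr0.
rewrite -nneseries_addn => [|n]; last first.
  by rewrite lee_fin mulr_ge0 ?cw_ge0//; case: ifP => // _; rewrite divr_ge0// exprn_ge0.
under eq_eseriesr do rewrite leq_addl addnK EFinM.
rewrite nneseriesZl => [|n _]; last by rewrite lee_fin divr_ge0// exprn_ge0.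
rewrite (@eseries_EFin _ (expR v))//.
by apply: is_cvg_series_exp_coeff.
Qed.

(** Vandermonde writes the coefficient C(l + k, k + 1) of (1 - y)^-l as the sum over j of C(l, j +
    1) C(k, j). Since C(k, j) v^k / k! = v^j / j! * v^(k - j) / (k - j)!, summing over k first gives
    one exponential series for each j. *)
Lemma cf0_series v l : 0 <= v ->
  (\sum_(k <oo) ((cf l 0 k)%:R * cw v k)%:E)%E = (expR v * binw v l)%:E.
Proof.
move=> v0; rewrite nneseries_recl//; last by move=> k _; rewrite lee_fin mulr_ge0// cw_ge0.
rewrite mulr0 add0e.
have cfE k : (cf l 0 k.+1 = \sum_(j < l) 'C(l, j.+1) * 'C(k, j))%N.
  rewrite cf0S; case: l => [|l]; first by rewrite big_ord0 bin_small.
  have -> : 'C(l.+1 + k, k.+1) = 'C(l.+1 + k, l).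
    have h : (l <= l.+1 + k)%N by lia.
    by rewrite -(bin_sub h); congr binomial; lia.
  rewrite [in LHS]addnC -binomial.Vandermonde.
  apply: eq_bigr => j _; rewrite mulnC; congr (_ * _)%N.
  have h : (j.+1 <= l.+1)%N by exact: ltn_ord.
  by rewrite -(bin_sub h); congr binomial; lia.
have -> : (\sum_(1 <= k <oo) ((cf l 0 k)%:R * cw v k)%:E = \sum_(k <oo) ((cf l 0 k.+1)%:R * cw v k.+1)%:E)%E.
  rewrite -(nneseries_addn (f := fun k => ((cf l 0 k)%:R * cw v k)%:E) 1) => [|k]; last first.
    by rewrite lee_fin mulr_ge0// cw_ge0.
  by apply: eq_eseriesr => k _; rewrite addn1.
transitivity (\sum_(k <oo) \sum_(j < l) ('C(l, j.+1)%:R%:E * (cw v j.+1 * (if (j <= k)%N then v ^+ (k - j) / (k - j)`!%:R else 0))%:E) : \bar R)%E.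
  apply: eq_eseriesr => k _; rewrite cfE natr_sum mulr_suml -sumEFin.
  apply: eq_bigr => j _; rewrite -EFinM; congr EFin; rewrite natrM -mulrA; congr (_ * _).
  case: ifPn => [jk|]; last by rewrite -ltnNge => kj; rewrite bin_small// mul0r mulr0.
  rewrite /= -(bin_fact jk) !natrM -{2}(subnKC jk) exprD.
  have := bin_gt0 k j; rewrite jk => /idP b0.
  by field; rewrite !pnatr_eq0 -!lt0n !fact_gt0 b0.
rewrite nneseries_sum => [|j k _]; last first.
  rewrite -EFinM lee_fin mulr_ge0// mulr_ge0 ?cw_ge0//.
  by case: ifP => // _; rewrite divr_ge0// exprn_ge0.
under eq_bigr => j _.
  rewrite nneseriesZl; last first.
    by move=> k _; rewrite lee_fin mulr_ge0 ?cw_ge0//; case: ifP => // _; rewrite divr_ge0// exprn_ge0.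
  rewrite eseries_exp// -EFinM.
  over.
rewrite sumEFin /binw big_ord_recl mulr0 add0r mulr_sumr; congr EFin.
by apply: eq_bigr => j _ /=; ring.
Qed.

(* [cyl] is the mass of a cylinder with [e] edges and [L] open vertices at height
   [s]; [cyl2] is that with [l] open vertices at height [s] and [l'] at height
   [s + 1]. *)
Definition cyl v s e L : R :=
  expR (- v * s.-1%:R) / 4 ^+ e * 2 ^+ L.+1 * binw v L.

Definition cyl2 v s e l l' : \bar R :=
  ((expR (- v * s%:R) / 4 ^+ e * 2 ^+ (l + l').+1)%:E *
   \sum_(k <oo) ((cf l l' k)%:R * cw v k)%:E)%E.

Lemma cyl0 v s e : cyl v s e 0 = 0.
Proof. by rewrite /cyl /binw big_ord1 mulr0 mulr0. Qed.

Lemma cyl2_0l v s e l' : 0 <= v -> cyl2 v s e 0 l' = (cyl v s.+1 e l')%:E.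
Proof.
move=> v0; rewrite /cyl2 /cyl add0n.
rewrite (nneseries_split _ l'.+1); last by move=> k _; rewrite lee_fin mulr_ge0// cw_ge0.
rewrite add0n big_mkord sumEFin eseries0 ?adde0 => [|k lk _]; last first.
  by rewrite /= bin_small// mul0r.
by rewrite -EFinM.
Qed.

(** [cyl2] carries the exponential of level s + 1 even before any vertex has been opened; the excess
    e^-v is absorbed by [cf0_series]. *)
Lemma cyl2_l0 v s e l : 0 <= v -> (0 < s)%N -> cyl2 v s e l 0 = (cyl v s e l)%:E.
Proof.
move=> v0; case: s => // s _; rewrite /cyl2 /cyl cf0_series// addn0 -EFinM; congr EFin.
have -> : - v * s.+1%:R = - v * s%:R - v by rewrite -natr1; ring.
rewrite expRD.
have e1 : expR (- v) * expR v = 1 by rewrite -expRD addrC subrr expR0.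
transitivity (expR (- v) * expR v * (expR (- v * s%:R) / 4 ^+ e * 2 ^+ l.+1 * binw v l)).
  ring.
by rewrite e1 mul1r.
Qed.

Lemma cyl2_ge0 v s e l l' : 0 <= v -> (0 <= cyl2 v s e l l')%E.
Proof.
move=> v0; rewrite /cyl2 mule_ge0// ?lee_fin ?mulr_ge0 ?expR_ge0//.
by apply: nneseries_ge0 => k _ _; rewrite lee_fin mulr_ge0// cw_ge0.
Qed.

(** A vertex opened with n children adds n edges, hence 4^-n, and n open vertices, hence 2^n (1 +
    y)^n; the sum over n of 2^-n (1 + y)^n produces one more factor 2 / (1 - y). *)
Lemma cyl2_step v s e l l' : 0 <= v ->
  cyl2 v s e l.+1 l' = (\sum_(n <oo) cyl2 v s (e + n) l (l' + n))%E.
Proof.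
move=> v0; pose c := expR (- v * s%:R) / 4 ^+ e * 2 ^+ (l + l').+1.
have c0 : 0 <= c by rewrite /c !mulr_ge0 ?expR_ge0.
transitivity (\sum_(n <oo) \sum_(k <oo) (c * cw v k * (2^-1 ^+ n * (cf l (l' + n) k)%:R))%:E : \bar R)%E; last first.
  apply: eq_eseriesr => n _.
  rewrite /cyl2 -nneseriesZl; last by move=> k _; rewrite lee_fin mulr_ge0// cw_ge0.
  apply: eq_eseriesr => k _; rewrite -EFinM; congr EFin.
  rewrite /c (_ : (l + (l' + n)).+1 = (l + l').+1 + n)%N; last by lia.
  rewrite [4 ^+ (e + n)]exprD [2 ^+ ((l + l').+1 + n)]exprD.
  have -> : 4 ^+ n = 2 ^+ n * 2 ^+ n :> R by rewrite -exprMn; congr (_ ^+ _); ring.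
  rewrite exprVn; field.
  by rewrite !expf_neq0.
rewrite nneseries_interchange; last first.
  by move=> n k; rewrite lee_fin !mulr_ge0// cw_ge0.
rewrite /cyl2 -nneseriesZl; last by move=> k _; rewrite lee_fin mulr_ge0// cw_ge0.
apply: eq_eseriesr => k _; under eq_eseriesr do rewrite EFinM.
rewrite nneseriesZl; last by move=> n _; rewrite lee_fin mulr_ge0.
rewrite cf_half_series -!EFinM; congr EFin.
rewrite /c (_ : (l.+1 + l').+1 = (l + l').+2)%N// [2 ^+ _.+2]exprS; ring.
Qed.

End Numeric.

(** * Trees cut at open vertices *)

Lemma ncardU (T : choiceType) (A B : set T) : finite_set A -> finite_set B ->
  A `&` B = set0 -> ncard (A `|` B) = (ncard A + ncard B)%N.
Proof.
move=> fA fB AB; rewrite /ncard fset_setU// cardfsU.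
by rewrite -fset_setI// AB fset_set0 cardfs0 subn0.
Qed.

Lemma ncard_seq (T : choiceType) (s : seq T) : uniq s ->
  ncard [set x | x \in s] = size s.
Proof.
move=> us; rewrite /ncard.
have -> : [set x | x \in s] = [set` [fset x in s]%fset].
  by apply/seteqP; split => x /=; rewrite inE.
by rewrite set_fsetK card_fseq undup_id.
Qed.

Lemma finite_seq (T : choiceType) (s : seq T) : finite_set [set x | x \in s].
Proof. by apply/finite_seqP; exists s. Qed.

Section Trees.
Implicit Types (X S : set word) (w u x : word) (O : seq word).

Lemma tree_cat X w u : is_tree X -> X (w ++ u) -> X w.
Proof.
move=> [_ _ pX _ _]; elim/last_ind: u => [|u k IH]; first by rewrite cats0.
by rewrite -rcons_cat => /pX.
Qed.

Lemma tree_sib X w k j : is_tree X -> X (rcons w k) -> (j <= k)%N -> X (rcons w j).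
Proof.
move=> [_ _ _ sX _]; elim: k => [|k IH] Xk; first by rewrite leqn0 => /eqP ->.
by rewrite leq_eqVlt => /orP[/eqP -> //|]; rewrite ltnS; apply: IH; exact: sX.
Qed.

Lemma tree_root X u : is_tree X -> X u -> u != [::] -> exists u', u = 0%N :: u'.
Proof.
move=> tX; case: u => // k u Xu _; exists u.
have Xk : X (rcons [::] k) by apply: (tree_cat (u := u)).
case: k Xk {Xu} => // k Xk; have [_ n1 _ _ _] := tX; exfalso; apply: n1.
exact: (tree_sib (w := [::]) tX Xk).
Qed.

Lemma tree_children X w : is_tree X -> X w ->
  exists n, forall k, X (rcons w k) <-> (k < n)%N.
Proof.
move=> tX Xw; have [_ _ _ _ /(_ _ Xw) fX] := tX.
pose P n := `[< ~ X (rcons w n) >].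
have eP : exists n, P n by case: fX => n ?; exists n; apply/asboolP.
case: (ex_minnP eP) => n /asboolP Xn mn; exists n => k; split => [Xk|kn].
  by rewrite ltnNge; apply/negP => nk; apply: Xn; apply: tree_sib Xk nk.
apply: contrapT => Xk; have := mn k; rewrite leqNgt kn => /(_ _)/negP; apply.
  exact/asboolP.
by [].
Qed.

Lemma Bball_finite X s : is_tree X -> finite_set (Bball s X).
Proof.
move=> tX; elim: s => [|s IH].
  apply: (@sub_finite_set _ _ [set [::]]); last exact: finite_set1.
  by move=> w [_]; rewrite leqn0 size_eq0 => /eqP.
apply: (@sub_finite_set _ _ ([set [::]] `|`
   \bigcup_(w in Bball s X) [set rcons w k | k in [set k | X (rcons w k)]])).
  move=> w [Xw sw]; elim/last_ind: w Xw sw => [|w k _] Xw sw; first by left.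
  right; exists w; last by exists k.
  split; last by rewrite size_rcons ltnS in sw.
  by move: Xw; rewrite -cats1; exact: tree_cat.
rewrite finite_setU; split; first exact: finite_set1.
apply: bigcup_finite => // w [Xw _]; apply: finite_image.
have [n nX] := tree_children tX Xw.
apply: (@sub_finite_set _ _ `I_n); last exact: finite_II.
by move=> k /= /nX.
Qed.

Lemma finite_height S : finite_set S -> exists n, forall w, S w -> (size w <= n)%N.
Proof.
move=> fS; exists (\max_(w <- fset_set S) size w)%N => w Sw.
have wS : w \in fset_set S by rewrite in_fset_set// inE.
exact: (leq_bigmax_seq w).
Qed.

Definition die (t : nat) (w : word) (X : set word) : Prop :=
  forall u, (t <= size u)%N -> ~ X (w ++ u).

Definition infdesc (w : word) (X : set word) : Prop :=
  ~ finite_set [set u | X (w ++ u)].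

Lemma finite_die X w : is_tree X -> ~ infdesc w X <-> exists t, die t w X.
Proof.
move=> tX; rewrite /infdesc notK; split => [/finite_height[n hn]|[t dt]].
  exists n.+1 => u nu Xu; have := hn u Xu; lia.
apply: (@sub_finite_set _ _ [set u | (w ++ u) \in fset_set (Bball (size w + t) X)]).
  move=> u /= Xu; rewrite in_fset_set; last exact: Bball_finite.
  rewrite inE; split => //; rewrite size_cat leq_add2l.
  by rewrite leqNgt; apply/negP => /ltnW /dt.
apply: (@finite_preimage _ _ [set` fset_set (Bball (size w + t) X)] (cat w)).
  by move=> u v _ _ /= /eqP; rewrite eqseq_cat// eqxx => /eqP.
exact: finite_fset.
Qed.

Lemma dieE X t w : is_tree X ->
  die t w X <-> forall u, size u = t -> ~ Bball (size w + t) X (w ++ u).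
Proof.
move=> tX; split=> [d u su [Xu _]|d u tu Xu]; first by apply: (d u) Xu; rewrite su.
apply: (d (take t u)); first by rewrite size_take_min; apply/minn_idPl.
split; last by rewrite size_cat leq_add2l size_take_min geq_minl.
by move: Xu; rewrite -{1}(cat_take_drop t u) catA; exact: tree_cat.
Qed.

Lemma die_mono X t t' w : (t <= t')%N -> die t w X -> die t' w X.
Proof. by move=> tt d u t'u; apply: d; apply: leq_trans t'u. Qed.

Lemma dieS X t w : is_tree X -> w != [::] ->
  die t.+1 w X <-> forall k, X (rcons w k) -> die t (rcons w k) X.
Proof.
move=> tX w0; split=> [d k Xk u tu|d u].
  by rewrite cat_rcons; apply: d.
case: u => [//|k u] /= tu Xu; apply: (d k _ u) => //; last by rewrite cat_rcons.
by move: Xu; rewrite -cat_rcons; exact: tree_cat.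
Qed.

(** Only strict descendants of [O] are removed: a vertex of [O] stays as a leaf with unknown
    progeny, while any other leaf of the pruned set is a genuine leaf of the tree. *)
Definition prune (O : seq word) (X : set word) : set word :=
  [set w | X w /\ forall o k u, w = o ++ k :: u -> o \notin O].

Lemma eq_prune O O' X : O =i O' -> prune O X = prune O' X.
Proof.
by move=> OO; apply/seteqP; split => w [Xw h]; split => // o k u /h; rewrite OO.
Qed.

Lemma prune_tree_cat O X w u : is_tree X -> prune O X (w ++ u) -> prune O X w.
Proof.
move=> tX [Xw h]; split; first exact: tree_cat Xw.
by move=> o k v e; apply: (h _ k (v ++ u)); rewrite e -catA cat_cons.
Qed.

Definition grow (S : set word) x n : set word :=
  S `|` [set w | w \in [seq rcons x k | k <- iota 0 n]].

Definition openleaves (S : set word) O :=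
  [/\ uniq O, forall o, o \in O -> S o & forall o k, o \in O -> ~ S (rcons o k)].

Lemma children_inP x n w :
  reflect (exists2 k, (k < n)%N & w = rcons x k) (w \in [seq rcons x k | k <- iota 0 n]).
Proof.
apply: (iffP mapP) => [[k]|[k kn ->]]; first by rewrite mem_iota add0n => kn ->; exists k.
by exists k => //; rewrite mem_iota add0n.
Qed.

Lemma uniq_children x n : uniq [seq rcons x k | k <- iota 0 n].
Proof. by rewrite map_inj_uniq ?iota_uniq// => i j /rcons_inj[]. Qed.

Lemma leaf_cat S x k u : is_tree S -> (forall j, ~ S (rcons x j)) -> ~ S (x ++ k :: u).
Proof. by move=> tS lx; rewrite -cat_rcons => /(tree_cat tS)/lx. Qed.

Lemma is_tree_grow S x n : is_tree S -> x != [::] -> S x ->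
  (forall k, ~ S (rcons x k)) -> is_tree (grow S x n).
Proof.
move=> tS x0 Sx lx; have [[S0 S00] S1 pS sS fS] := tS.
have rn k : rcons [::] k <> rcons x k by move=> /rcons_inj[/esym/eqP]; rewrite (negbTE x0).
split.
- by split; left.
- case=> // /children_inP[k _] /(@rcons_inj _ [::] x 1%N k)[/esym/eqP].
  by rewrite (negbTE x0).
- move=> w k [/pS|/children_inP[j _ /rcons_inj[-> _]]]; by left.
- move=> w k [/sS|/children_inP[j jn /rcons_inj[-> jk]]]; first by left.
  by right; apply/children_inP; exists k => //; apply: ltnW; rewrite jk.
- move=> w [Sw|/children_inP[j jn ->]].
    have [wx|wx] := eqVneq w x.
      exists n; rewrite wx => -[/lx//|/children_inP[k kn /rcons_inj[nk]]].
      by move: kn; rewrite -nk ltnn.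
    have [k Sk] := fS _ Sw; exists k => -[//|/children_inP[j _ /rcons_inj[wx' _]]].
    by rewrite wx' eqxx in wx.
  exists 0%N => -[|/children_inP[i _]].
    by rewrite -!cats1 -catA; exact: leaf_cat.
  by move/(congr1 size); rewrite !size_rcons => -[]; lia.
Qed.

Lemma ncard_grow S x n : finite_set S -> (forall k, ~ S (rcons x k)) ->
  ncard (grow S x n) = (ncard S + n)%N.
Proof.
move=> fS lx; rewrite ncardU//.
- by rewrite ncard_seq ?uniq_children// size_map size_iota.
- exact: finite_seq.
- by rewrite -subset0 => w [Sw /children_inP[k _ e]]; apply: (lx k); rewrite -e.
Qed.

Lemma finite_grow S x n : finite_set S -> finite_set (grow S x n).
Proof. by move=> fS; rewrite finite_setU; split => //; exact: finite_seq. Qed.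

Lemma openleaves_grow S x O n : is_tree S -> openleaves S (x :: O) ->
  openleaves (grow S x n) (O ++ [seq rcons x k | k <- iota 0 n]).
Proof.
move=> tS [uO SO lO]; have /andP[xO uO'] : (x \notin O) && uniq O := uO.
have lx k : ~ S (rcons x k) by apply: lO; rewrite mem_head.
split.
- rewrite cat_uniq uO' uniq_children andbT; apply/hasPn => w /children_inP[k _ ->].
  by apply/negP => wO; apply: (lx k); apply: SO; rewrite inE wO orbT.
- move=> o; rewrite mem_cat => /orP[oO|]; last by right.
  by left; apply: SO; rewrite inE oO orbT.
- move=> o k; rewrite mem_cat => /orP[oO|/children_inP[j _ ->]].
    move=> [|/children_inP[j _ /rcons_inj[ox _]]].
      by apply: lO; rewrite inE oO orbT.
    by rewrite -ox oO in xO.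
  move=> [|/children_inP[i _]].
    by rewrite -!cats1 -catA; exact: leaf_cat.
  by move/(congr1 size); rewrite !size_rcons => -[]; lia.
Qed.

Definition cylinder (S : set word) O : set Tsp := [set T : tree | prune O T = S].

Lemma rcons_strict_prefix x k (o : word) j u :
  rcons x k = o ++ j :: u -> exists u', x = o ++ u'.
Proof.
case/lastP: u => [|u i].
  by rewrite cats1 => /rcons_inj[-> _]; exists [::]; rewrite cats0.
by rewrite -rcons_cons -rcons_cat => /rcons_inj[-> _]; exists (j :: u).
Qed.

Lemma cylinder_children S x O n (T : tree) : openleaves S (x :: O) ->
  cylinder (grow S x n) (O ++ [seq rcons x k | k <- iota 0 n]) T ->
  forall k, tverts T (rcons x k) <-> (k < n)%N.
Proof.
move=> [uO SO lO] TS k; have /andP[xO _] : (x \notin O) && uniq O := uO.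
have lx j : ~ S (rcons x j) by apply: lO; rewrite mem_head.
have [Tx hx] : prune (O ++ [seq rcons x k | k <- iota 0 n]) T x.
  by rewrite TS; left; apply: SO; rewrite mem_head.
split => [Tk|kn].
  have : grow S x n (rcons x k).
    rewrite -TS; split => // o j u e; rewrite mem_cat negb_or.
    have [u' e'] := rcons_strict_prefix e.
    apply/andP; split.
      case: u' e' => [|i u'] xe; first by move: xe; rewrite cats0 => <-.
      by have := hx _ _ _ xe; rewrite mem_cat negb_or => /andP[].
    apply/negP => /children_inP[i _ oe]; move: e'; rewrite oe.
    by move/(congr1 size); rewrite size_cat size_rcons; lia.
  by case=> [/lx//|/children_inP[j jn /rcons_inj[->]]].
have : grow S x n (rcons x k) by right; apply/children_inP; exists k.
by rewrite -TS => -[].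
Qed.

(** The cases are the possible numbers n of children of x. The children are appended at the end of
    the open list, so that an induction on the head of the list exhausts the old vertices before it
    reaches the new ones. *)
Lemma cylinder_expand S x O : is_tree S -> openleaves S (x :: O) ->
  cylinder S (x :: O) =
  \bigcup_n cylinder (grow S x n) (O ++ [seq rcons x k | k <- iota 0 n]).
Proof.
move=> tS ol; have [uO SO lO] := ol; have /andP[xO _] : (x \notin O) && uniq O := uO.
have lx j : ~ S (rcons x j) by apply: lO; rewrite mem_head.
apply/seteqP; split => [T TS|T [n _ TS]].
  have [Tx hx] : prune (x :: O) T x by rewrite TS; apply: SO; rewrite mem_head.
  have [n nT] := tree_children (tree_ok T) Tx; exists n => //.
  apply/seteqP; split => [w [Tw h]|w].
    have [[k [u e]]|nx] := pselect (exists k u, w = x ++ k :: u).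
      right; apply/children_inP; exists k.
        by apply/nT; move: Tw; rewrite e -cat_rcons; apply: tree_cat; exact: tree_ok.
      case: u e => [|j u] e; first by rewrite e cats1.
      have := h (rcons x k) j u; rewrite cat_rcons => /(_ e).
      rewrite mem_cat negb_or => /andP[_ /negP[]]; apply/children_inP.
      exists k => //; apply/nT; move: Tw; rewrite e -cat_rcons; apply: tree_cat; exact: tree_ok.
    left; rewrite -TS; split => // o k u e; rewrite inE negb_or.
    have := h _ _ _ e; rewrite mem_cat negb_or => /andP[-> _]; rewrite andbT.
    by apply/negP => /eqP oe; apply: nx; exists k, u; rewrite -oe.
  case=> [Sw|/children_inP[k kn ->]].
    move: (Sw); rewrite -{1}TS => -[Tw h]; split => // o k u e.
    have := h _ _ _ e; rewrite inE negb_or mem_cat negb_or => /andP[_ ->] /=.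
    apply/negP => /children_inP[j _ oe]; move: Sw.
    by rewrite e oe cat_rcons; exact: leaf_cat.
  split; first exact/nT.
  move=> o j u e; have [u' e'] := rcons_strict_prefix e.
  rewrite mem_cat negb_or; apply/andP; split.
    case: u' e' => [|i u'] xe; first by move: xe; rewrite cats0 => <-.
    by have := hx _ _ _ xe; rewrite inE negb_or => /andP[].
  apply/negP => /children_inP[i _ oe]; move: e'; rewrite oe.
  by move/(congr1 size); rewrite size_cat size_rcons; lia.
apply/seteqP; split => [w [Tw h]|w Sw].
  have : grow S x n w.
    rewrite -TS; split => // o k u e; have := h _ _ _ e.
    rewrite inE negb_or mem_cat negb_or => /andP[_ ->] /=.
    apply/negP => /children_inP[j _ oe].
    by have := h x j (k :: u); rewrite e oe cat_rcons mem_head => /(_ erefl).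
  case=> // /children_inP[k _ we].
  by have := h x k [::]; rewrite we cats1 mem_head => /(_ erefl).
have [Tw h] : prune (O ++ [seq rcons x k | k <- iota 0 n]) T w by rewrite TS; left.
split => // o k u e; rewrite inE negb_or.
have := h _ _ _ e; rewrite mem_cat negb_or => /andP[-> _]; rewrite andbT.
by apply/negP => /eqP oe; move: Sw; rewrite e oe; exact: leaf_cat.
Qed.

Lemma cylinder_expand_triv S x O : openleaves S (x :: O) ->
  trivIset setT (fun n => cylinder (grow S x n) (O ++ [seq rcons x k | k <- iota 0 n])).
Proof.
move=> ol; apply/trivIsetP => i j _ _ ij; rewrite -subset0 => T [Ti Tj].
have iT := cylinder_children ol Ti; have jT := cylinder_children ol Tj.
have h k : (k < i)%N = (k < j)%N.
  by apply/idP/idP => [/iT/jT|/jT/iT].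
by move: ij; rewrite neq_ltn => /orP[|] lt; have := h (minn i j); move: lt; lia.
Qed.

(** Trees are locally finite, so a ball is a finite set of words, and there are only countably many
    of those. *)
Lemma measurable_ball_pred s (Q : set word -> Prop) :
  measurable ([set T : tree | Q (Bball s T)] : set Tsp).
Proof.
rewrite (_ : [set T : tree | _] = \bigcup_(A : {fset word})
    (if `[< Q [set` A] >] then ball_ev s [set` A] else set0)); last first.
  apply/seteqP; split => [T QT|T [A _]].
    exists (fset_set (Bball s T)) => //; rewrite fset_setK; last exact/Bball_finite/tree_ok.
    by rewrite asboolT.
  by case: asboolP => // QA TA; rewrite /= TA.
apply: countable_bigcupT_measurable => [|A]; first exact: countableP.
 case: asboolP => // _; apply: sub_sigma_algebra; by exists s, [set` A].
Qed.

Lemma measurable_ball_ev s S : measurable (ball_ev s S : set Tsp).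
Proof. exact: (measurable_ball_pred s (fun X => X = S)). Qed.

Lemma prune_Bball O s X : prune O (Bball s X) = Bball s (prune O X).
Proof. by apply/seteqP; split => w /= [[? ?] ?]. Qed.

Lemma measurable_cylinder S O : finite_set S -> measurable (cylinder S O).
Proof.
move=> /finite_height[n hn].
(* S has height at most n; one level more is needed to see that the closed leaves have no
   children. *)
rewrite (_ : cylinder _ _ = [set T : tree | prune O (Bball n.+1 T) = S]); last first.
  apply/seteqP; split => T; rewrite /cylinder /= prune_Bball => TS.
    rewrite TS; apply/seteqP; split => w; first by case.
    by move=> Sw; split => //; have := hn _ Sw; lia.
  apply/seteqP; split => w; last by rewrite -TS => -[].
  move=> Pw; have [wn|nw] := leqP (size w) n.+1; first by rewrite -TS; split.
  have : S (take n.+1 w).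
    rewrite -TS; split; last by rewrite size_take_min geq_minl.
    by move: Pw; rewrite -{1}(cat_take_drop n.+1 w); apply: prune_tree_cat; exact: tree_ok.
  by move=> /hn; rewrite size_take_min; lia.
exact: (measurable_ball_pred n.+1 (fun X => prune O X = S)).
Qed.

Lemma measurable_die t w : measurable ([set T : tree | die t w T] : set Tsp).
Proof.
rewrite (_ : [set T : tree | _] = [set T : tree |
    (fun X => forall u, size u = t -> ~ X (w ++ u)) (Bball (size w + t) T)]).
  exact: (measurable_ball_pred _ (fun X => forall u, size u = t -> ~ X (w ++ u))).
by apply/seteqP; split => T /= /(dieE _ _ (tree_ok T)).
Qed.

End Trees.

(** * Mass of a cylinder *)

Section CylinderMeasure.
Variable R : realType.
Implicit Types (v : R) (S : set word) (O : seq word) (s : nat).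

Lemma nu_ballE v s S :
  nu_ball v s S = cyl v s (nedges S) (ncard [set w | S w /\ size w = s]).
Proof.
rewrite /nu_ball /cyl; congr (_ * _); rewrite /binw big_ord_recl mulr0 add0r.
rewrite big_add1 big_mkord; apply: eq_bigr => k _.
by rewrite /= mulrA.
Qed.

Lemma nedges_grow S x n : finite_set S -> S [::] -> (forall k, ~ S (rcons x k)) ->
  nedges (grow S x n) = (nedges S + n)%N.
Proof.
move=> fS S0 lx; rewrite /nedges ncard_grow//.
have : (0 < ncard S)%N.
  by rewrite /ncard cardfs_gt0; apply/fset0Pn; exists [::]; rewrite in_fset_set// inE.
by case: (ncard S).
Qed.

Lemma cylinder_ball S O s : is_tree S ->
  (forall o, o \in O -> size o = s) ->
  (forall w, S w -> w \in O \/ (size w < s)%N) ->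
  cylinder S O = ball_ev s S.
Proof.
move=> tS Os hS; apply/seteqP; split => T TS; apply/seteqP; split => w.
- move=> [Tw ws]; rewrite -TS; split => // o k u e; apply/negP => /Os so.
  by move: ws; rewrite e size_cat so /=; lia.
- move=> Sw; split; first by move: Sw; rewrite -TS => -[].
  by have [/Os ->//|/ltnW] := hS _ Sw.
- move=> [Tw h]; rewrite -TS; split => //; rewrite leqNgt; apply/negP => sw.
  have St : S (take s w).
    rewrite -TS; split; last by rewrite size_take_min geq_minl.
    move: Tw; rewrite -{1}(cat_take_drop s w); apply: tree_cat; exact: tree_ok.
  have st : size (take s w) = s by rewrite size_take_min; apply/minn_idPl/ltnW.
  have [tO|] := hS _ St; last by rewrite st ltnn.
  case dw : (drop s w) => [|k u].
    by move: (congr1 size dw); rewrite size_drop /=; lia.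
  have := h (take s w) k u; rewrite -dw cat_take_drop => /(_ erefl).
  by rewrite tO.
- move=> Sw; have := Sw; rewrite -TS => -[Tw _]; split => // o k u e.
  apply/negP => /Os so.
  have [/Os|] := hS _ Sw; rewrite e size_cat so /=; lia.
Qed.

(* The two instances of the induction below: the lower bound, used for a
   measure charging no finite tree, and then the exact value. *)
Definition rel (b : bool) (x y : \bar R) : Prop := if b then x = y else (y <= x)%E.

Lemma rel_series b (x y : nat -> \bar R) : (forall n, 0 <= y n)%E ->
  (forall n, rel b (x n) (y n)) -> rel b (\sum_(n <oo) x n)%E (\sum_(n <oo) y n)%E.
Proof.
case: b => y0 xy; first by apply: eq_eseriesr => n _; exact: xy.
by apply: lee_nneseries => [n _ _|n _]; [exact: y0|exact: xy].
Qed.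

Lemma cylinder_measure_expand (m : {measure set Tsp -> \bar R}) S x O :
  is_tree S -> finite_set S -> openleaves S (x :: O) ->
  m (cylinder S (x :: O)) =
  (\sum_(n <oo) m (cylinder (grow S x n) (O ++ [seq rcons x k | k <- iota 0 n])))%E.
Proof.
move=> tS fS ol; rewrite cylinder_expand// measure_semi_bigcup//.
- by move=> n; apply: measurable_cylinder; exact: finite_grow.
- exact: cylinder_expand_triv.
- apply: bigcupT_measurable => n; apply: measurable_cylinder; exact: finite_grow.
Qed.

Lemma openleaf_neq0 S x O : is_tree S -> openleaves S (x :: O) -> x != [::].
Proof.
move=> [[_ S00] _ _ _ _] [_ _ /(_ [::] 0%N)]; rewrite inE => lx.
by apply/negP => /eqP x0; apply: lx => //; rewrite x0 eqxx.
Qed.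

Section generic.
Variables (m : {measure set Tsp -> \bar R}) (b : bool) (v : R) (s1 : nat).
Hypothesis v0 : 0 <= v.
Hypothesis Hball : forall s S, (s1 <= s)%N -> is_tree S -> finite_set S ->
  tree_height S s -> rel b (m (ball_ev s S)) (nu_ball v s S)%:E.
Hypothesis Hfin : forall S, is_tree S -> finite_set S -> rel b (m (cylinder S [::])) 0%E.

(** Here t bounds by how much the closed part of S may overtake the open level s. At t = 0 the
    cylinder is the ball of radius s, or fixes a finite tree if nothing is open. Otherwise the whole
    open level is opened, which raises s and lowers t by one. *)
Lemma cylinder_rel t s S O : (s1 <= s + t)%N -> (0 < s)%N ->
  is_tree S -> finite_set S -> openleaves S O -> (forall o, o \in O -> size o = s) ->
  (forall w, S w -> w \in O \/ (size w < s + t)%N) ->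
  rel b (m (cylinder S O)) (cyl v s (nedges S) (size O))%:E.
Proof.
elim: t s S O => [|t IH] s S O.
  rewrite addn0 => s1s s0 tS fS ol Os hS.
  case: O ol Os hS => [|x O] ol Os hS; first by rewrite cyl0; exact: Hfin.
  have [uO SO _] := ol.
  rewrite (cylinder_ball tS Os hS).
  have -> : size (x :: O) = ncard [set w | S w /\ size w = s].
    rewrite -(ncard_seq uO); congr ncard; apply/seteqP; split => w /=.
      by move=> wO; split; [exact: SO|exact: Os].
    by move=> [/hS[//|]]; lia.
  rewrite -nu_ballE; apply: Hball => //; split => [w /hS[/Os ->//|/ltnW//]|].
  by exists x; split; [apply: SO|apply: Os]; rewrite mem_head.
move=> s1s s0 tS fS ol Os hS.
(* Intermediate states of one generation: [O] is still to be opened at height s, and [O1] collects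
   the children at height s + 1. *)
suff H O1 : openleaves S (O ++ O1) -> (forall o, o \in O1 -> size o = s.+1) ->
    (forall w, S w -> w \in O ++ O1 \/ (size w < s + t.+1)%N) ->
    rel b (m (cylinder S (O ++ O1))) (cyl2 v s (nedges S) (size O) (size O1)).
  have := H [::]; rewrite cats0 cyl2_l0//; exact.
elim: O S O1 tS fS Os {ol hS} => [|x O IHO] S O1 tS fS Os ol O1s hS.
  rewrite cyl2_0l//; apply: IH => //; first by rewrite addSnnS.
  by move=> w /hS; rewrite addSnnS.
have x0 := openleaf_neq0 tS ol.
have [uO SO lO] := ol.
have lx k : ~ S (rcons x k) by apply: lO; rewrite mem_head.
have Sx : S x by apply: SO; rewrite mem_head.
have [[S0 _] _ _ _ _] := tS.
rewrite /= cylinder_measure_expand// cyl2_step//.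
apply: rel_series => [n|n]; first exact: cyl2_ge0.
rewrite -(nedges_grow n fS S0 lx) -catA.
have -> : (size O1 + n)%N = size (O1 ++ [seq rcons x k | k <- iota 0 n]).
  by rewrite size_cat size_map size_iota.
apply: IHO.
- exact: is_tree_grow.
- exact: finite_grow.
- by move=> o oO; apply: Os; rewrite inE oO orbT.
- by rewrite catA; exact: openleaves_grow.
- move=> o; rewrite mem_cat => /orP[/O1s//|/children_inP[k _ ->]].
  by rewrite size_rcons Os// mem_head.
- move=> w [/hS[]|/children_inP[k kn ->]].
  + rewrite /= inE catA !mem_cat => /orP[/eqP ->|/orP[->|->]]; [right|by left|by left; rewrite orbT].
    by rewrite Os ?mem_head//; lia.
  + by right.
  + by left; rewrite catA mem_cat; apply/orP; right; apply/children_inP; exists k.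
Qed.

End generic.

Lemma tree_height_exists S : is_tree S -> finite_set S ->
  exists2 h, (0 < h)%N & tree_height S h.
Proof.
move=> tS fS; have [[_ S00] _ _ _ _] := tS.
have [n hn] := finite_height fS.
pose P k := `[< exists w, S w /\ size w = k >].
have eP : exists k, P k by exists 1%N; apply/asboolP; exists [:: 0%N].
have bP k : P k -> (k <= n)%N by move=> /asboolP[w [/hn + <-]].
case: (ex_maxnP eP bP) => h /asboolP[w [Sw wh]] mh.
exists h.
  by apply: (mh 1%N); apply/asboolP; exists [:: 0%N].
split; last by exists w.
by move=> u Su; apply: mh; apply/asboolP; exists u.
Qed.

Lemma tops_exists S h : finite_set S -> tree_height S h ->
  exists O, [/\ openleaves S O, forall o, o \in O -> size o = h &
    forall w, S w -> w \in O \/ (size w < h)%N].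
Proof.
move=> fS [hS _]; exists [seq w <- enum_fset (fset_set S) | size w == h]; split.
- split; first by rewrite filter_uniq// fset_uniq.
    by move=> o; rewrite mem_filter => /andP[_]; rewrite in_fset_set// inE.
  move=> o k; rewrite mem_filter => /andP[/eqP sh _] /hS.
  by rewrite size_rcons sh ltnn.
- by move=> o; rewrite mem_filter => /andP[/eqP].
- move=> w Sw; have := hS _ Sw; rewrite leq_eqVlt => /orP[wh|]; last by right.
  by left; rewrite mem_filter wh /= in_fset_set// inE.
Qed.

Section nu.
Variables (nu : R -> probability Tsp R).
Hypothesis Hnu : forall v, 0 < v -> forall s S,
  is_tree S -> finite_set S -> tree_height S s ->
  nu v (ball_ev s S) = (nu_ball v s S)%:E.
Variable v : R.
Hypothesis v_gt0 : 0 < v.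

Lemma nu_finite_tree S : is_tree S -> finite_set S -> nu v (cylinder S [::]) = 0%E.
Proof.
move=> tS fS; have [h h0 hS] := tree_height_exists tS fS.
have [D [ol Oh SO]] := tops_exists fS hS.
have mS : measurable (~` (cylinder S [::])).
  by apply: measurableC; exact: measurable_cylinder.
have mB : measurable (ball_ev h S : set Tsp) by exact: measurable_ball_ev.
have cT (T : tree) : cylinder S [::] T -> tverts T = S.
  by move=> <-; apply/seteqP; split => w; [move=> Tw; split|case].
(* The measure is [nu v] restricted to the trees other than S, and one opened generation (t = 1)
   suffices. *)
have := @cylinder_rel (mrestr (nu v) mS) false v h.+1 (ltW v_gt0) _ _ 1 h S D.
rewrite addn1 leqnn => /(_ _ _ isT h0 tS fS ol Oh).
rewrite (cylinder_ball tS Oh SO).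
have e0 : nu v (ball_ev h S) = (cyl v h (nedges S) (size D))%:E.
  rewrite Hnu// nu_ballE; congr (EFin (cyl _ _ _ _)).
  have [uO SOO _] := ol.
  rewrite -(ncard_seq uO); congr ncard; apply/seteqP; split => w /=.
    by move=> [/SO[//|]]; lia.
  by move=> wO; split; [exact: SOO|exact: Oh].
rewrite -e0 /rel /mrestr /= => H.
have {}H : (nu v (ball_ev h S) <= nu v (ball_ev h S `\` cylinder S [::]))%E.
  rewrite setDE; apply: H.
  - move=> s S' hs tS' fS' hS'; rewrite -Hnu//.
    apply: le_measure; rewrite ?inE; first exact: measurable_ball_ev.
      by apply: measurableI => //; exact: measurable_ball_ev.
    move=> T TS'; split => // /cT TS; have [_ [w [S'w ws]]] := hS'.
    have [hS1 _] := hS; have := hS1 w; rewrite -TS; move: S'w; rewrite -TS' => -[Tw _].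
    by move=> /(_ Tw); lia.
  - by move=> S' _ _; exact: measure_ge0.
  - by move=> w /SO[|]; [left|right; lia].
have bI : ball_ev h S `&` cylinder S [::] = cylinder S [::].
  apply/setIidPr => T /cT TS; apply/seteqP; split => w; first by move=> []; rewrite TS.
  by move=> Sw; split; [rewrite TS|have [/(_ _ Sw)] := hS].
have := measureDI (nu v) mB (measurable_cylinder [::] fS); rewrite bI => e.
apply/eqP; rewrite eq_le measure_ge0 andbT.
have fin1 : nu v (ball_ev h S `\` cylinder S [::]) \is a fin_num.
  apply: fin_num_measure; apply: measurableD => //; exact: measurable_cylinder.
by rewrite -(leeD2lE _ _ fin1) adde0 -e.
Qed.

(** Since finite trees are now known to be null, both inputs of [cylinder_rel] hold with
    equality. *)
Theorem nu_cylinder s S O : (0 < s)%N -> is_tree S -> finite_set S ->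
  openleaves S O -> (forall o, o \in O -> size o = s) ->
  nu v (cylinder S O) = (cyl v s (nedges S) (size O))%:E.
Proof.
move=> s0 tS fS ol Os; have [n hn] := finite_height fS.
apply: (@cylinder_rel (nu v) true v 0 (ltW v_gt0) _ _ n.+1 s S O) => //.
- by move=> s' S' _ tS' fS' hS'; exact: Hnu.
- by move=> S'; exact: nu_finite_tree.
- by move=> w /hn wn; right; lia.
Qed.

End nu.
End CylinderMeasure.

(** * Survival of open vertices *)

Section Survival.
Variable R : realType.
Implicit Types (v : R) (S : set word) (O Z : seq word) (s t : nat).

(* 'X^k |-> v^(k-1) / (k-1)!, the constant coefficient being ignored. *)
Definition Lam v (p : {poly R}) : R := \sum_(k < size p) p`_k * cw v k.

Lemma LamE v (p : {poly R}) n : (size p <= n)%N ->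
  Lam v p = \sum_(k < n) p`_k * cw v k.
Proof.
move=> pn; rewrite /Lam -(subnKC pn) big_split_ord/= [X in _ + X]big1 ?addr0// => i _.
by rewrite nth_default ?mul0r// leq_addr.
Qed.

Lemma LamB v p q : Lam v (p - q) = Lam v p - Lam v q.
Proof.
pose n := maxn (size p) (size q).
have sz : (size (p - q)%R <= n)%N by rewrite (leq_trans (size_polyD _ _))// size_polyN.
rewrite (LamE _ sz) (@LamE _ p n) ?leq_maxl// (@LamE _ q n) ?leq_maxr//.
by rewrite -sumrB; apply: eq_bigr => i _; rewrite coefB mulrBl.
Qed.

Lemma binw_Lam v L : binw v L = Lam v ((1 + 'X) ^+ L).
Proof.
have e : (1 + 'X) ^+ L = \poly_(k < L.+1) ('C(L, k)%:R : R).
  rewrite exprDn poly_def; apply: eq_bigr => k _.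
  by rewrite expr1n mul1r scaler_nat.
rewrite e (LamE _ (size_poly _ _)); apply: eq_bigr => k _.
by rewrite coef_poly ltn_ord.
Qed.

(** The solution of b_0 = 0, b_(t+1) = 1 / (1 - b_t / 4): the recursion sums over the number of
    children, each costing one edge (1/4) and having to die within t generations. The scale is such
    that b_1 = 1, the weight of a vertex closed as a leaf. *)
Definition bt t : R := (2 * t%:R) / t.+1%:R.

Lemma bt_ge0 t : 0 <= bt t.
Proof. by rewrite /bt divr_ge0// mulr_ge0. Qed.

Lemma bt_lt2 t : bt t < 2.
Proof. by rewrite /bt ltr_pdivrMr// ltr_pM2l// ltr_nat. Qed.

Lemma bt_series t : (\sum_(n <oo) ((bt t / 4) ^+ n)%:E)%E = (bt t.+1)%:E :> \bar R.
Proof.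
have b2 := bt_lt2 t; have b0 := bt_ge0 t.
have -> : bt t.+1 = (1 * (1 - bt t / 4)^-1).
  have t0 : 0 <= t%:R :> R by [].
  rewrite /bt -!natr1; field.
  by apply/and3P; split; apply: lt0r_neq0; lra.
rewrite -(@eseries_EFin _ (geometric 1 (bt t / 4))).
  by apply: eq_eseriesr => n _; rewrite /= mul1r.
by apply: cvg_geometric_series; rewrite ger0_norm; lra.
Qed.

Lemma cvg_bt : bt @ \oo --> (2 : R).
Proof.
have -> : bt = fun t => 2 - 2 * t.+1%:R^-1.
  apply/funext => t; have t0 : 0 <= t%:R :> R by [].
  by rewrite /bt -natr1; field; apply: lt0r_neq0; lra.
rewrite -[X in _ --> X]subr0; apply: cvgB; first exact: cvg_cst.
have := cvgM (@cvg_cst R (2 : R) nat \oo _) (@cvg_harmonic R).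
by rewrite mulr0; apply.
Qed.

Lemma cylD v s e n L : cyl v s (e + n) L = cyl v s e L / 4 ^+ n.
Proof. by rewrite /cyl exprD invfM; ring. Qed.

Definition dieall t Z : set Tsp := [set T : tree | forall z, z \in Z -> die t z T].

Lemma measurable_dieall t Z : measurable (dieall t Z).
Proof.
elim: Z => [|z Z IH].
  by rewrite (_ : dieall _ _ = setT)//; apply/seteqP; split.
rewrite (_ : dieall _ _ = [set T : tree | die t z T] `&` dieall t Z).
  by apply: measurableI => //; exact: measurable_die.
apply/seteqP; split => T.
  by move=> h; split => [|y yZ]; apply: h; rewrite inE ?eqxx ?yZ ?orbT.
by move=> [h1 h2] y; rewrite inE => /orP[/eqP ->//|/h2].
Qed.

Section nu.
Variables (nu : R -> probability Tsp R).
Hypothesis Hnu : forall v, 0 < v -> forall s S,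
  is_tree S -> finite_set S -> tree_height S s ->
  nu v (ball_ev s S) = (nu_ball v s S)%:E.
Variable v : R.
Hypothesis v_gt0 : 0 < v.

(** The vertices of [Z2] are opened one at a time and their children, which have one generation less
    to live, join [Z1]. Only [O] has to lie at height s: the doomed vertices may have any height,
    which is what allows children and parents to be mixed. *)
Lemma nu_dieall_step t s S Z2 O Z1 : (0 < s)%N ->
  (forall S O Z, is_tree S -> finite_set S -> openleaves S (O ++ Z) ->
     (forall o, o \in O -> size o = s) ->
     nu v (cylinder S (O ++ Z) `&` dieall t Z) =
     (cyl v s (nedges S) (size O) * bt t ^+ size Z)%:E) ->
  is_tree S -> finite_set S -> openleaves S (Z2 ++ (O ++ Z1)) ->
  (forall o, o \in O -> size o = s) ->
  nu v (cylinder S (Z2 ++ (O ++ Z1)) `&` (dieall t Z1 `&` dieall t.+1 Z2)) =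
  (cyl v s (nedges S) (size O) * bt t ^+ size Z1 * bt t.+1 ^+ size Z2)%:E.
Proof.
move=> s0 H; elim: Z2 S Z1 => [|x Z2 IH] S Z1 tS fS ol Os.
  rewrite expr0 mulr1 -H//; congr (nu v (_ `&` _)).
  by apply/seteqP; split => T; [case|move=> h; split].
have x0 := openleaf_neq0 tS ol.
have [uO SO lO] := ol.
have lx k : ~ S (rcons x k) by apply: lO; rewrite mem_head.
have Sx : S x by apply: SO; rewrite mem_head.
have [[S0 _] _ _ _ _] := tS.
pose ch n := [seq rcons x k | k <- iota 0 n].
pose P n := cylinder (grow S x n) (Z2 ++ (O ++ (Z1 ++ ch n))) `&`
            (dieall t (Z1 ++ ch n) `&` dieall t.+1 Z2).
have PE : cylinder S ((x :: Z2) ++ (O ++ Z1)) `&` (dieall t Z1 `&` dieall t.+1 (x :: Z2))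
    = \bigcup_n P n.
  rewrite /= cylinder_expand// setI_bigcupl; apply: eq_bigcupr => n _.
  rewrite -!catA /P; apply/seteqP; split => T [TS [d1 d2]].
    split => //; split; last by move=> z zZ; apply: d2; rewrite inE zZ orbT.
    move=> z; rewrite mem_cat => /orP[/d1//|/children_inP[k kn ->]].
    have := d2 x; rewrite mem_head => /(_ isT)/(dieS _ (tree_ok T) x0); apply.
    have TS' : cylinder (grow S x n) ((Z2 ++ O ++ Z1) ++ ch n) T by rewrite -!catA.
    exact: ((cylinder_children ol TS' k).2 kn).
  split => //; split; first by move=> z zZ; apply: d1; rewrite mem_cat zZ.
  move=> z; rewrite inE => /orP[/eqP ->|/d2//].
  apply/(dieS _ (tree_ok T) x0) => k Tk; apply: d1; rewrite mem_cat; apply/orP; right.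
  apply/children_inP; exists k => //; move: Tk.
  have TS' : cylinder (grow S x n) ((Z2 ++ O ++ Z1) ++ ch n) T by rewrite -!catA.
  exact: (cylinder_children ol TS' k).1.
have mP n : measurable (P n).
  apply: measurableI; last by apply: measurableI; exact: measurable_dieall.
  by apply: measurable_cylinder; exact: finite_grow.
have tP : trivIset setT P.
  apply/trivIsetP => i j _ _ ij; rewrite -subset0 => T [[Ti _] [Tj _]].
  have /trivIsetP/(_ i j I I ij) := cylinder_expand_triv ol.
  by rewrite -subset0 => /(_ T); apply; split; rewrite -!catA.
rewrite PE measure_semi_bigcup//; last exact: bigcupT_measurable.
transitivity (\sum_(n <oo) ((cyl v s (nedges S) (size O) * bt t ^+ size Z1 * bt t.+1 ^+ size Z2)%:E *
   ((bt t / 4) ^+ n)%:E) : \bar R)%E.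
  apply: eq_eseriesr => n _; apply: (etrans (IH _ _ _ _ _ _)) => //.
  - exact: is_tree_grow.
  - exact: finite_grow.
  - by have := openleaves_grow n tS ol; rewrite -!catA.
  - rewrite -EFinM; congr EFin; rewrite nedges_grow// cylD.
    by rewrite size_cat size_map size_iota exprD [(_ / 4) ^+ n]expr_div_n; ring.
rewrite nneseriesZl => [|n _]; last by rewrite lee_fin exprn_ge0// divr_ge0// bt_ge0.
by rewrite bt_series -EFinM exprS; congr EFin; ring.
Qed.

Lemma nu_dieall t s S O Z : (0 < s)%N ->
  is_tree S -> finite_set S -> openleaves S (O ++ Z) ->
  (forall o, o \in O -> size o = s) ->
  nu v (cylinder S (O ++ Z) `&` dieall t Z) =
  (cyl v s (nedges S) (size O) * bt t ^+ size Z)%:E.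
Proof.
move=> s0; elim: t S O Z => [|t IH] S O Z tS fS ol Os.
  (* No vertex dies within 0 generations, so the event is empty unless [Z] is; this matches
     [bt 0 = 0] and 0^0 = 1. *)
  case: Z ol => [|z Z] ol.
    rewrite cats0 expr0 mulr1 in ol *.
    rewrite (_ : _ `&` _ = cylinder S O); last by apply/seteqP; split => T; [case|split].
    exact: (nu_cylinder Hnu).
  rewrite (_ : _ `&` _ = set0) ?measure0; last first.
    rewrite -subset0 => T [TS] /(_ z); rewrite mem_head => /(_ isT [::] isT).
    rewrite cats0; apply; suff [] : prune (O ++ z :: Z) T z by [].
    by rewrite TS; have [_ h _] := ol; apply: h; rewrite mem_cat mem_head orbT.
  by rewrite /bt mulr0 mul0r exprS mul0r mulr0.
have [u1 u2 u3] := ol.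
have pe : Z ++ (O ++ [::]) =i O ++ Z by move=> w; rewrite cats0 !mem_cat orbC.
have ol' : openleaves S (Z ++ (O ++ [::])).
  split; first by rewrite cats0 uniq_catC.
    by move=> o; rewrite pe; exact: u2.
  by move=> o k; rewrite pe; exact: u3.
have := nu_dieall_step s0 IH tS fS ol' Os.
rewrite expr0 mulr1 => <-; congr (nu v (_ `&` _)).
  by apply/seteqP; split => T; rewrite /cylinder /= (eq_prune _ pe).
by apply/seteqP; split => T; [split|case].
Qed.

Definition finall Z : set Tsp := [set T : tree | forall z, z \in Z -> ~ infdesc z T].

Lemma finallE Z : finall Z = \bigcup_t dieall t Z.
Proof.
apply/seteqP; split => T; last first.
  by move=> [t _ h] z /h dz; apply/(finite_die _ (tree_ok T)); exists t.
elim: Z => [|z Z IH] h; first by exists 0%N.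
have [|t _ ht] := IH; first by move=> y yZ; apply: h; rewrite inE yZ orbT.
have /(finite_die _ (tree_ok T))[t' ht'] : ~ infdesc z T by apply: h; rewrite mem_head.
exists (maxn t t') => // y; rewrite inE => /orP[/eqP ->|/ht].
  by apply: die_mono ht'; rewrite leq_maxr.
by apply: die_mono; rewrite leq_maxl.
Qed.

Lemma measurable_finall Z : measurable (finall Z).
Proof. by rewrite finallE; apply: bigcupT_measurable => t; exact: measurable_dieall. Qed.

Lemma nu_finall s S O Z : (0 < s)%N ->
  is_tree S -> finite_set S -> openleaves S (O ++ Z) ->
  (forall o, o \in O -> size o = s) ->
  nu v (cylinder S (O ++ Z) `&` finall Z) =
  (cyl v s (nedges S) (size O) * 2 ^+ size Z)%:E.
Proof.
move=> s0 tS fS ol Os.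
have mF t : measurable (cylinder S (O ++ Z) `&` dieall t Z).
  by apply: measurableI; [exact: measurable_cylinder|exact: measurable_dieall].
rewrite finallE setI_bigcupr.
apply: (@cvg_unique _ _ ((fun t => nu v (cylinder S (O ++ Z) `&` dieall t Z)) @ \oo)) => //.
  apply: nondecreasing_cvg_mu => //; first exact: bigcupT_measurable.
  move=> t t' tt'; apply/subsetPset => T [TS dT]; split => // z /dT.
  exact: die_mono.
rewrite (_ : (fun t => _) = fun t => (cyl v s (nedges S) (size O) * bt t ^+ size Z)%:E); last first.
  by apply/funext => t; exact: nu_dieall.
apply: cvg_EFin; first by apply: nearW.
apply: cvgM; first exact: cvg_cst.
have : (fun t => bt t ^+ size Z) @ \oo --> (2 : R) ^+ size Z.
  apply: (@cvg_comp _ _ _ bt (fun x => x ^+ size Z)); first exact: cvg_bt.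
  exact: exprn_continuous.
exact.
Qed.

Definition infgroups (l : seq (seq word)) : set Tsp :=
  [set T : tree | forall G, G \in l -> exists2 z, z \in G & infdesc z T].

Lemma infgroups_cons G l : infgroups (G :: l) = infgroups l `\` finall G.
Proof.
apply/seteqP; split => T.
  move=> h; split => [G' G'l|fG]; first by apply: h; rewrite inE G'l orbT.
  by have [|z zG iz] := h G; [rewrite mem_head|apply: (fG z)].
move=> [h nf] G'; rewrite inE => /orP[/eqP ->|/h//].
apply: contrapT => nz; apply: nf => z zG iz; apply: nz; by exists z.
Qed.

Lemma measurable_infgroups l : measurable (infgroups l).
Proof.
elim: l => [|G l IH].
  by rewrite (_ : infgroups _ = setT)//; apply/seteqP; split.
by rewrite infgroups_cons; apply: measurableD => //; exact: measurable_finall.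
Qed.

(** The event for [G :: l] is the event with G free minus the event with G doomed. For the induction
    G is moved to the unrestricted list [O], contributing (1 + 'X)^|G|, or to the doomed list [Z],
    contributing 1; the power of 2 is the same in both cases. *)
Lemma nu_infgroups_gen s S l O Z : (0 < s)%N ->
  is_tree S -> finite_set S -> openleaves S (O ++ flatten l ++ Z) ->
  (forall o, o \in O ++ flatten l -> size o = s) ->
  nu v (cylinder S (O ++ flatten l ++ Z) `&` (finall Z `&` infgroups l)) =
  (expR (- v * s.-1%:R) / 4 ^+ nedges S * 2 ^+ (size (O ++ flatten l ++ Z)).+1 *
   Lam v ((1 + 'X) ^+ size O * \prod_(G <- l) ((1 + 'X) ^+ size G - 1)))%:E.
Proof.
move=> s0 tS fS; elim: l O Z => [|G l IH] O Z ol Os.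
  rewrite big_nil mulr1 (_ : _ `&` infgroups _ = finall Z); last first.
    by apply/seteqP; split => T; [case|split].
  rewrite (nu_finall s0)//; last by rewrite /= cats0 in Os.
  by rewrite /cyl binw_Lam /= size_cat -addSn [2 ^+ (_ + _)]exprD; congr EFin; ring.
have pe1 : (O ++ G) ++ flatten l ++ Z =i O ++ flatten (G :: l) ++ Z.
  by move=> w; rewrite /= -!catA.
have pe2 : O ++ flatten l ++ (G ++ Z) =i O ++ flatten (G :: l) ++ Z.
  by move=> w; rewrite /= !mem_cat; do !case: (_ \in _).
have ol1 : openleaves S ((O ++ G) ++ flatten l ++ Z) by move: ol; rewrite /= -!catA.
have ol2 : openleaves S (O ++ flatten l ++ (G ++ Z)).
  have [u1 u2 u3] := ol; split.
  - rewrite (perm_uniq (_ : perm_eq _ (O ++ flatten (G :: l) ++ Z)))//.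
    by rewrite perm_cat2l /= -catA perm_catCA.
  - by move=> o; rewrite pe2; exact: u2.
  - by move=> o k; rewrite pe2; exact: u3.
have Os1 o : o \in (O ++ G) ++ flatten l -> size o = s.
  by rewrite -catA; exact: Os.
have Os2 o : o \in O ++ flatten l -> size o = s.
  by move=> h; apply: Os; move: h; rewrite /= !mem_cat => /orP[->//|->]; rewrite !orbT.
have e1 := IH _ _ ol1 Os1; have e2 := IH _ _ ol2 Os2.
set A := cylinder S _ `&` _ in e1; set B := cylinder S _ `&` _ in e2.
have mA : measurable A.
  apply: measurableI; first exact: measurable_cylinder.
  by apply: measurableI; [exact: measurable_finall|exact: measurable_infgroups].
have BE : B = A `&` finall G.
  rewrite /A /B; apply/seteqP; split => T.
    move=> [TS [fZ il]]; split; last by move=> z zG; apply: fZ; rewrite mem_cat zG.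
    split; first by rewrite /cylinder /= (eq_prune _ pe1) -(eq_prune _ pe2).
    by split => // z zZ; apply: fZ; rewrite mem_cat zZ orbT.
  move=> [[TS [fZ il]] fG]; split.
    by move: TS; rewrite /cylinder /= (eq_prune _ pe2) => <-; apply: eq_prune => w; rewrite /= -!catA.
  by split => // z; rewrite mem_cat => /orP[/fG|/fZ].
rewrite (_ : _ `&` _ = A `\` finall G); last first.
  rewrite infgroups_cons /A; apply/seteqP; split => T.
    move=> [TS [fZ [il nf]]]; split => //; split => //.
    by move: TS; rewrite /cylinder /= => <-; apply: eq_prune => w; rewrite /= -!catA.
  move=> [[TS [fZ il]] nf]; split => //.
  by move: TS; rewrite /cylinder /= => <-; apply: eq_prune => w; rewrite /= -!catA.
apply: (etrans (measureD (mu := nu v) mA (measurable_finall G) _)).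
  by rewrite ltey_eq fin_num_measure.
rewrite -BE; apply: (etrans (f_equal2 (fun a b : \bar R => a - b)%E e1 e2)).
rewrite -EFinB big_cons mulrBl mul1r mulrBr LamB; congr EFin.
have -> : size (O ++ flatten l ++ G ++ Z) = size (O ++ (G ++ flatten l) ++ Z).
  by rewrite !size_cat; lia.
have -> : size ((O ++ G) ++ flatten l ++ Z) = size (O ++ (G ++ flatten l) ++ Z).
  by rewrite !size_cat; lia.
by rewrite -mulrBr [size (O ++ G)]size_cat exprD mulrA.
Qed.

Theorem nu_infgroups s S l : (0 < s)%N ->
  is_tree S -> finite_set S -> openleaves S (flatten l) ->
  (forall o, o \in flatten l -> size o = s) ->
  nu v (cylinder S (flatten l) `&` infgroups l) =
  (expR (- v * s.-1%:R) / 4 ^+ nedges S * 2 ^+ (size (flatten l)).+1 *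
   Lam v (\prod_(G <- l) ((1 + 'X) ^+ size G - 1)))%:E.
Proof.
move=> s0 tS fS ol Os.
have := @nu_infgroups_gen s S l [::] [::] s0 tS fS; rewrite /= cats0 => /(_ ol Os).
rewrite expr0 mul1r => <-; congr (nu v (_ `&` _)).
by apply/seteqP; split => T; [split|case].
Qed.

End nu.
End Survival.

(** * Grafting and the total mass of rho *)

Lemma ncard_image (T U : choiceType) (f : T -> U) (A : set T) :
  {in A &, injective f} -> finite_set A -> ncard (f @` A) = ncard A.
Proof.
move=> fi fA; rewrite /ncard fset_set_image// card_in_imfset//= => x y.
by rewrite !in_fset_set//; exact: fi.
Qed.

Lemma ncard_set1 (T : choiceType) (x : T) : ncard [set x] = 1%N.
Proof. by rewrite /ncard fset_set1 cardfs1. Qed.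

Lemma cat_comparable (o w : word) k u v : o ++ k :: u = w ++ v ->
  (exists z, w = o ++ z) \/ (exists j z, o = w ++ j :: z).
Proof.
elim: o w => [|a o IH] [|b w] /=.
- by move=> _; left; exists [::].
- by move=> _; left; exists (b :: w).
- by move=> _; right; exists a, o.
- by move=> [-> /IH[[z ->]|[j [z ->]]]]; [left; exists z|right; exists j, z].
Qed.

Lemma is_tree_Bball (X : set word) s : is_tree X -> (0 < s)%N -> is_tree (Bball s X).
Proof.
move=> tX s0; have [[X0 X00] X1 pX sX fX] := tX; split.
- by split; split.
- by case.
- move=> w k [/pX Xw]; rewrite size_rcons => /ltnW ws; by split.
- by move=> w k [/sX Xw]; rewrite !size_rcons => ws; split => //; rewrite size_rcons.
- by move=> w [/fX[n hn] _]; exists n => -[].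
Qed.

Section Graft.
Implicit Types (S U : set word) (x w u : word) (O : seq word).

(** The root edge of the planted tree U is identified with the edge from x to its parent, whence the
    words [0 :: u]; the edge counts of S and U therefore overlap in one edge. *)
Definition graft S x U : set word := S `|` [set w | exists2 u, U (0%N :: u) & w = x ++ u].

Lemma is_tree_graft S x U : is_tree S -> x != [::] -> S x ->
  (forall k, ~ S (rcons x k)) -> is_tree U -> is_tree (graft S x U).
Proof.
move=> tS x0 Sx lx tU.
have [[S0 S00] S1 pS sS fS] := tS; have [_ _ pU sU fU] := tU; split.
- by split; left.
- case=> // -[u _]; case: x x0 Sx lx => // a x _ Sx _ [a1 /esym/eqP].
  by case: x Sx => // Sx _; apply: S1; rewrite a1.
- move=> w k [/pS|[u]]; first by left.
  elim/last_ind: u => [|u j _] Uu; first by rewrite cats0 => xe; left; apply: (pS _ k); rewrite xe.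
  rewrite -rcons_cat => /rcons_inj[-> _]; right; exists u => //.
  by apply: (pU _ j).
- move=> w k [/sS|[u]]; first by left.
  elim/last_ind: u => [|u j _] Uu; first by rewrite cats0 => xe; left; apply: (sS _ k); rewrite xe.
  rewrite -rcons_cat => /rcons_inj[-> kj]; right; exists (rcons u k); last by rewrite rcons_cat.
  by apply: (sU (0%N :: u) k); rewrite /= kj.
- move=> w; have [[u [Uu we]] _|nx] := pselect (exists u, U (0%N :: u) /\ w = x ++ u).
    have [n hn] := fU _ Uu; exists n; rewrite we rcons_cat => -[|[u' Uu' /eqP]].
      by case: (u) => [|j v]; [rewrite /= cats1 => /lx|exact: leaf_cat].
    by rewrite eqseq_cat// eqxx => /eqP ue; apply: hn; rewrite /= ue.
  move=> [Sw|[u Uu we]]; last by exfalso; apply: nx; exists u.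
  have [n hn] := fS _ Sw; exists n => -[//|[u]].
  elim/last_ind: u => [|u j _] Uu; first by rewrite cats0 => xe; apply: hn; rewrite xe.
  rewrite -rcons_cat => /rcons_inj[we _]; apply: nx; exists u; split => //.
  by apply: (pU _ j).
Qed.

Lemma finite_graft S x U : finite_set S -> finite_set U -> finite_set (graft S x U).
Proof.
move=> fS fU; rewrite finite_setU; split => //.
apply: (@sub_finite_set _ _ ((fun u => x ++ behead u) @` U)); last exact: finite_image.
by move=> w [u Uu ->]; exists (0%N :: u).
Qed.

Lemma ncard_tree U : is_tree U -> finite_set U ->
  ncard U = (ncard [set u | u != [::] /\ U (0%N :: u)]).+2.
Proof.
move=> tU fU; have [[U0 U00] _ _ _ _] := tU.
have UE : U = [set [::]] `|` ([set [:: 0%N]] `|` cons 0%N @` [set u | u != [::] /\ U (0%N :: u)]).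
  apply/seteqP; split => u.
    move=> Uu; have [->|u0] := eqVneq u [::]; first by left.
    have [[|a u'] ue] := tree_root tU Uu u0; first by right; left.
    by right; right; exists (a :: u') => //; split => //; rewrite -ue.
  by case=> [->//|[->//|[u' [_ Uu] <-]]].
have fV : finite_set [set u | u != [::] /\ U (0%N :: u)].
  apply: (@sub_finite_set _ _ (behead @` U)); last exact: finite_image.
  by move=> u [_ Uu]; exists (0%N :: u).
rewrite {1}UE ncardU//; last 2 first.
- by rewrite finite_setU; split => //; exact: finite_image.
- by rewrite -subset0 => u [->] [|[]].
rewrite ncardU//; last 2 first.
- exact: finite_image.
- by rewrite -subset0 => u [->] [v [v0 _] [/eqP]]; rewrite (negbTE v0).
by rewrite !ncard_set1 ncard_image// => u v _ _ [].
Qed.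

Lemma nedges_graft S x U : is_tree S -> S x -> finite_set S ->
  (forall k, ~ S (rcons x k)) -> is_tree U -> finite_set U ->
  (nedges (graft S x U)).+1 = (nedges S + nedges U)%N.
Proof.
move=> tS Sx fS lx tU fU.
have fV : finite_set [set u | u != [::] /\ U (0%N :: u)].
  apply: (@sub_finite_set _ _ (behead @` U)); last exact: finite_image.
  by move=> u [_ Uu]; exists (0%N :: u).
have [[U0 U00] _ _ _ _] := tU; have [[S0 S00] _ _ _ _] := tS.
have gE : graft S x U = S `|` cat x @` [set u | u != [::] /\ U (0%N :: u)].
  apply/seteqP; split => w; (case=> [Sw|]; first by left).
    move=> [u Uu ->]; have [->|u0] := eqVneq u [::]; first by left; rewrite cats0.
    by right; exists u.
  by move=> [u [_ Uu] <-]; right; exists u.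
rewrite /nedges gE ncardU//; last 2 first.
- exact: finite_image.
- rewrite -subset0 => w [Sw [[|k u] [//= _ _] we]].
  by move: Sw; rewrite -we; exact: leaf_cat.
rewrite ncard_image// => [|u v _ _ /eqP]; last by rewrite eqseq_cat// eqxx => /eqP.
rewrite (ncard_tree tU fU) (ncard_tree tS fS) /=; lia.
Qed.

Lemma openleaf_incomparable S O x o k u v : is_tree S -> openleaves S (x :: O) ->
  o \in O -> o ++ k :: u <> x ++ v.
Proof.
move=> tS [uO SO lO] oO e.
have Sx : S x by apply: SO; rewrite mem_head.
have So : S o by apply: SO; rewrite inE oO orbT.
have lx j : ~ S (rcons x j) by apply: lO; rewrite mem_head.
have lo j : ~ S (rcons o j) by apply: lO; rewrite inE oO orbT.
have [[[|j z]]|[j [z oe]]] := cat_comparable e.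
- by rewrite cats0 => xo; move: uO; rewrite /= xo oO.
- by move=> xe; apply: (@leaf_cat S o j z tS lo); rewrite -xe; exact: Sx.
- by apply: (@leaf_cat S x j z tS lx); rewrite -oe; exact: So.
Qed.

Lemma openleaves_graft S x O U : is_tree S -> openleaves S (x :: O) ->
  openleaves (graft S x U) O.
Proof.
move=> tS ol; have [/andP[xO uO] SO lO] := ol; split => //.
- by move=> o oO; left; apply: SO; rewrite inE oO orbT.
- move=> o k oO [|[u Uu]]; first by apply: lO; rewrite inE oO orbT.
  by rewrite -cats1; exact: openleaf_incomparable ol oO.
Qed.

Lemma cylinder_graft S x O U : is_tree S -> openleaves S (x :: O) -> is_tree U ->
  cylinder S (x :: O) `&` [set T : tree | plant T x = U] = cylinder (graft S x U) O.
Proof.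
move=> tS ol tU; have [uO SO lO] := ol; have [[U0 U00] _ _ _ _] := tU.
have Sx : S x by apply: SO; rewrite mem_head.
have lx j : ~ S (rcons x j) by apply: lO; rewrite mem_head.
apply/seteqP; split => T.
  move=> [TS TU]; have UT u : U (0%N :: u) <-> tverts T (x ++ u).
    rewrite -TU; split => [[//|[u' [[->]]]]//|Tu]; by right; exists u.
  apply/seteqP; split => w.
    move=> [Tw h]; have [[k [u we]]|nx] := pselect (exists k u, w = x ++ k :: u).
      by right; exists (k :: u) => //; apply/UT; rewrite -we.
    left; rewrite -TS; split => // o k u we; rewrite inE negb_or (h _ _ _ we) andbT.
    by apply/negP => /eqP oe; apply: nx; exists k, u; rewrite -oe.
  case=> [Sw|[u /UT Tu ->]].
    have [Tw h] : prune (x :: O) T w by rewrite TS.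
    by split => // o k u /h; rewrite inE negb_or => /andP[].
  split => // o k v e; apply/negP => oO.
  exact: (openleaf_incomparable tS ol oO (esym e)).
move=> TG; split.
  apply/seteqP; split => w.
    move=> [Tw h]; have : graft S x U w.
      by rewrite -TG; split => // o k u /h; rewrite inE negb_or => /andP[].
    case=> // -[[|k u] _ we]; first by rewrite we cats0.
    by have := h x k u we; rewrite mem_head.
  move=> Sw; have [Tw h] : prune O T w by rewrite TG; left.
  split => // o k u we; rewrite inE negb_or (h _ _ _ we) andbT.
  by apply/negP => /eqP oe; move: Sw; rewrite we oe; exact: leaf_cat.
have Tg w : graft S x U w -> tverts T w by rewrite -TG => -[].
apply/seteqP; split => u.
  move=> [->//|[u' [-> Tu]]].
  have : graft S x U (x ++ u').
    rewrite -TG; split => // o k v e; apply/negP => oO.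
    exact: (openleaf_incomparable tS ol oO (esym e)).
  case=> [|[v Uv /eqP]]; last by rewrite eqseq_cat// eqxx => /eqP ->.
  by case: u' {Tu} => [//|j u'] /= /leaf_cat; case.
move=> Uu; have [->|u0] := eqVneq u [::]; first by left.
have [u' ue] := tree_root tU Uu u0; right; exists u'; split => //.
by apply: Tg; right; exists u' => //; rewrite -ue.
Qed.

Lemma is_tree_plant (T : tree) x : tverts T x -> is_tree (plant T x).
Proof.
move=> Tx; have tT := tree_ok T; have [_ _ pT sT fT] := tT; split.
- by split; [left|right; exists [::]; rewrite cats0].
- by case=> // -[u []].
- move=> w k [/eqP|]; first by rewrite -size_eq0 size_rcons.
  case: w => [|a w]; first by left.
  move=> [u [/= [-> ue] Tu]]; right; exists w; split => //.
  by apply: (pT _ k); rewrite rcons_cat ue.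
- move=> w k [/eqP|]; first by rewrite -size_eq0 size_rcons.
  case: w => [|a w]; first by move=> [u []].
  move=> [u [/= [-> ue] Tu]]; right; exists (rcons w k); split => //.
  by rewrite -rcons_cat; apply: sT; rewrite rcons_cat ue.
- move=> w [->|[u [-> Tu]]]; first by exists 1%N => -[//|[u []]].
  have [n hn] := fT _ Tu; exists n => -[//|[u' [[ue] Tu']]].
  by apply: hn; rewrite rcons_cat ue.
Qed.

Lemma finite_plant (T : tree) x : finite_set (plant T x) <-> ~ infdesc x T.
Proof.
rewrite /infdesc notK; split => fP.
  apply: (@sub_finite_set _ _ (behead @` plant T x)); last exact: finite_image.
  by move=> u Tu; exists (0%N :: u) => //; right; exists u.
apply: (@sub_finite_set _ _ ([set [::]] `|` cons 0%N @` [set u | tverts T (x ++ u)])).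
  by move=> w [->|[u [-> Tu]]]; [left|right; exists u].
by rewrite finite_setU; split => //; exact: finite_image.
Qed.

End Graft.

Section Countable.
Variable R : realType.

Definition csum (I : countType) (f : I -> \bar R) : \bar R :=
  (\sum_(n <oo) oapp f 0 (pickle_inv n))%E.

Lemma csumZl (I : countType) (f : I -> \bar R) (x : R) : (forall i, 0 <= f i)%E ->
  csum (fun i => x%:E * f i)%E = (x%:E * csum f)%E.
Proof.
move=> f0; rewrite /csum -nneseriesZl; last by move=> n _; case: pickle_inv => /=.
by apply: eq_eseriesr => n _; case: pickle_inv => //=; rewrite mule0.
Qed.

Lemma eq_csum (I : countType) (f g : I -> \bar R) : f =1 g -> csum f = csum g.
Proof. by move=> fg; apply: eq_eseriesr => n _; case: pickle_inv => /=. Qed.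

Lemma measure_csum d (X : measurableType d) (m : {measure set X -> \bar R})
    (I : countType) (A : I -> set X) :
  (forall i, measurable (A i)) -> trivIset setT A ->
  m (\bigcup_i A i) = csum (fun i => m (A i)).
Proof.
move=> mA tA; pose B n := oapp A set0 (pickle_inv n).
have -> : \bigcup_i A i = \bigcup_n B n.
  apply/seteqP; split => x [i _].
    by move=> Ax; exists (choice.pickle i) => //; rewrite /B pickleK_inv.
  by rewrite /B; case: pickle_inv => //= j Aj; exists j.
have mB n : measurable (B n) by rewrite /B; case: pickle_inv => [i|] /=; [exact: mA|exact: measurable0].
rewrite measure_semi_bigcup//; last exact: bigcupT_measurable.
  by apply: eq_eseriesr => n _; rewrite /B; case: pickle_inv => //=; rewrite measure0.
apply/trivIsetP => i j _ _ ij; rewrite /B.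
case ei : (pickle_inv i) => [a|]; last by rewrite set0I.
case ej : (pickle_inv j) => [b|]; last by rewrite setI0.
move/trivIsetP: tA; apply => //; apply: contra ij => /eqP ab.
have := @pickle_invK I i; have := @pickle_invK I j.
by rewrite ei ej /= ab => -> ->.
Qed.

End Countable.

Section RhoMass.
Variable R : realType.
Variables (nu : R -> probability Tsp R).
Hypothesis Hnu : forall v, 0 < v -> forall s S,
  is_tree S -> finite_set S -> tree_height S s ->
  nu v (ball_ev s S) = (nu_ball v s S)%:E.

Lemma cyl1_gt0 (v : R) s e : 0 < cyl v s e 1.
Proof.
rewrite /cyl /binw !big_ord_recl big_ord0 /= mulr0 add0r addr0 expr0 fact0.
by rewrite bin1 mul1r divr1 mulr1 !mulr_gt0 ?expR_gt0// ?invr_gt0 exprn_gt0.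
Qed.

Lemma rho_ge0 (X : set word) : 0 <= rho R X.
Proof. by rewrite /rho; case: ifP => // _; rewrite divr_ge0. Qed.

(* Both sides below compute the probability that one of two given siblings has
   finite progeny: on the right by enumerating the finite subtree. *)
Lemma rho_mass : csum (fun U : {fset word} => (rho R [set` U])%:E) = 1%E.
Proof.
(* The subtree at x is enumerated while y stays open. Without an open vertex both computations would
   give 0, since finite trees are null, and nothing could be cancelled. *)
pose x : word := [:: 0; 0]%N; pose y : word := [:: 0; 1]%N.
pose S0 := Bball 1 path_verts.
have tS0 : is_tree S0 by apply: is_tree_Bball => //; exact: path_is_tree.
have fS0 : finite_set S0 by apply: Bball_finite; exact: path_is_tree.
have nS0 : nedges S0 = 1%N.
  rewrite /nedges (_ : S0 = [set w | w \in [:: [::]; [:: 0%N]]]) ?ncard_seq//.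
  apply/seteqP; split => w; rewrite /S0 /Bball /path_verts /= !inE.
    by case: w => [|a [|b w]] //= [/andP[/eqP -> _]].
  by case/orP => /eqP ->.
pose S := grow S0 [:: 0%N] 2.
have l0 k : ~ S0 (rcons [:: 0%N] k) by rewrite /S0 /Bball /= => -[].
have ol0 : openleaves S0 [:: [:: 0%N]].
  by split => // [z|z k]; rewrite inE => /eqP ->; [|exact: l0].
have tS : is_tree S by exact: is_tree_grow.
have fS : finite_set S by exact: finite_grow.
have nS : nedges S = 3%N by rewrite nedges_grow// nS0.
have ol : openleaves S [:: x; y] by exact: (openleaves_grow 2 tS0 ol0).
have ol' : openleaves S ([:: y] ++ [:: x]).
  have [u1 u2 u3] := ol; split => //.
    by move=> o ho; apply: u2; move: ho; rewrite !inE orbC.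
  by move=> o k ho; apply: u3; move: ho; rewrite !inE orbC.
have oy o : o \in [:: y] -> size o = 2 by rewrite inE => /eqP ->.
have := @nu_finall R nu Hnu 1 ltr01 2 S [:: y] [:: x] isT tS fS ol' oy.
pose A (U : {fset word}) := if `[< is_tree [set` U] >] then cylinder (graft S x [set` U]) [:: y] else set0.
have mA U : measurable (A U).
  rewrite /A; case: ifP => // _; apply: measurable_cylinder.
  by apply: finite_graft => //; exact: finite_fset.
have SxE : cylinder S ([:: y] ++ [:: x]) = cylinder S [:: x; y].
  by apply/seteqP; split => T <-; apply: eq_prune => w; rewrite !inE orbC.
have AE : cylinder S ([:: y] ++ [:: x]) `&` finall [:: x] = \bigcup_U A U.
  rewrite SxE; apply/seteqP; split => T.
    move=> [TS /(_ x)]; rewrite mem_head => /(_ isT)/finite_plant fx.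
    have Tx : tverts T x.
      suff [] : prune [:: x; y] T x by [].
      by rewrite TS; have [_ h _] := ol; apply: h; rewrite mem_head.
    exists (fset_set (plant T x)) => //; rewrite /A fset_setK//.
    rewrite asboolT; last exact: is_tree_plant.
    by rewrite -cylinder_graft//; (try exact: is_tree_plant); split.
  move=> [U _]; rewrite /A; case: asboolP => // tU.
  rewrite -cylinder_graft// => -[TS TU]; split => // z; rewrite inE => /eqP ->.
  by apply/finite_plant; rewrite (TU : plant T x = _); exact: finite_fset.
have tA : trivIset setT A.
  apply/trivIsetP => U V _ _ UV; rewrite -subset0 => T; rewrite /A.
  case: asboolP => [tU|_ []//]; case: asboolP => [tV|_ []//].
  rewrite -!cylinder_graft// => -[[_ TU] [_ TV]]; move/eqP: UV; apply.
  by rewrite -(set_fsetK U) -(set_fsetK V) -(TU : plant T x = _) -(TV : plant T x = _).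
rewrite AE measure_csum// => e.
have c0 := cyl1_gt0 1 2 3.
have : ((cyl (1 : R) 2 3 1 * 2)%:E * csum (fun U : {fset word} => (rho R [set` U])%:E))%E
     = ((cyl (1 : R) 2 3 1 * 2)%:E)%E.
  rewrite -csumZl => [|U]; last by rewrite lee_fin rho_ge0.
  rewrite nS /= expr1 in e; rewrite -[RHS]e; apply: eq_csum => U; rewrite /A /rho.
  case: asboolP => [[tU fU]|ntU]; last first.
    rewrite mule0; case: asboolP => [tU|]; last by rewrite measure0.
    by exfalso; apply: ntU; split => //; exact: finite_fset.
  rewrite asboolT//.
  have Sx : S x by have [_ h _] := ol; apply: h; rewrite mem_head.
  have lx k : ~ S (rcons x k) by have [_ _ h] := ol; apply: h; rewrite mem_head.
  apply/esym; apply: (etrans (@nu_cylinder R nu Hnu 1 ltr01 2 (graft S x [set` U]) [:: y] isT _ _ _ _)).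
  - exact: is_tree_graft.
  - exact: finite_graft.
  - exact: openleaves_graft.
  - by move=> o; rewrite inE => /eqP ->.
  have := nedges_graft tS Sx fS lx tU fU; rewrite nS addnC => ge.
  (* S has 3 edges, one of them shared with U. The two remaining ones turn the mass into the common
     factor [cyl 1 2 3 1 * 2] times [rho U]. *)
  have -> : nedges (graft S x [set` U]) = (nedges [set` U] + 2)%N.
    by apply/eqP; rewrite -eqSS ge addnS.
  rewrite -EFinM; congr EFin; rewrite /cyl exprD; field.
  by rewrite expf_neq0.
have c20 : 0 < cyl (1 : R) 2 3 1 * 2 by rewrite mulr_gt0.
case: (csum _) => [r| |].
- rewrite -EFinM => -[h]; congr EFin.
  by apply: (mulfI (lt0r_neq0 c20)); rewrite h mulr1.
- by rewrite gt0_muley// lte_fin.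
- by rewrite gt0_muleNy// lte_fin.
Qed.

End RhoMass.

(** * Addresses along the spine *)

Lemma ncard_II n : ncard `I_n = n.
Proof. by rewrite /ncard fset_set_II card_imfset /= ?size_enum_ord// -?cardE ?card_ord//; exact: val_inj. Qed.

Lemma nchildP (X : set word) w k : is_tree X -> X w ->
  X (rcons w k) <-> (k < nchild X w)%N.
Proof.
move=> tX Xw; have [n hn] := tree_children tX Xw.
rewrite hn /nchild (_ : [set k | X (rcons w k)] = `I_n) ?ncard_II//.
by apply/seteqP; split => j /=; rewrite hn.
Qed.

Lemma relab_aux_rcons (Y : set word) pre w k :
  relab_aux Y pre (rcons w k) = rcons (relab_aux Y pre w) (nsp_before Y (pre ++ w) k).
Proof.
elim: w pre => [|a w IH] pre /=; first by rewrite /nsp_before cats0.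
by rewrite IH cat_rcons.
Qed.

Lemma relab_rcons (Y : set word) w k :
  relab Y (rcons w k) = rcons (relab Y w) (nsp_before Y w k).
Proof. exact: relab_aux_rcons. Qed.

Lemma size_relab (Y : set word) w : size (relab Y w) = size w.
Proof.
by elim/last_ind: w => [//|w k IH]; rewrite relab_rcons !size_rcons IH.
Qed.

Lemma nsp_beforeS (Y : set word) w j :
  nsp_before Y w j.+1 = (nsp_before Y w j + `[< Y (rcons w j) >])%N.
Proof. by rewrite /nsp_before big_ord_recr. Qed.

Lemma gap_offS (X Y : set word) w n j :
  gap_off X Y w n j.+1 = (gap_off X Y w n j + `[< in_gap X Y w n j >])%N.
Proof. by rewrite /gap_off big_ord_recr. Qed.

Lemma nsp_before_mono (Y : set word) w : {homo nsp_before Y w : i j / (i <= j)%N}.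
Proof. by apply: homo_leq => [//|i j k|i]; [exact: leq_trans|rewrite nsp_beforeS leq_addr]. Qed.

Lemma gap_off_mono (X Y : set word) w n : {homo gap_off X Y w n : i j / (i <= j)%N}.
Proof. by apply: homo_leq => [//|i j k|i]; [exact: leq_trans|rewrite gap_offS leq_addr]. Qed.

Section Address.
Variable F : word -> nat -> set word.
Implicit Types (u w x y z : word) (n i j k : nat).

(* For a spine vertex with label [u] in [T0] and finite branches [F u n]: its children
   in sector [n] are those of index [st u n + i] with [i < gapn u n], its [k]-th
   spine child is the one of index [pos u k], and [emb u] is its address. *)
Definition gapn u n : nat := nchild (F u n) [:: 0%N].

Definition st u n : nat := \sum_(i < n) (gapn u i).+1.

Lemma stS u n : st u n.+1 = (st u n + (gapn u n).+1)%N.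
Proof. by rewrite /st big_ord_recr. Qed.

Lemma st0 u : st u 0 = 0%N.
Proof. by rewrite /st big_ord0. Qed.

Lemma st_mono u : {homo st u : n m / (n <= m)%N}.
Proof. by apply: homo_leq => [//|i j k|i]; [exact: leq_trans|rewrite stS leq_addr]. Qed.

Lemma st_lt u n m i : (i <= gapn u n)%N -> (n < m)%N -> (st u n + i < st u m)%N.
Proof. by move=> ib nm; apply: leq_trans (st_mono u nm); rewrite stS; lia. Qed.

(** The child indices are tiled by consecutive blocks, block n consisting of the [gapn u n] children
    in sector n followed by one place for the n-th spine child; [st_decode] is the covering half of
    this statement. *)
Lemma st_inj u n i n' i' : (i <= gapn u n)%N -> (i' <= gapn u n')%N ->
  (st u n + i = st u n' + i')%N -> n = n' /\ i = i'.
Proof.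
move=> ib ib' e; have [nn|nn|nn] := ltngtP n n'.
- by have := st_lt ib nn; lia.
- by have := st_lt ib' nn; lia.
- by split => //; move: e; rewrite nn; lia.
Qed.

Lemma st_decode u j : exists n i, (i <= gapn u n)%N /\ j = (st u n + i)%N.
Proof.
elim: j => [|j [n [i [ib ->]]]]; first by exists 0%N, 0%N; rewrite st0.
move: ib; rewrite leq_eqVlt => /orP[/eqP ->|ib].
  by exists n.+1, 0%N; split => //; rewrite stS addn0 addnS.
by exists n, i.+1; rewrite addnS.
Qed.

(** The root carries no sectors, so the index of its child is not shifted. *)
Definition pos u k : nat := if u is [::] then k else (st u k + gapn u k)%N.

Lemma pos_inj u : injective (pos u).
Proof. by case: u => [|a u] k k' //= e; have [] := st_inj (leqnn _) (leqnn _) e. Qed.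

Lemma spine_posE u k : u != [::] -> pos u k = (st u k + gapn u k)%N.
Proof. by case: u. Qed.

Fixpoint emb_aux (pre w : word) : word :=
  if w is k :: w' then pos pre k :: emb_aux (rcons pre k) w' else [::].

Definition emb u : word := emb_aux [::] u.

Lemma emb_aux_cat pre u w : emb_aux pre (u ++ w) = emb_aux pre u ++ emb_aux (pre ++ u) w.
Proof. by elim: u pre => [|a u IH] pre /=; rewrite ?cats0// IH cat_rcons. Qed.

Lemma emb_cat u w : emb (u ++ w) = emb u ++ emb_aux u w.
Proof. exact: emb_aux_cat. Qed.

Lemma emb_rcons u k : emb (rcons u k) = rcons (emb u) (pos u k).
Proof. by rewrite -!cats1 emb_cat. Qed.

Lemma size_emb u : size (emb u) = size u.
Proof. by elim/last_ind: u => [//|u k IH]; rewrite emb_rcons !size_rcons IH. Qed.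

Lemma emb_prefix u y u' y' : emb u ++ y = emb u' ++ y' ->
  (exists z, u' = u ++ z) \/ (exists k z, u = u' ++ k :: z).
Proof.
rewrite /emb; elim: u [::] u' => [|k u IH] pre [|k' u'] /=.
- by move=> _; left; exists [::].
- by move=> _; left; exists (k' :: u').
- by move=> _; right; exists k, u.
- by move=> [/pos_inj -> /IH[[z ->]|[j [z ->]]]]; [left; exists z|right; exists j, z].
Qed.

Lemma emb_inj : injective emb.
Proof.
move=> u u' e; have su : size u = size u' by rewrite -size_emb e size_emb.
have : emb u ++ [::] = emb u' ++ [::] by rewrite !cats0.
case/emb_prefix => [[z e']|[k [z e']]].
  move: su; rewrite e' size_cat; case: z {e'} => [|a z] /=; rewrite ?cats0//; lia.
by move: su; rewrite e' size_cat /=; lia.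
Qed.

End Address.

Lemma ncard_bigcup_seq (I T : choiceType) (s : seq I) (A : I -> set T) : uniq s ->
  (forall i, i \in s -> finite_set (A i)) ->
  (forall i j, i \in s -> j \in s -> i != j -> A i `&` A j = set0) ->
  ncard (\bigcup_(i in [set i | i \in s]) A i) = (\sum_(i <- s) ncard (A i))%N.
Proof.
elim: s => [|i s IH] us fA dA.
  rewrite big_nil (_ : \bigcup_(_ in _) _ = set0); last by rewrite -subset0 => x [].
  by rewrite /ncard fset_set0 cardfs0.
have /andP[nis us'] : (i \notin s) && uniq s := us.
have -> : \bigcup_(j in [set j | j \in i :: s]) A j = A i `|` \bigcup_(j in [set j | j \in s]) A j.
  apply/seteqP; split => x.
    by move=> [j /=]; rewrite inE => /orP[/eqP ->|js] Ajx; [left|right; exists j].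
  move=> [Ai|[j /= js Aj]]; first by exists i => //=; rewrite mem_head.
  by exists j => //=; rewrite inE js orbT.
rewrite ncardU.
- rewrite big_cons IH// => [j js|j k js ks]; [apply: fA|apply: dA];
    by rewrite inE ?js ?ks orbT.
- by apply: fA; rewrite mem_head.
- by apply: bigcup_finite; [exact: finite_seq|move=> j js; apply: fA; rewrite inE js orbT].
- rewrite -subset0 => x [Ai [j js Aj]].
  suff : (A i `&` A j) x by rewrite dA ?mem_head// ?inE ?js ?orbT//; apply: contraNneq nis => ->.
  by split.
Qed.

Lemma spine_cat (T : tree) w u : spine_set T (w ++ u) -> spine_set T w.
Proof.
move=> [Tw iw]; split; first exact: tree_cat (tree_ok T) Tw.
move=> fw; apply: iw.
apply: (@sub_finite_set _ _ [set y | (u ++ y) \in fset_set [set y | tverts T (w ++ y)]]).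
  by move=> y /= Ty; rewrite in_fset_set//; apply: mem_set; rewrite /= catA.
apply: (@finite_preimage _ _ [set` fset_set [set y | tverts T (w ++ y)]] (cat u)).
  by move=> x y _ _ /eqP; rewrite eqseq_cat// eqxx => /eqP.
exact: finite_fset.
Qed.

Lemma nsp_before_ivt (Y : set word) w j n : (n < nsp_before Y w j)%N ->
  exists j', [/\ (j' < j)%N, Y (rcons w j') & nsp_before Y w j' = n].
Proof.
elim: j => [|j IH]; first by rewrite /nsp_before big_ord0.
rewrite nsp_beforeS; case: asboolP => [Yj|_]; last first.
  by rewrite addn0 => /IH[j' [jj ? ?]]; exists j'; split => //; exact: ltnW.
rewrite addn1 ltnS leq_eqVlt => /orP[/eqP ->|]; first by exists j.
by move=> /IH[j' [jj ? ?]]; exists j'; split => //; exact: ltnW.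
Qed.

Lemma gap_off_ivt (X Y : set word) w n j i : (i < gap_off X Y w n j)%N ->
  exists j', [/\ (j' < j)%N, in_gap X Y w n j' & gap_off X Y w n j' = i].
Proof.
elim: j => [|j IH]; first by rewrite /gap_off big_ord0.
rewrite gap_offS; case: asboolP => [Yj|_]; last first.
  by rewrite addn0 => /IH[j' [jj ? ?]]; exists j'; split => //; exact: ltnW.
rewrite addn1 ltnS leq_eqVlt => /orP[/eqP ->|]; first by exists j.
by move=> /IH[j' [jj ? ?]]; exists j'; split => //; exact: ltnW.
Qed.

Lemma gap_off_eq0 (X Y : set word) w n j :
  (forall j', (j' < j)%N -> ~ in_gap X Y w n j') -> gap_off X Y w n j = 0%N.
Proof.
move=> h; rewrite /gap_off big1// => i _; case: asboolP => // /h; case.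
exact: ltn_ord.
Qed.

Lemma nsp_st F (Y : set word) w u c :
  (forall j, Y (rcons w j) <-> exists k, (k < c)%N /\ j = (st F u k + gapn F u k)%N) ->
  forall n i, (n <= c)%N -> (i <= gapn F u n)%N -> nsp_before Y w (st F u n + i) = n.
Proof.
move=> hY; elim=> [|n IHn] i nc.
  rewrite st0 add0n; elim: i => [|i IHi] ig; first by rewrite /nsp_before big_ord0.
  rewrite nsp_beforeS IHi ?(ltnW ig)//; case: asboolP => // /hY[k [_ e]].
  have e' : (st F u 0 + i = st F u k + gapn F u k)%N by rewrite st0 add0n.
  have [k0 i0] := st_inj (ltnW ig) (leqnn _) e'.
  by move: ig; rewrite i0 k0 ltnn.
elim: i => [|i IHi] ig.
  rewrite addn0 stS addnS nsp_beforeS IHn ?(ltnW nc)// asboolT ?addn1//.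
  by apply/hY; exists n.
rewrite addnS nsp_beforeS IHi ?(ltnW ig)//; rewrite asboolF ?addn0// => /hY[k [_ e]].
have [k0 i0] := st_inj (ltnW ig) (leqnn _) e.
by move: ig; rewrite i0 k0 ltnn.
Qed.

Lemma gap_off_st F (X Y : set word) w u n :
  (forall j, in_gap X Y w n j <-> exists i, (i < gapn F u n)%N /\ j = (st F u n + i)%N) ->
  forall i, (i <= gapn F u n)%N -> gap_off X Y w n (st F u n + i) = i.
Proof.
move=> hg; elim=> [|i IH] ig.
  by rewrite addn0; apply: gap_off_eq0 => j jn /hg[i [_ e]]; move: jn; rewrite e; lia.
rewrite addnS gap_offS IH ?(ltnW ig)// asboolT ?addn1//.
by apply/hg; exists i.
Qed.

(** * Gluing branches on the spine *)

Section Glue.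
Variables (T0 : set word) (r : nat) (F : word -> nat -> set word).
Hypothesis T0_tree : is_tree T0.
Hypothesis T0_fin : finite_set T0.
Hypothesis T0_height : tree_height T0 r.
Hypothesis T0_leaves : forall w, leaf T0 w -> size w = r.
Hypothesis F_ok : forall u n, T0 u -> (0 < size u < r)%N -> (n <= nchild T0 u)%N ->
  is_tree (F u n) /\ finite_set (F u n).
Implicit Types (u v w x y z : word) (n i j k : nat) (U : word -> set word).

Local Notation emb := (emb F).
Local Notation pos := (pos F).
Local Notation st := (st F).
Local Notation gapn := (gapn F).

Lemma T0_size u : T0 u -> (size u <= r)%N.
Proof. by have [h _] := T0_height; exact: h. Qed.

Lemma r_gt0 : (0 < r)%N.
Proof. by have [[_ h] _ _ _ _] := T0_tree; have := T0_size h. Qed.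

Lemma T0_leafE v : leaf T0 v <-> T0 v /\ size v = r.
Proof.
split=> [lv|[Tv vr]]; first by split; [case: lv|exact: T0_leaves].
by split => // k /T0_size; rewrite size_rcons vr ltnn.
Qed.

Lemma T0_to_leaf u : T0 u -> exists z, T0 (u ++ z) /\ size (u ++ z) = r.
Proof.
move=> Tu; have [m] := ubnP (r - size u); elim: m u Tu => // m IH u Tu um.
have [[k Tk]|nk] := pselect (exists k, T0 (rcons u k)).
  have [|z [Tz sz]] := IH _ Tk; last by exists (k :: z); rewrite -cat_rcons.
  by have := T0_size Tk; rewrite size_rcons; lia.
exists [::]; rewrite cats0; split => //; apply: T0_leaves; split => // k Tk.
by apply: nk; exists k.
Qed.

Definition gaprel u y := exists n i w',
  [/\ (n <= nchild T0 u)%N, F u n (0%N :: i :: w') & y = (st u n + i)%N :: w'].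

(** The vertices hanging at [emb u] that do not pass through a further vertex of the embedded [T0],
    by their address relative to [emb u]: the vertex itself, its finite branches, or at height r its
    infinite branch. *)
Definition part U u y : Prop :=
  [\/ y = [::], (0 < size u < r)%N /\ gaprel u y | size u = r /\ U u (0%N :: y)].

Definition glue U : set word :=
  [set x | exists u y, [/\ T0 u, x = emb u ++ y & part U u y]].

Lemma gapF u n i w' : T0 u -> (0 < size u < r)%N -> (n <= nchild T0 u)%N ->
  F u n (0%N :: i :: w') -> (i < gapn u n)%N.
Proof.
move=> Tu ur nc Fi; have [tF _] := F_ok Tu ur nc; have [[_ F0] _ _ _ _] := tF.
apply/(nchildP _ tF F0); exact: (tree_cat (u := w') tF).
Qed.

(** Finite branches never use the place reserved for a spine child. Hence the parts of different
    vertices are disjoint, and a glued vertex can be located from its address. *)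
Lemma part_pos U u k y : T0 u -> (size u < r)%N -> ~ part U u (pos u k :: y).
Proof.
move=> Tu ur [//|[ur' [n [i [w' [nc Fi []]]]]]|[e]]; last by rewrite e ltnn in ur.
rewrite spine_posE; last by case: (u) ur'.
move=> e _; have il := gapF Tu ur' nc Fi.
by have [kn ki] := st_inj (leqnn _) (ltnW il) e; move: il; rewrite -ki kn ltnn.
Qed.

Lemma glue_part U u y : T0 u -> part U u y -> glue U (emb u ++ y).
Proof. by move=> Tu p; exists u, y. Qed.

Lemma glue_inv U u y : T0 u -> glue U (emb u ++ y) -> part U u y \/
  exists k y', [/\ T0 (rcons u k), y = pos u k :: y' & glue U (emb (rcons u k) ++ y')].
Proof.
move=> Tu [u' [y1 [Tu' e p]]]; have [[z ue]|[k [z ue]]] := emb_prefix e.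
  move: e; rewrite ue emb_cat -catA => /eqP; rewrite eqseq_cat// eqxx => /eqP /= ye.
  case: z ue ye => [|k z] ue ye; first by left; move: p; rewrite ue cats0 ye.
  right; exists k, (emb_aux F (rcons u k) z ++ y1); split => //.
    by move: Tu'; rewrite ue -cat_rcons; exact: tree_cat.
  by exists u', y1; split => //; rewrite ue -cat_rcons emb_cat catA.
have ur : (size u' < r)%N by have := T0_size Tu; rewrite ue size_cat /=; lia.
exfalso; move: e; rewrite {1}ue emb_cat -catA => /eqP; rewrite eqseq_cat// eqxx => /eqP /= ye.
by move: p; rewrite -ye; exact: part_pos.
Qed.

Lemma glue_emb U u : T0 u -> glue U (emb u).
Proof. by move=> Tu; exists u, [::]; rewrite cats0; split => //; constructor 1. Qed.

Lemma glue_leaf U v y : T0 v -> size v = r -> is_tree (U v) ->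
  glue U (emb v ++ y) <-> U v (0%N :: y).
Proof.
move=> Tv vr tU; split=> [/(glue_inv Tv)|Uy].
  case=> [[->|[]|[]//]|[k [y' [/T0_size]]]].
  - by have [[_ h] _ _ _ _] := tU.
  - by rewrite vr ltnn andbF.
  - by rewrite size_rcons vr ltnn.
by apply: glue_part => //; constructor 3.
Qed.

Lemma glue_gap U u n i w' : T0 u -> (0 < size u < r)%N -> (i < gapn u n)%N ->
  glue U (emb u ++ (st u n + i)%N :: w') <->
  (n <= nchild T0 u)%N /\ F u n (0%N :: i :: w').
Proof.
move=> Tu ur ig; split=> [/(glue_inv Tu)|[nc Fi]]; last first.
  by apply: glue_part => //; constructor 2; split => //; exists n, i, w'.
case=> [[//|[_ [n' [i' [w1 [nc Fi [e ->]]]]]]|[e]]|[k [y' [_ []]]]].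
- by have [-> ->] := st_inj (ltnW ig) (ltnW (gapF Tu ur nc Fi)) e.
- by move: ur; rewrite e ltnn andbF.
- rewrite spine_posE; last by case: (u) ur.
  move=> e; have [nk ik] := st_inj (ltnW ig) (leqnn _) e.
  by move: ig; rewrite ik nk ltnn.
Qed.

Lemma glue_children U u j : T0 u -> (0 < size u < r)%N ->
  glue U (rcons (emb u) j) <-> (j < st u (nchild T0 u) + gapn u (nchild T0 u))%N.
Proof.
move=> Tu ur; rewrite -cats1; set c := nchild T0 u.
have u0 : u != [::] by case: (u) ur.
split=> [/(glue_inv Tu)|jc].
  case=> [[//|[_ [n [i [w' [nc Fi [-> _]]]]]]|[e]]|[k [y' [Tk [-> _] _]]]].
  - have := gapF Tu ur nc Fi.
    move: nc; rewrite leq_eqVlt => /orP[/eqP ->|nc ig]; first by rewrite ltn_add2l.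
    by have := st_lt (ltnW ig) nc; rewrite /c; lia.
  - by move: ur; rewrite e ltnn andbF.
  - have kc : (k < c)%N by apply/(nchildP _ T0_tree Tu).
    by rewrite spine_posE//; have := st_lt (leqnn (gapn u k)) kc; lia.
have [n [i [ig je]]] := st_decode F u j.
have nc : (n <= c)%N.
  rewrite leqNgt; apply/negP => cn; have := st_lt (leqnn (gapn u c)) cn.
  by move: jc; rewrite je; lia.
move: ig; rewrite leq_eqVlt => /orP[/eqP ie|ig].
  have nc' : (n < c)%N.
    by rewrite ltn_neqAle nc andbT; apply/eqP => nce; move: jc; rewrite je ie nce ltnn.
  have Tn : T0 (rcons u n) by apply/(nchildP _ T0_tree Tu).
  by have := glue_emb U Tn; rewrite emb_rcons spine_posE// -cats1 je ie.
rewrite je; apply/(glue_gap _ _ Tu ur ig); split => //.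
have [tF _] := F_ok Tu ur nc; have [[_ F0] _ _ _ _] := tF.
exact/(nchildP i tF F0).
Qed.

Lemma glue_root_child U j : glue U [:: j] -> j = 0%N.
Proof.
have T0nil : T0 [::] by have [[h _] _ _ _ _] := T0_tree.
move=> gj; have : glue U (emb [::] ++ [:: j]) by [].
case/(glue_inv T0nil) => [[//|[//]|[/= e]]|[k [y' [Tk [-> _] _]]]].
  by have := r_gt0; rewrite -e.
by have [] // := tree_root T0_tree Tk; case: (k) Tk.
Qed.

Lemma is_tree_glue U : (forall v, T0 v -> size v = r -> is_tree (U v)) -> is_tree (glue U).
Proof.
move=> tU; have [[T0n T00] _ _ _ _] := T0_tree.
have prf : forall w k, glue U (rcons w k) -> glue U w.
  move=> w k [u [y [Tu e p]]]; case/lastP: y e p => [|y j] e p.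
    rewrite cats0 in e; case/lastP: u Tu e {p} => [|u j] Tu.
      by case: w.
    rewrite emb_rcons => /rcons_inj[-> _]; apply: glue_emb.
    by move: Tu; rewrite -cats1; exact: tree_cat.
  move: e; rewrite -rcons_cat => /rcons_inj[-> _]; apply: glue_part => //.
  case: p => [/eqP|[ur [n [i [w' [nc Fi ye]]]]]|[ur Uy]].
  - by rewrite -size_eq0 size_rcons.
  - case: y ye => [|a y] /= ye; first by constructor 1.
    case: ye => -> ye; constructor 2; split => //; exists n, i, y; split => //.
    have [tF _] := F_ok Tu ur nc; have [_ _ pF _ _] := tF.
    by apply: (pF _ j); rewrite /= ye.
  - constructor 3; split => //; have [_ _ pU _ _] := tU _ Tu ur.
    by apply: (pU _ j).
split=> //.
- split; first exact: (glue_emb U T0n).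
  have := glue_emb U T00; rewrite /emb /=; exact.
- by move=> /glue_root_child.
- move=> w k g; have [u [y [Tu e p]]] := g.
  case/lastP: y e p => [|y j] e p.
    rewrite cats0 in e; case/lastP: u Tu e {p} => [|u j] Tu; first by case: (w).
    rewrite emb_rcons => /rcons_inj[we ke].
    have Tu' : T0 u by move: Tu; rewrite -cats1; exact: tree_cat.
    case: u we Tu Tu' ke => [|a u] we Tu Tu' ke.
      by move: g; rewrite we => /glue_root_child.
    have ur : (0 < size (a :: u) < r)%N by have := T0_size Tu; rewrite size_rcons /=.
    move: g; rewrite we => /(glue_children _ _ Tu' ur) kc.
    by apply/(glue_children _ _ Tu' ur); lia.
  move: e; rewrite -rcons_cat => /rcons_inj[we kj].
  case: p => [/eqP|[ur [n [i [w' [nc Fi ye]]]]]|[ur Uy]].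
  - by rewrite -size_eq0 size_rcons.
  - case: y ye we => [|a y] /= ye we.
      rewrite cats0 in we; move: g; rewrite we => /(glue_children _ _ Tu ur) kc.
      by apply/(glue_children _ _ Tu ur); lia.
    case: ye => ae ye; rewrite we rcons_cat; apply: glue_part => //.
    constructor 2; split => //; exists n, i, (rcons y k); split; rewrite ?ae//.
    have [tF _] := F_ok Tu ur nc; have [_ _ _ sF _] := tF.
    by apply: (sF (0%N :: i :: y) k); rewrite /= kj ye.
  - rewrite we rcons_cat; apply: glue_part => //; constructor 3; split => //.
    have [_ _ _ sU _] := tU _ Tu ur.
    by apply: (sU (0%N :: y) k); rewrite /= kj.
- move=> w [u [y [Tu -> p]]].
  have [ur|ur] := eqVneq (size u) r.
    have Uy : U u (0%N :: y) by apply/(glue_leaf _ Tu ur (tU _ Tu ur)); exact: glue_part.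
    have [_ _ _ _ fU] := tU _ Tu ur; have [n hn] := fU _ Uy.
    by exists n; rewrite rcons_cat => /(glue_leaf _ Tu ur (tU _ Tu ur)).
  case: p => [->|[ur' [n [i [w' [nc Fi ye]]]]]|[e]]; last by rewrite e eqxx in ur.
    rewrite cats0; case: u Tu ur => [|a u] Tu ur; first by exists 1%N => /glue_root_child.
    have ur' : (0 < size (a :: u) < r)%N by have := T0_size Tu; rewrite leq_eqVlt (negbTE ur).
    exists (st (a :: u) (nchild T0 (a :: u)) + gapn (a :: u) (nchild T0 (a :: u)))%N.
    by move=> /(glue_children _ _ Tu ur'); rewrite ltnn.
  have [tF _] := F_ok Tu ur' nc; have [_ _ _ _ fF] := tF.
  have [m hm] := fF _ Fi; exists m; rewrite ye rcons_cat rcons_cons.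
  by move/(glue_gap _ _ Tu ur' (gapF Tu ur' nc Fi)) => [].
Qed.

Lemma part_finite U u : T0 u -> (size u = r -> finite_set (U u)) -> finite_set (part U u).
Proof.
move=> Tu fU.
apply: (@sub_finite_set _ _ ([set [::]] `|` ((if (0 < size u < r)%N then
   \bigcup_(n in `I_(nchild T0 u).+1)
      ((fun y => (st u n + head 0%N (behead y))%N :: behead (behead y)) @` F u n) else set0) `|`
   (if size u == r then behead @` U u else set0)))).
  move=> y [->|[ur [n [i [w' [nc Fi ->]]]]]|[ur Uy]]; first by left.
    by right; left; rewrite ur; exists n => //; exists (0%N :: i :: w').
  by right; right; rewrite ur eqxx; exists (0%N :: y).
rewrite !finite_setU; split => //; split.
  case: ifP => // ur; apply: bigcup_finite; first exact: finite_II.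
  by move=> n /= nc; apply: finite_image; have [] := F_ok Tu ur nc.
by case: eqP => // ur; apply: finite_image; exact: fU.
Qed.

Lemma glueE U : glue U = \bigcup_(u in T0) (cat (emb u) @` part U u).
Proof.
apply/seteqP; split => x; first by move=> [u [y [Tu -> p]]]; exists u => //; exists y.
by move=> [u Tu [y p <-]]; exists u, y.
Qed.

Lemma finite_glue U : (forall v, T0 v -> size v = r -> finite_set (U v)) ->
  finite_set (glue U).
Proof.
move=> fU; rewrite glueE; apply: bigcup_finite => // u Tu.
by apply: finite_image; apply: part_finite => //; exact: fU.
Qed.

Lemma glue_ncard U : (forall v, T0 v -> size v = r -> finite_set (U v)) ->
  ncard (glue U) = (\sum_(u <- enum_fset (fset_set T0)) ncard (part U u))%N.
Proof.
move=> fU.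
have memT0 u : u \in enum_fset (fset_set T0) <-> T0 u.
  by rewrite in_fset_set// inE.
transitivity (ncard (\bigcup_(u in [set u | u \in enum_fset (fset_set T0)])
    (cat (emb u) @` part U u))).
  rewrite glueE; congr ncard; apply/seteqP; split => x [u Tu h]; exists u => //; exact/memT0.
rewrite ncard_bigcup_seq ?fset_uniq//.
- apply: eq_big_seq => u /memT0 Tu; rewrite ncard_image//.
    by move=> y y' _ _ /eqP; rewrite eqseq_cat// eqxx => /eqP.
  by apply: part_finite => //; exact: fU.
- by move=> u /memT0 Tu; apply: finite_image; apply: part_finite => //; exact: fU.
- have half u u' y y' k z : T0 u -> T0 u' -> part U u y -> u' = u ++ k :: z ->
      emb u ++ y = emb u' ++ y' -> False.
    move=> Tu Tu' p ue; rewrite ue emb_cat -catA => /eqP; rewrite eqseq_cat// eqxx => /eqP /= ye.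
    move: p; rewrite ye; apply: part_pos => //.
    by have := T0_size Tu'; rewrite ue size_cat /=; lia.
  move=> u u' /memT0 Tu /memT0 Tu' /eqP uu'; rewrite -subset0 => x [[y p <-] [y' p' e]].
  case: (emb_prefix e) => [[[|k z] ue]|[k [z ue]]].
  + by apply: uu'; rewrite ue cats0.
  + by apply: (half _ _ _ _ _ _ Tu' Tu p' ue e).
  + by apply: (half _ _ _ _ _ _ Tu Tu' p ue (esym e)).
Qed.

(** Each branch [F u n] loses two vertices, its root and the root's child, since its root edge is
    identified with the edge above u; the successor counts [emb u] itself. *)
Lemma ncard_part_internal U u : T0 u -> (0 < size u < r)%N ->
  ncard (part U u) = (\sum_(n <- iota 0 (nchild T0 u).+1) (ncard (F u n)).-2).+1.
Proof.
move=> Tu ur; set c := nchild T0 u.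
pose G n : set word := [set y | exists i w', F u n (0%N :: i :: w') /\ y = (st u n + i)%N :: w'].
have Fn n : n \in iota 0 c.+1 -> is_tree (F u n) /\ finite_set (F u n).
  by rewrite mem_iota => /andP[_ nc]; apply: F_ok.
have GE n : G n = (fun x => (st u n + head 0%N x)%N :: behead x) @`
     [set x | x != [::] /\ F u n (0%N :: x)].
  apply/seteqP; split => y; first by move=> [i [w' [Fi ->]]]; exists (i :: w').
  by move=> [[|i w'] [// _ Fi] <-]; exists i, w'.
have fV n : n \in iota 0 c.+1 -> finite_set [set x | x != [::] /\ F u n (0%N :: x)].
  move=> /Fn[_ fF]; apply: (@sub_finite_set _ _ (behead @` F u n)); last exact: finite_image.
  by move=> x [_ Fx]; exists (0%N :: x).
have pE : part U u = [set [::]] `|` \bigcup_(n in [set n | n \in iota 0 c.+1]) G n.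
  apply/seteqP; split => y.
    move=> [->|[_ [n [i [w' [nc Fi ->]]]]]|[e]]; first by left.
      by right; exists n; [change (n \in iota 0 c.+1); rewrite mem_iota|exists i, w'].
    by move: ur; rewrite e ltnn andbF.
  move=> [->|[n nc]]; first by constructor 1.
  have {}nc : n \in iota 0 c.+1 by [].
  move: nc; rewrite mem_iota => /andP[_ nc] [i [w' [Fi ->]]]; constructor 2; split => //.
  by exists n, i, w'.
rewrite pE ncardU//; last 2 first.
- apply: bigcup_finite; first exact: finite_seq.
  by move=> n nc; rewrite GE; apply: finite_image; exact: fV.
- by rewrite -subset0 => y [->] [n _ [i [w' []]]].
rewrite ncard_set1 add1n ncard_bigcup_seq ?iota_uniq//.
- congr _.+1; apply: eq_big_seq => n nc; have [tF fF] := Fn _ nc.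
  rewrite (ncard_tree tF fF) GE ncard_image//; last exact: fV.
  by move=> x y /set_mem[x0 _] /set_mem[y0 _]; case: x y x0 y0 => [|i x] [|j y]//= _ _ [/addnI -> ->].
- by move=> n nc; rewrite GE; apply: finite_image; exact: fV.
- move=> n m nc mc /eqP nm; rewrite -subset0 => y [[i [w' [Fi ->]]] [i' [w1 [Fi' [e _]]]]].
  move: nc mc; rewrite !mem_iota => /andP[_ nc] /andP[_ mc].
  have [] := st_inj (ltnW (gapF Tu ur nc Fi)) (ltnW (gapF Tu ur mc Fi')) e.
  by move=> /nm.
Qed.

Lemma ncard_part_leaf U v : size v = r -> is_tree (U v) -> finite_set (U v) ->
  ncard (part U v) = nedges (U v).
Proof.
move=> vr tU fU; have [[U0 U00] _ _ _ _] := tU.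
have pE : part U v = [set y | U v (0%N :: y)].
  apply/seteqP; split => y.
    by case=> [->//|[]|[]//]; rewrite vr ltnn andbF.
  by move=> Uy; constructor 3.
have UE : U v = [set [::]] `|` cons 0%N @` part U v.
  apply/seteqP; split => x.
    have [->|x0] := eqVneq x [::]; first by left.
    move=> Ux; have [x' xe] := tree_root tU Ux x0.
    by right; exists x'; rewrite ?xe// pE /= -xe.
  by rewrite pE => -[->|[y /= Uy <-]].
have fp : finite_set (part U v).
  rewrite pE; apply: (@sub_finite_set _ _ (behead @` U v)); last exact: finite_image.
  by move=> x Ux; exists (0%N :: x).
rewrite /nedges UE ncardU//; last 2 first.
- exact: finite_image.
- by rewrite -subset0 => x [->] [].
by rewrite ncard_set1 ncard_image// => x y _ _ [].
Qed.

Definition leaves : seq word := enum_fset (fset_set (leaf T0)).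
Definition internals : seq word :=
  [seq u <- enum_fset (fset_set T0) | (0 < size u < r)%N].

Lemma finite_leaf : finite_set (leaf T0).
Proof. by apply: (@sub_finite_set _ _ T0) => // v []. Qed.

Lemma leavesP v : v \in leaves <-> T0 v /\ size v = r.
Proof. by rewrite -T0_leafE /leaves in_fset_set ?inE//; exact: finite_leaf. Qed.

Lemma internalsP u : u \in internals <-> T0 u /\ (0 < size u < r)%N.
Proof.
rewrite mem_filter in_fset_set//; split=> [/andP[ur /set_mem]//|[Tu ->]].
exact: mem_set.
Qed.

Lemma verts_perm : perm_eq (enum_fset (fset_set T0)) ([::] :: internals ++ leaves).
Proof.
have T0n : T0 [::] by have [[h _] _ _ _ _] := T0_tree.
apply: uniq_perm; first exact: fset_uniq.
  rewrite /= cat_uniq filter_uniq ?fset_uniq// andbT; apply/andP; split.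
    rewrite mem_cat negb_or; apply/andP; split; apply/negP.
      by move/internalsP => [].
    by move/leavesP => [_ /=]; have := r_gt0; lia.
  by apply/hasPn => v /leavesP[_ vr]; rewrite /= mem_filter vr ltnn andbF.
move=> u; rewrite in_cons mem_cat; apply/idP/idP.
  rewrite in_fset_set// => /set_mem Tu.
  have := T0_size Tu; rewrite leq_eqVlt => /orP[/eqP ur|ur].
    by apply/orP; right; apply/orP; right; apply/leavesP.
  have [//|u0] := eqVneq u [::]; apply/orP; right; apply/orP; left; apply/internalsP.
  by split => //; rewrite ur andbT lt0n size_eq0.
by case/orP => [/eqP ->|/orP[/internalsP[Tu _]|/leavesP[Tu _]]]; rewrite in_fset_set//; exact: mem_set.
Qed.

(** The sum is the number of sectors, 2|T0| - R - 1: every vertex other than the root and its child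
    is a child of exactly one internal vertex, and each internal vertex has one sector more than it
    has children. *)
Lemma sum_children :
  (\sum_(u <- internals) (nchild T0 u).+1).+1 = ((size internals).*2 + size leaves)%N.
Proof.
have T0n : T0 [::] by have [[h _] _ _ _ _] := T0_tree.
have T00 : T0 [:: 0%N] by have [[_ h] _ _ _ _] := T0_tree.
have nT0 : ncard T0 = (size internals + size leaves).+1.
  by rewrite /ncard (perm_size verts_perm) /= size_cat.
have fI u : finite_set (rcons u @` `I_(nchild T0 u)) by apply: finite_image; exact: finite_II.
have TE : T0 = [set [::]] `|` ([set [:: 0%N]] `|`
    \bigcup_(u in [set u | u \in internals]) (rcons u @` `I_(nchild T0 u))).
  apply/seteqP; split => w.
    move=> Tw; case/lastP: w Tw => [|w k] Tw; first by left.
    have Tw' : T0 w by move: Tw; rewrite -cats1; exact: tree_cat.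
    right; have [w0|w0] := eqVneq w [::].
      left; move: Tw; rewrite w0 /= => Tk.
      by have [|w' e] := tree_root T0_tree Tk => //; rewrite e; case: e => _ <-.
    right; exists w; last by exists k => //; apply/(nchildP _ T0_tree Tw').
    apply/internalsP; split => //; rewrite lt0n size_eq0 w0 /=.
    by have := T0_size Tw; rewrite size_rcons.
  case=> [->//|[->//|[u /= /internalsP[Tu _] [k /= kc <-]]]].
  by apply/(nchildP _ T0_tree Tu).
have : ncard T0 = (1 + (1 + \sum_(u <- internals) nchild T0 u))%N.
  rewrite {1}TE ncardU//; last 2 first.
  - by rewrite finite_setU; split => //; apply: bigcup_finite => //; exact: finite_seq.
  - rewrite -subset0 => w [->] [//|[u _ [k _ /eqP]]].
    by rewrite -size_eq0 size_rcons.
  rewrite ncard_set1 ncardU//; last 2 first.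
  - by apply: bigcup_finite => //; exact: finite_seq.
  - rewrite -subset0 => w [->] [u /= /internalsP[_ ur] [k _ /(congr1 size)]].
    by rewrite size_rcons /= => -[e]; move: ur; rewrite e.
  rewrite ncard_set1 ncard_bigcup_seq//.
  - by congr (_ + (_ + _))%N; apply: eq_bigr => u _; rewrite ncard_image ?ncard_II// => i j _ _ /rcons_inj[].
  - by rewrite filter_uniq// fset_uniq.
  - move=> u u' _ _ /eqP uu'; rewrite -subset0 => w [[k _ <-] [k' _ /rcons_inj[e _]]].
    by apply: uu'.
rewrite nT0; under [X in _ -> X.+1 = _]eq_bigr do rewrite -addn1.
rewrite big_split/= big_const_seq count_predT iter_addn_0 mul1n => e.
rewrite -addnn; move: e; set A := (\sum_(_ <- _) _)%N; lia.
Qed.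

(** A branch with e edges adds e - 1 edges, that is 4 * 4^-e = 2 [rho]. With I internal vertices and
    R leaves, the sectors give 2^(2I + R - 1) and the edges above the internal vertices give 4^-I,
    which leaves 2^(R - 1). *)
Lemma glue_weight (R : realType) U :
  (forall v, T0 v -> size v = r -> is_tree (U v) /\ finite_set (U v)) ->
  (4 ^+ nedges (glue U))^-1 = 2 ^+ (size leaves).-1 *
    \prod_(u <- internals) \prod_(n <- iota 0 (nchild T0 u).+1) rho R (F u n) *
    \prod_(v <- leaves) (4 ^+ nedges (U v))^-1 :> R.
Proof.
move=> UU; have T0n : T0 [::] by have [[h _] _ _ _ _] := T0_tree.
have nE : nedges (glue U) = (\sum_(u <- internals)
     (\sum_(n <- iota 0 (nchild T0 u).+1) (ncard (F u n)).-2).+1 +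
     \sum_(v <- leaves) nedges (U v))%N.
  rewrite /nedges glue_ncard => [|v Tv vr]; last by have [] := UU _ Tv vr.
  rewrite (perm_big _ verts_perm) /= big_cons big_cat /=.
  have -> : ncard (part U [::]) = 1%N.
    rewrite (_ : part U [::] = [set [::]]) ?ncard_set1//.
    apply/seteqP; split => y; last by move=> ->; constructor 1.
    by case=> [//|[]//|[/= e]]; have := r_gt0; rewrite -e.
  rewrite add1n /=; congr (_ + _)%N.
    apply: eq_big_seq => u /internalsP[Tu ur].
    exact: ncard_part_internal.
  apply: eq_big_seq => v /leavesP[Tv vr].
  by have [tU fU] := UU _ Tv vr; exact: ncard_part_leaf.
have expS (I : Type) (s : seq I) (f : I -> nat) :
    (4 ^+ (\sum_(i <- s) f i)%N)^-1 = \prod_(i <- s) (4 ^+ f i)^-1 :> R.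
  elim: s => [|i s IH]; first by rewrite !big_nil expr0 invr1.
  by rewrite !big_cons exprD invfM IH.
rewrite nE exprD invfM !expS; congr (_ * _).
transitivity (\prod_(u <- internals) (4^-1 * 2 ^+ (nchild T0 u).+1 *
    \prod_(n <- iota 0 (nchild T0 u).+1) rho R (F u n))).
  apply: eq_big_seq => u /internalsP[Tu ur].
  rewrite exprS invfM -mulrA; congr (_ * _); rewrite expS.
  have -> : 2 ^+ (nchild T0 u).+1 = \prod_(n <- iota 0 (nchild T0 u).+1) 2 :> R.
    by rewrite big_const_seq count_predT size_iota iter_mulr_1.
  rewrite -big_split.
  apply: eq_big_seq => n; rewrite mem_iota => /andP[_ nc].
  have [tF fF] := F_ok Tu ur nc; rewrite /rho asboolT//.
  by rewrite /nedges (ncard_tree tF fF) /= exprS; field; rewrite expf_neq0.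
rewrite big_split/=; congr (_ * _).
rewrite big_split/= big_const_seq count_predT iter_mulr_1.
have -> : \prod_(u <- internals) 2 ^+ (nchild T0 u).+1 =
    2 ^+ (\sum_(u <- internals) (nchild T0 u).+1)%N :> R.
  by rewrite (big_morph _ (exprD 2) (expr0 _)).
have := sum_children; set A := (\sum_(_ <- _) _)%N => e.
have lv : (0 < size leaves)%N.
  have [v [Tv vr]] := T0_height.2.
  have : v \in leaves by apply/leavesP.
  by case: (leaves).
have -> : A = ((size internals).*2 + (size leaves).-1)%N by lia.
rewrite exprD -mul2n exprM mulrA -exprMn (_ : 4^-1 * 2 ^+ 2 = 1) ?expr1n ?mul1r//.
by field.
Qed.

(** * Spine and sectors of a glued tree *)

Section GlueTree.
Variables (T : tree) (U : word -> set word).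
Hypothesis U_tree : forall v, T0 v -> size v = r -> is_tree (U v).
Hypothesis U_inf : forall v, T0 v -> size v = r -> ~ finite_set (U v).
Hypothesis TE : tverts T = glue U.
Local Notation Y := (spine_set T).

Lemma glue_tree_spine u : T0 u -> Y (emb u).
Proof.
move=> Tu; have [z [Tz uz]] := T0_to_leaf Tu.
apply: (@spine_cat _ _ (emb_aux F u z)); rewrite -emb_cat; split.
  by rewrite TE; exact: glue_emb.
move=> fv; apply: (U_inf Tz uz).
apply: (@sub_finite_set _ _ ([set [::]] `|` cons 0%N @` [set y | tverts T (emb (u ++ z) ++ y)])).
  move=> x Ux; have [->|x0] := eqVneq x [::]; first by left.
  have [x' xe] := tree_root (U_tree Tz uz) Ux x0; right; exists x' => //.
  by rewrite /= TE; apply/(glue_leaf _ Tz uz (U_tree Tz uz)); rewrite -xe.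
by rewrite finite_setU; split => //; exact: finite_image.
Qed.

(** Up to height r, a vertex outside the embedded [T0] lies in one of the finite branches, so it has
    finitely many descendants. *)
Lemma glue_tree_spineP w : Y w -> (size w <= r)%N -> exists2 u, T0 u & w = emb u.
Proof.
move=> [Tw iw] wr; move: (Tw); rewrite TE => -[u [y [Tu we p]]]; exists u => //.
case: p => [ye|[ur [n [i [w' [nc Fi ye]]]]]|[ur _]]; first by rewrite we ye cats0.
  exfalso; apply: iw.
  have [tF fF] := F_ok Tu ur nc.
  apply: (@sub_finite_set _ _ [set z | ([:: 0, i & w']%N ++ z) \in fset_set (F u n)]).
    move=> z /=; rewrite TE we ye -catA cat_cons.
    move=> /(glue_gap _ _ Tu ur (gapF Tu ur nc Fi))[_ Fz].
    by rewrite in_fset_set//; apply: mem_set.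
  apply: (@finite_preimage _ _ [set` fset_set (F u n)] (cat [:: 0, i & w']%N)).
    by move=> x z _ _ /eqP; rewrite eqseq_cat// eqxx => /eqP.
  exact: finite_fset.
move: wr; rewrite we size_cat size_emb ur; case: (y) => [|a y'] /=; first by rewrite cats0.
by lia.
Qed.

Lemma glue_tree_spine_child u j : T0 u -> (0 < size u < r)%N ->
  Y (rcons (emb u) j) <-> exists k, (k < nchild T0 u)%N /\ j = (st u k + gapn u k)%N.
Proof.
move=> Tu ur; have u0 : u != [::] by case: (u) ur.
split=> [Yj|[k [/(nchildP _ T0_tree Tu) Tk ->]]]; last first.
  by rewrite -spine_posE// -emb_rcons; exact: glue_tree_spine.
have [|u' Tu' e] := glue_tree_spineP Yj; first by rewrite size_rcons size_emb; case/andP: ur.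
case/lastP: u' Tu' e => [|u' k] Tk; first by case: (emb u).
rewrite emb_rcons => /rcons_inj[/emb_inj ue ->].
by exists k; split; [apply/(nchildP _ T0_tree Tu); rewrite ue|rewrite -spine_posE// ue].
Qed.

Lemma glue_tree_relab u : T0 u -> relab Y (emb u) = u.
Proof.
elim/last_ind: u => [//|u k IH] Tk.
have Tu : T0 u by move: Tk; rewrite -cats1; exact: tree_cat.
rewrite emb_rcons relab_rcons IH//; congr rcons.
have [u0|u0] := eqVneq u [::].
  rewrite u0 /=; have [] // := tree_root (u := rcons u k) T0_tree Tk.
    by rewrite u0.
  by move=> u'; rewrite u0 => -[-> _]; rewrite /nsp_before big_ord0.
have ur : (0 < size u < r)%N.
  by rewrite lt0n size_eq0 u0 /=; have := T0_size Tk; rewrite size_rcons.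
rewrite spine_posE//; apply: (nsp_st (c := nchild T0 u)) => //.
  by move=> j; exact: glue_tree_spine_child.
by apply: ltnW; apply/(nchildP _ T0_tree Tu).
Qed.

Lemma glue_tree_chi : Bball r (chi T) = T0.
Proof.
apply/seteqP; split => u.
  move=> [[w Yw <-] wr]; rewrite size_relab in wr.
  by have [u' Tu' ->] := glue_tree_spineP Yw wr; rewrite glue_tree_relab.
move=> Tu; split; last exact: T0_size.
by exists (emb u); [exact: glue_tree_spine|exact: glue_tree_relab].
Qed.

Lemma glue_tree_gap u n : T0 u -> (0 < size u < r)%N -> (n <= nchild T0 u)%N ->
  gap_branch T Y (emb u) n = F u n.
Proof.
move=> Tu ur nc; have [tF fF] := F_ok Tu ur nc; have [[F0 F00] _ _ _ _] := tF.
have u0 : u != [::] by case: (u) ur.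
have spineP := fun j => glue_tree_spine_child j Tu ur.
have nsp := nsp_st (c := nchild T0 u) spineP.
have gapP j : in_gap T Y (emb u) n j <-> exists i, (i < gapn u n)%N /\ j = (st u n + i)%N.
  split=> [[Tj nYj nj]|[i [ig ->]]].
    move: (Tj); rewrite TE -cats1 => /(glue_inv Tu)[[//|[_ [n' [i [w' [n'c Fi [je _]]]]]]|[e]]|[k [y' [Tk [je _] _]]]].
    - have ig := gapF Tu ur n'c Fi.
      have := nj; rewrite je nsp ?(ltnW ig)// => nn; rewrite -nn.
      by exists i.
    - by move: ur; rewrite e ltnn andbF.
    - exfalso; apply: nYj; apply/spineP; exists k; rewrite je spine_posE//; split => //.
      by apply/(nchildP _ T0_tree Tu).
  have Fi : F u n [:: 0%N; i] by apply/(nchildP _ tF F00).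
  split; last by apply: nsp => //; exact: ltnW.
    by rewrite TE -cats1; apply/(glue_gap _ _ Tu ur ig).
  move=> /spineP[k [_ e]]; have [nk ik] := st_inj (ltnW ig) (leqnn _) e.
  by move: ig; rewrite ik nk ltnn.
have go := gap_off_st gapP.
apply/seteqP; split => x.
  move=> [->//|[->//|[j [u' [/gapP[i [ig ->]] -> ]]]]].
  rewrite go ?(ltnW ig)// TE cat_rcons => /(glue_gap _ _ Tu ur ig)[_].
  exact.
move=> Fx; have [->|x0] := eqVneq x [::]; first by left.
have [[|i w'] xe] := tree_root tF Fx x0; first by right; left.
rewrite xe in Fx *; have ig := gapF Tu ur nc Fx.
right; right; exists (st u n + i)%N, w'; rewrite go ?(ltnW ig)//; split => //.
  by apply/gapP; exists i.
by rewrite TE cat_rcons; apply/(glue_gap _ _ Tu ur ig).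
Qed.

End GlueTree.

Lemma spine_infinite_plant (T : tree) w : spine_set T w -> ~ finite_set (plant T w).
Proof. by move=> [_ iw] /finite_plant; apply. Qed.

(** * Decomposing a tree along its spine *)

Section Decompose.
Variable T : tree.
Local Notation Y := (spine_set T).
Hypothesis chiE : Bball r (chi T) = T0.
Hypothesis gapE : forall w, Y w -> (0 < size w < r)%N ->
  forall n, (n <= nchild T0 (relab Y w))%N -> gap_branch T Y w n = F (relab Y w) n.

Lemma spine_relab w : Y w -> (size w <= r)%N -> T0 (relab Y w).
Proof. by move=> Yw wr; rewrite -chiE; split; [exists w|rewrite size_relab]. Qed.

(** Reading the children of w from left to right, a spine child closes the current block and any
    other child advances the offset inside it, so the index j can be recovered from the sector and
    the offset. The offset is bounded by [gapn] because the branch in that sector has exactly [gapn]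
    children below its root edge. *)
Lemma spine_index w j : Y w -> (0 < size w < r)%N ->
  (forall j', (j' < j)%N -> tverts T (rcons w j')) ->
  let u := relab Y w in let n := nsp_before Y w j in let i := gap_off T Y w n j in
  [/\ (n <= nchild T0 u)%N, (i <= gapn u n)%N, j = (st u n + i)%N,
      Y (rcons w j) -> i = gapn u n &
      in_gap T Y w n j -> (i < gapn u n)%N].
Proof.
move=> Yw wr; have Tu : T0 (relab Y w) by apply: spine_relab => //; case/andP: wr => _ /ltnW.
have ur : (0 < size (relab Y w) < r)%N by rewrite size_relab.
have ncle k : (nsp_before Y w k <= nchild T0 (relab Y w))%N.
  case en : (nsp_before Y w k) => [|n] //.
  have [|k' [_ Yk' kn]] := @nsp_before_ivt Y w k n; first by rewrite en.
  apply/(nchildP _ T0_tree Tu); rewrite -kn -relab_rcons; apply: spine_relab => //.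
  by rewrite size_rcons; case/andP: wr.
have gapnP n : (n <= nchild T0 (relab Y w))%N -> forall i, (i < gapn (relab Y w) n)%N <->
    exists j', in_gap T Y w n j' /\ i = gap_off T Y w n j'.
  move=> nc i; have [tF _] := F_ok Tu ur nc; have [[_ F00] _ _ _ _] := tF.
  rewrite -(nchildP i tF F00) -gapE//; split.
    by move=> [//|[//|[j' [u' [gj' [-> _] _]]]]]; exists j'.
  move=> [j' [gj' ->]]; right; right; exists j', [::]; split => //.
  by rewrite cats0; case: gj'.
have gle k n : (n <= nchild T0 (relab Y w))%N -> (gap_off T Y w n k <= gapn (relab Y w) n)%N.
  move=> nc; rewrite leqNgt; apply/negP => /gap_off_ivt[k' [_ gk' e]].
  have : (gapn (relab Y w) n < gapn (relab Y w) n)%N by apply/gapnP => //; exists k'.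
  by rewrite ltnn.
(* To the right of the spine child k the sector number has increased, so all of the sector's
   children lie to the left of k. *)
have gY k : Y (rcons w k) -> gap_off T Y w (nsp_before Y w k) k = gapn (relab Y w) (nsp_before Y w k).
  move=> Yk; apply/eqP; rewrite eqn_leq gle//= leqNgt; apply/negP.
  move=> /(gapnP _ (ncle k))[k' [gk' e]].
  have [kk|kk|kk] := ltngtP k k'.
  - have := @nsp_before_mono Y w _ _ kk; rewrite nsp_beforeS asboolT//.
    by case: gk' => _ _ ->; lia.
  - have := @gap_off_mono T Y w (nsp_before Y w k) _ _ kk.
    by rewrite gap_offS asboolT// e; lia.
  - by case: gk' => _; rewrite -kk.
have gT k : in_gap T Y w (nsp_before Y w k) k ->
    (gap_off T Y w (nsp_before Y w k) k < gapn (relab Y w) (nsp_before Y w k))%N.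
  by move=> gk; apply/gapnP => //; exists k.
move=> Tj /=; split; [exact: ncle|exact: gle| |exact: gY|exact: gT].
elim: j Tj => [|j IH] Tj.
  by rewrite /gap_off /nsp_before !big_ord0 st0.
have {}IH : j = (st (relab Y w) (nsp_before Y w j) + gap_off T Y w (nsp_before Y w j) j)%N.
  by apply: IH => j' jj; apply: Tj; exact: ltnW.
rewrite nsp_beforeS; case: asboolP => [Yj|nYj].
  (* A spine child ends block n: the offset restarts at 0 at the beginning of block n + 1. *)
  rewrite addn1 stS gap_off_eq0 ?addn0 ?addnS; first by rewrite -gY// -IH.
  move=> j' jj [_ _ e]; have := @nsp_before_mono Y w j' j jj; rewrite e; lia.
rewrite addn0 gap_offS asboolT; first by rewrite addn1 addnS -IH.
by split => //; exact: Tj.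
Qed.

Lemma spine_eq_emb w : Y w -> (size w <= r)%N -> w = emb (relab Y w).
Proof.
elim/last_ind: w => [//|w j IH] Yj wr.
have Yw : Y w by move: Yj; rewrite -cats1; exact: spine_cat.
have wr' : (size w < r)%N by rewrite size_rcons in wr.
rewrite relab_rcons emb_rcons -IH ?(ltnW wr')//; congr rcons.
have [w0|w0] := eqVneq w [::].
  rewrite w0 /= in Yj *.
  have [] // := tree_root (u := [:: j]) (tree_ok T); first by case: Yj.
  by move=> u' [-> _]; rewrite /nsp_before big_ord0.
have wr2 : (0 < size w < r)%N by rewrite lt0n size_eq0 w0.
have Tj j' : (j' < j)%N -> tverts T (rcons w j').
  by move=> jj; apply: tree_sib (tree_ok T) _ (ltnW jj); case: Yj.
have [_ _ je /(_ Yj) ie _] := spine_index Yw wr2 Tj.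
by rewrite spine_posE -?ie// -size_eq0 size_relab size_eq0.
Qed.

Lemma emb_spine u : T0 u -> Y (emb u).
Proof.
rewrite -{1}chiE => -[[w Yw we] ur]; rewrite -we -spine_eq_emb//.
by rewrite -(size_relab Y) we.
Qed.

Lemma relab_emb u : T0 u -> relab Y (emb u) = u.
Proof.
rewrite -{1}chiE => -[[w Yw we] ur].
by rewrite -we -spine_eq_emb// -(size_relab Y) we.
Qed.

(** Induction on the address: a new last letter either stays inside a branch, or leaves a vertex of
    the embedded spine, where [spine_index] tells whether it leads to a spine child or into a
    sector. *)
Lemma tree_glueE : tverts T = glue (fun v => plant T (emb v)).
Proof.
have tT := tree_ok T.
apply/seteqP; split => x; last first.
  move=> [u [y [Tu -> p]]]; have [Tw _] := emb_spine Tu.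
  case: p => [->|[ur [n [i [w' [nc Fi ->]]]]]|[ur]]; first by rewrite cats0.
    have Yu := emb_spine Tu.
    move: Fi; rewrite -{1}(relab_emb Tu) -gapE ?size_emb ?relab_emb// => Fi.
    have ig : (0 < size (emb u) < r)%N by rewrite size_emb.
    case: Fi => [//|[//|[j [u' [gj [ie we] Tj]]]]].
    have Tj' j' : (j' < j)%N -> tverts T (rcons (emb u) j').
      by move=> jj; apply: tree_sib tT _ (ltnW jj); case: gj.
    have [_ _ je _ _] := spine_index Yu ig Tj'.
    have nj : nsp_before Y (emb u) j = n by case: gj.
    move: je; rewrite relab_emb// nj -ie => je.
    by rewrite -je we -cat_rcons.
  by move=> [//|[u' [[->]]]].
elim/last_ind: x => [|x j IH] Tj.
  have [[T0n _] _ _ _ _] := T0_tree.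
  exact: (glue_emb _ T0n).
have Tx : tverts T x by move: Tj; rewrite -cats1; exact: tree_cat.
have [u [y [Tu xe p]]] := IH Tx.
case: p => [y0|[ur [n [i [w' [nc Fi ye]]]]]|[ur Uy]].
- rewrite y0 cats0 in xe.
  have [ur|ur] := eqVneq (size u) r.
    rewrite xe -cats1; apply: glue_part => //; constructor 3; split => //; right.
    by exists [:: j]; rewrite cats1 -xe.
  have ur' : (size u < r)%N by rewrite ltn_neqAle ur T0_size.
  have [u0|u0] := eqVneq u [::].
    have [] // := tree_root (u := rcons x j) tT Tj; first by case: (x).
    move=> z; rewrite xe u0 /= => -[j0 _]; rewrite j0.
    have [[_ T00] _ _ _ _] := T0_tree.
    exact: (glue_emb _ T00).
  have ui : (0 < size u < r)%N by rewrite lt0n size_eq0 u0.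
  have ei : (0 < size (emb u) < r)%N by rewrite size_emb.
  have Yx := emb_spine Tu; rewrite xe in Tj *.
  have [Yj|nYj] := pselect (Y (rcons (emb u) j)).
    have rr : (size (rcons (emb u) j) <= r)%N by rewrite size_rcons size_emb.
    by rewrite (spine_eq_emb Yj rr); apply: glue_emb; exact: spine_relab.
  have Tj' j' : (j' < j)%N -> tverts T (rcons (emb u) j').
    by move=> jj; apply: tree_sib tT _ (ltnW jj).
  have [nc _ je _ gi] := spine_index Yx ei Tj'.
  rewrite relab_emb// in nc je gi.
  have gj : in_gap T Y (emb u) (nsp_before Y (emb u) j) j by split.
  rewrite -cats1 {1}je; apply/(glue_gap _ _ Tu ui (gi gj)); split => //.
  have [tF _] := F_ok Tu ui nc; have [[_ F00] _ _ _ _] := tF.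
  exact/(nchildP _ tF F00)/gi.
- have Yu := emb_spine Tu.
  have ei : (0 < size (emb u) < r)%N by rewrite size_emb.
  have FE : F u n = gap_branch T Y (emb u) n by rewrite gapE ?relab_emb.
  rewrite xe ye rcons_cat rcons_cons; apply/(glue_gap _ _ Tu ur (gapF Tu ur nc Fi)).
  split => //; move: Fi; rewrite FE => -[//|[//|[k [u' [gk [ie we] Tk]]]]].
  right; right; exists k, (rcons u' j); split => //; first by rewrite ie we.
  have Tk' j' : (j' < k)%N -> tverts T (rcons (emb u) j').
    by move=> jj; apply: tree_sib tT _ (ltnW jj); case: gk.
  have [_ _ ke _ _] := spine_index Yu ei Tk'.
  have nk : nsp_before Y (emb u) k = n by case: gk.
  move: ke; rewrite relab_emb// nk -ie => ke.
  by rewrite ke cat_rcons -we -rcons_cons -rcons_cat -ye -xe.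
- rewrite xe rcons_cat; apply: glue_part => //; constructor 3; split => //.
  by right; exists (rcons y j); split => //; rewrite -rcons_cat -xe.
Qed.

End Decompose.

(** * Branch events as cylinder events *)

Section Tops.
Variables (d : nat) (S : word -> set word).
Hypothesis d_gt0 : (0 < d)%N.
Hypothesis S_ok : forall v, T0 v -> size v = r ->
  [/\ is_tree (S v), finite_set (S v) & tree_height (S v) d].

(** [S v] is planted, so its level d lies d - 1 generations below [emb v]; [behead] drops the letter
    of the root edge. All tops, whatever the leaf v, thus have the same height r + d - 1. *)
Definition tops v : seq word :=
  [seq emb v ++ behead x | x <- enum_fset (fset_set (S v)) & size x == d].

Definition groups : seq (seq word) := [seq tops v | v <- leaves].

Lemma topsP v z : T0 v -> size v = r ->
  z \in tops v <-> exists y, [/\ z = emb v ++ y, S v (0%N :: y) & (size y).+1 = d].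
Proof.
move=> Tv vr; have [tS fS _] := S_ok Tv vr; split.
  move=> /mapP[x]; rewrite mem_filter in_fset_set// => /andP[/eqP xd /set_mem Sx] ->.
  have x0 : x != [::] by rewrite -size_eq0 xd -lt0n.
  by have [y xe] := tree_root tS Sx x0; exists y; rewrite xe -xd xe in Sx *.
move=> [y [-> Sy yd]]; apply/mapP; exists (0%N :: y) => //.
by rewrite mem_filter /= yd eqxx /= in_fset_set//; apply: mem_set.
Qed.

Lemma groupsP z : z \in flatten groups <->
  exists v y, [/\ T0 v, size v = r, z = emb v ++ y, S v (0%N :: y) & (size y).+1 = d].
Proof.
split.
  move=> /flatten_mapP[v /leavesP[Tv vr] /(topsP _ Tv vr)[y [? ? ?]]].
  by exists v, y.
move=> [v [y [Tv vr ? ? ?]]]; apply/flatten_mapP; exists v; first exact/leavesP.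
by apply/(topsP _ Tv vr); exists y.
Qed.

Lemma size_groups z : z \in flatten groups -> size z = (r + d.-1)%N.
Proof. by move=> /groupsP[v [y [Tv vr -> _ <-]]]; rewrite size_cat size_emb vr. Qed.

Lemma size_tops v : T0 v -> size v = r -> size (tops v) = ncard [set x | S v x /\ size x = d].
Proof.
move=> Tv vr; have [tS fS _] := S_ok Tv vr.
rewrite size_map -ncard_seq ?filter_uniq ?fset_uniq//; congr ncard.
apply/seteqP; split => x /=; rewrite mem_filter in_fset_set//.
  by move=> /andP[/eqP ? /set_mem].
by move=> [Sx ->]; rewrite eqxx; apply: mem_set.
Qed.

Lemma emb_leaf_inj v v' y y' : size v = r -> size v' = r ->
  emb v ++ y = emb v' ++ y' -> v = v' /\ y = y'.
Proof.
move=> vr vr' /eqP; rewrite eqseq_cat ?size_emb ?vr// => /andP[/eqP/emb_inj -> /eqP ->].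
by [].
Qed.

Lemma uniq_groups : uniq (flatten groups).
Proof.
rewrite /groups; have : forall v, v \in leaves -> T0 v /\ size v = r by move=> v /leavesP.
have : uniq leaves by exact: fset_uniq.
elim: leaves => [//|v l IH] /= /andP[vl ul] lP.
have [Tv vr] := lP v (mem_head _ _).
rewrite cat_uniq IH// => [|v' v'l]; last by apply: lP; rewrite inE v'l orbT.
rewrite andbT; apply/andP; split.
  rewrite map_inj_in_uniq ?filter_uniq ?fset_uniq// => x x'.
  rewrite !mem_filter; have [tS fS _] := S_ok Tv vr; rewrite !in_fset_set//.
  move=> /andP[/eqP xd /set_mem Sx] /andP[/eqP xd' /set_mem Sx'] /eqP.
  rewrite eqseq_cat// eqxx => /eqP /= e.
  have x0 : x != [::] by rewrite -size_eq0 xd -lt0n.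
  have x0' : x' != [::] by rewrite -size_eq0 xd' -lt0n.
  have [y xe] := tree_root tS Sx x0.
  have [y' xe'] := tree_root tS Sx' x0'.
  by move: e; rewrite xe xe' /= => ->.
apply/hasPn => z /flatten_mapP[v' v'l].
have [|Tv' vr'] := lP v'; first by rewrite inE v'l orbT.
move=> /(topsP _ Tv' vr')[y' [-> _ _]]; apply/negP => /(topsP _ Tv vr)[y [e _ _]].
by have [ve _] := emb_leaf_inj vr' vr e; rewrite ve (negbTE vl) in v'l.
Qed.

Lemma is_tree_glueS : is_tree (glue S).
Proof. by apply: is_tree_glue => v Tv vr; have [] := S_ok Tv vr. Qed.

Lemma openleaves_groups : openleaves (glue S) (flatten groups).
Proof.
split; first exact: uniq_groups.
  by move=> z /groupsP[v [y [Tv vr -> Sy _]]]; apply: glue_part => //; constructor 3.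
move=> z k /groupsP[v [y [Tv vr -> Sy yd]]]; have [tS _ [hS _]] := S_ok Tv vr.
by rewrite rcons_cat => /(glue_leaf _ Tv vr tS)/hS /=; rewrite size_rcons yd; lia.
Qed.

(** The trees planted at the leaves are constrained only through their balls of radius d, because
    everything strictly below a top is cut away. *)
Lemma cylinder_glue (T : tree) : cylinder (glue S) (flatten groups) T <->
  tverts T = glue (fun v => plant T (emb v)) /\
  forall v, T0 v -> size v = r -> Bball d (plant T (emb v)) = S v.
Proof.
have tT := tree_ok T; split=> [TS|[TE TB]].
  have Tg x : glue S x -> tverts T x by rewrite -TS => -[].
  split.
    apply/seteqP; split => x.
      move=> Tx; have [[q [k [u [xe oG]]]]|nx] :=
        pselect (exists o k u, x = o ++ k :: u /\ o \in flatten groups).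
        have [v [y [Tv vr oe _ _]]] := (groupsP q).1 oG.
        rewrite xe oe -catA; apply: glue_part => //; constructor 3; split => //.
        by right; exists (y ++ k :: u); split => //; rewrite catA -oe -xe.
      have : glue S x.
        by rewrite -TS; split => // o k u xe; apply/negP => oG; apply: nx; exists o, k, u.
      move=> [u [y [Tu xe p]]]; rewrite xe; apply: glue_part => //.
      case: p => [->|[ur gy]|[ur _]]; [by constructor 1|by constructor 2|constructor 3].
      by split => //; right; exists y; rewrite -xe.
    move=> [u [y [Tu -> p]]].
    case: p => [->|[ur gy]|[ur]].
    - by rewrite cats0; apply: Tg; exact: glue_emb.
    - by apply: Tg; apply: glue_part => //; constructor 2.
    - by move=> [//|[u' [[->]]]].
  move=> v Tv vr; have [tS fS [hS _]] := S_ok Tv vr; have [[S0 _] _ _ _ _] := tS.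
  apply/seteqP; split => x.
    move=> [[->//|[y [-> Ty]]] yd]; apply/(glue_leaf _ Tv vr tS).
    rewrite -TS; split => // o k u e; apply/negP => /groupsP[v' [y' [Tv' vr' oe _ yd']]].
    move: e; rewrite oe -catA => /(emb_leaf_inj vr vr')[_ e].
    by move: yd; rewrite e /= size_cat /= -yd'; lia.
  move=> Sx; split; last exact: hS.
  have [->|x0] := eqVneq x [::]; first by left.
  have [y xe] := tree_root tS Sx x0; right; exists y; split => //.
  by apply: Tg; apply/(glue_leaf _ Tv vr tS); rewrite -xe.
apply/seteqP; split => x.
  move=> [Tx hx]; move: (Tx); rewrite TE => -[u [y [Tu xe p]]].
  rewrite xe; apply: glue_part => //.
  case: p => [->|[ur gy]|[ur Uy]]; [by constructor 1|by constructor 2|].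
  constructor 3; split => //; rewrite -TB//; split => //.
  (* A vertex beyond the ball lies strictly below the top given by its first [d.-1] letters, so it
     would have been pruned. *)
  rewrite leqNgt; apply/negP => yd.
  have sT : (size (take d.-1 y)).+1 = d.
    by move: yd => /= yd; rewrite size_take_min; lia.
  case ed : (drop d.-1 y) => [|k t].
    by move: (congr1 size ed) yd; rewrite size_drop /=; lia.
  have := hx (emb u ++ take d.-1 y) k t; rewrite -catA -ed cat_take_drop => /(_ xe)/negP; apply.
  apply/groupsP; exists u, (take d.-1 y); split => //.
  rewrite -TB//; split; last by rewrite /= sT.
  right; exists (take d.-1 y); split => //.
  by apply: (tree_cat (u := drop d.-1 y) tT); rewrite -catA cat_take_drop -xe.
move=> [u [y [Tu -> p]]]; split.
  rewrite TE; apply: glue_part => //.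
  case: p => [->|[ur gy]|[ur Uy]]; [by constructor 1|by constructor 2|].
  constructor 3; split => //; move: Uy; rewrite -TB//; by case.
move=> o k t e; apply/negP => /groupsP[v [z [Tv vr oe _ zd]]].
move: e; rewrite oe -catA => e.
case: (emb_prefix e) => [[z' ve]|[k' [z' ue]]]; last first.
  by have := T0_size Tu; rewrite ue size_cat vr /=; lia.
case: z' ve => [|k' z'] ve.
  rewrite cats0 in ve; move: p e; rewrite -ve => p /(emb_leaf_inj vr vr)[_ e].
  case: p => [ye|[]|[_]]; first by move: e; rewrite ye; case: (z).
    by rewrite vr ltnn andbF.
  have [_ _ [hS _]] := S_ok Tv vr; move=> /hS; rewrite e /= size_cat /= -zd; lia.
move: e; rewrite ve emb_cat -catA => /eqP; rewrite eqseq_cat// eqxx => /eqP /= ye.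
move: p; rewrite ye; apply: part_pos => //.
by rewrite -vr ve size_cat /=; lia.
Qed.

(** There are finitely many tops: if each has finite progeny, one t bounds all their extinction
    times, and the whole branch is extinct after d - 1 + t generations. *)
Lemma tops_infinite (T : tree) v : T0 v -> size v = r ->
  Bball d (plant T (emb v)) = S v ->
  (exists2 z, z \in tops v & infdesc z T) <-> ~ finite_set (plant T (emb v)).
Proof.
move=> Tv vr TB; have tT := tree_ok T; split.
  move=> [z /(topsP _ Tv vr)[y [ze _ _]] iz] fp; apply: iz.
  apply: (@sub_finite_set _ _ [set u | ([:: 0%N] ++ (y ++ u)) \in fset_set (plant T (emb v))]).
    move=> u; rewrite /= ze -catA => Tu; rewrite in_fset_set//; apply: mem_set.
    by right; exists (y ++ u).
  apply: (@finite_preimage _ _ [set` fset_set (plant T (emb v))] (fun u => [:: 0%N] ++ (y ++ u))).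
    by move=> x x' _ _ /eqP; rewrite eqseq_cat// eqxx eqseq_cat// eqxx => /eqP.
  exact: finite_fset.
move=> ip; apply: contrapT => nz; apply: ip; apply/finite_plant.
have : finall (tops v) T by move=> z zt iz; apply: nz; exists z.
rewrite finallE => -[t _ dt]; apply/(finite_die _ tT); exists (d.-1 + t)%N => y yt Ty.
pose y1 := take d.-1 y.
have sy1 : (size y1).+1 = d by rewrite size_take_min; lia.
apply: (dt (emb v ++ y1) _ (drop d.-1 y)).
- apply/(topsP _ Tv vr); exists y1; split => //; rewrite -TB; split; last by rewrite /= sy1.
  right; exists y1; split => //.
  by apply: (tree_cat (u := drop d.-1 y) tT); rewrite -catA cat_take_drop.
- by rewrite size_drop; lia.
- by rewrite -catA cat_take_drop.
Qed.

(** The cylinder alone does not determine the spine. The survival of every group makes each leaf of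
    [T0] a spine vertex, and the finiteness of the branches F keeps everything else off the spine up
    to height r. *)
Lemma branch_event_cylinder :
  branch_event T0 r d S F = cylinder (glue S) (flatten groups) `&` infgroups groups.
Proof.
apply/seteqP; split => T.
  move=> [chiE plantE gapE].
  have gE w (Yw : spine_set T w) (wr : (0 < size w < r)%N) n :
      (n <= nchild T0 (relab (spine_set T) w))%N ->
      gap_branch T (spine_set T) w n = F (relab (spine_set T) w) n.
    by move=> nc; exact: gapE.
  have TB v : T0 v -> size v = r -> Bball d (plant T (emb v)) = S v.
    move=> Tv vr; rewrite -[in RHS](relab_emb chiE gE Tv); apply: plantE.
      exact: emb_spine.
    by rewrite size_emb.
  split.
    by apply/cylinder_glue; split => //; exact: tree_glueE.
  move=> G /mapP[v /leavesP[Tv vr] ->]; apply/(tops_infinite Tv vr (TB _ Tv vr)).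
  by apply: spine_infinite_plant; exact: emb_spine.
move=> [/cylinder_glue[TE TB] TI].
have Temb u : T0 u -> tverts T (emb u) by move=> Tu; rewrite TE; exact: glue_emb.
have Ut v : T0 v -> size v = r -> is_tree (plant T (emb v)).
  by move=> Tv _; apply: is_tree_plant; exact: Temb.
have Ui v : T0 v -> size v = r -> ~ finite_set (plant T (emb v)).
  move=> Tv vr; apply/(tops_infinite Tv vr (TB _ Tv vr)); apply: TI.
  by apply/mapP; exists v => //; apply/leavesP.
split; first exact: glue_tree_chi Ut Ui TE.
- move=> w Yw wr.
  have [|u Tu we] := glue_tree_spineP TE Yw; first by rewrite wr.
  rewrite we (glue_tree_relab Ut Ui TE Tu); apply: TB => //.
  by rewrite -(size_emb F) -we.
- move=> w Yw wr n.
  have [|u Tu we] := glue_tree_spineP TE Yw; first by case/andP: wr => _ /ltnW.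
  have ur : (0 < size u < r)%N by rewrite -(size_emb F) -we.
  rewrite we (glue_tree_relab Ut Ui TE Tu) => nc.
  exact: (glue_tree_gap Ut Ui TE).
Qed.

End Tops.

End Glue.

(** * Dirichlet integrals *)

Section Dirichlet.
Variable R : realType.
Implicit Types (t m : R) (p q : {poly R}).

Lemma LamD t p q : Lam t (p + q) = Lam t p + Lam t q.
Proof.
pose n := maxn (size p) (size q).
rewrite (@LamE _ _ _ n (size_polyD _ _)) (@LamE _ _ p n) ?leq_maxl// (@LamE _ _ q n) ?leq_maxr//.
by rewrite -big_split/=; apply: eq_bigr => i _; rewrite coefD mulrDl.
Qed.

Lemma LamZ t a p : Lam t (a *: p) = a * Lam t p.
Proof.
rewrite (@LamE _ _ _ (size p) (size_scale_leq _ _)) /Lam mulr_sumr.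
by apply: eq_bigr => i _; rewrite coefZ mulrA.
Qed.

Lemma Lam0 t : Lam t 0 = 0.
Proof. by rewrite /Lam size_poly0 big_ord0. Qed.

Lemma LamXn t n : Lam t 'X^n = cw t n.
Proof.
rewrite (@LamE _ _ _ n.+1) ?size_polyXn// big_ord_recr/= coefXn eqxx mul1r.
by rewrite big1 ?add0r// => i _; rewrite coefXn ltn_eqF// mul0r.
Qed.

Lemma LamM t p q : Lam t (p * q) =
  \sum_(i < size p) \sum_(j < size q) p`_i * q`_j * cw t (i + j).
Proof.
have e : p * q = \sum_(i < size p) \sum_(j < size q) (p`_i * q`_j) *: 'X^(i + j).
  rewrite -[p in LHS]coefK -[q in LHS]coefK !poly_def mulr_suml.
  apply: eq_bigr => i _; rewrite mulr_sumr; apply: eq_bigr => j _.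
  by rewrite -scalerAl -scalerAr scalerA exprD.
rewrite e (big_morph (Lam t) (LamD t) (Lam0 t)); apply: eq_bigr => i _.
rewrite (big_morph (Lam t) (LamD t) (Lam0 t)); apply: eq_bigr => j _.
by rewrite LamZ LamXn.
Qed.

(** Divided powers as polynomials. Each one is the derivative of the next, which yields the explicit
    primitive in [Lam_beta]. *)
Definition wp k : {poly R} := if k is k'.+1 then (k'`!%:R)^-1 *: 'X^k' else 0.

Lemma wpE k t : (wp k).[t] = cw t k.
Proof. by case: k => [|k] /=; rewrite ?horner0// hornerZ hornerXn mulrC. Qed.

Lemma deriv_wp k : (wp k.+1)^`() = wp k.
Proof.
case: k => [|k] /=; first by rewrite derivZ derivC scaler0.
rewrite derivZ derivXn /= -[X in _ *: X]scaler_nat scalerA; congr (_ *: _).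
by rewrite factS natrM invfM mulrAC mulVf ?mul1r ?pnatr_eq0.
Qed.

Local Arguments wp : simpl never.

Lemma cw0n k : cw (0 : R) k.+2 = 0.
Proof. by rewrite /= expr0n mul0r. Qed.

Lemma integral_poly (P : {poly R}) m : 0 < m ->
  (\int[@lebesgue_measure R]_(t in [set t : R | (0 < t < m)%R]) (P^`().[t])%:E)%E
  = (P.[m] - P.[0])%:E.
Proof.
move=> m0.
have -> : [set t : R | 0 < t < m] = `]0, m[%classic.
  by apply/seteqP; split => t /=; rewrite in_itv.
have cP (Q : {poly R}) : continuous (horner Q).
  by move=> x; apply: differentiable_continuous; apply/derivable1_diffP; exact: derivable_horner.
rewrite -(@integral_itv_bndoo _ 0 m _ true false); last first.
  apply/measurable_EFinP; apply: measurable_funTS.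
  by apply: continuous_measurable_fun; exact: cP.
rewrite (@continuous_FTC2 _ _ (horner P))//.
- by apply: continuous_subspaceT; exact: cP.
- split.
  + by move=> x _; exact: derivable_horner.
  + by apply: cvg_at_right_filter; exact: cP.
  + by apply: cvg_at_left_filter; exact: cP.
- by move=> x _; rewrite derivE.
Qed.

Lemma Lam_wp t p : Lam t p = (\sum_(i < size p) p`_i *: wp i).[t].
Proof. by rewrite horner_sum; apply: eq_bigr => i _; rewrite hornerZ wpE. Qed.

(** On monomials this is the Beta integral of t^(i-1)/(i-1)! times (m-t)^(j-1)/(j-1)!, with value
    m^(i+j-1)/(i+j-1)!. The constant terms must vanish because [Lam] kills them in each factor,
    while in the product they would multiply the other polynomial. *)
Lemma Lam_beta m p q : 0 < m -> p`_0 = 0 -> q`_0 = 0 ->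
  (\int[@lebesgue_measure R]_(t in [set t : R | (0 < t < m)%R])
     (Lam t p * Lam (m - t) q)%:E)%E = (Lam m (p * q))%:E.
Proof.
move=> m0 p0 q0; pose Q : {poly R} := m%:P - 'X.
pose wQ k := wp k \Po Q.
have dQ : Q^`() = -1 by rewrite derivB derivC derivX sub0r.
have wQ0 : wQ 0 = 0 by rewrite /wQ comp_poly0.
have wQE k t : (wQ k).[t] = cw (m - t) k by rewrite horner_comp !hornerE wpE.
(* A primitive of [wp i * wQ j] from repeated integration by parts: its derivative telescopes. At 0
   it vanishes for positive i, and at m only the last summand survives. *)
pose G i j := \sum_(k < j) wp (i + k).+1 * wQ (j - k)%N.
have dG i j : (G i j)^`() = wp i * wQ j.
  pose a k := wp (i + k) * wQ (j - k)%N.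
  rewrite raddf_sum (eq_bigr (fun k : 'I_j => a k - a k.+1)); last first.
    move=> k _ /=; rewrite derivM deriv_wp /a /wQ deriv_comp dQ.
    have -> : (j - k)%N = (j - k.+1)%N.+1 by rewrite subnSK.
    by rewrite deriv_wp addnS mulrN1 mulrN.
  rewrite -(big_mkord xpredT (fun k => a k - a k.+1)).
  rewrite (@telescope_sumr_eq _ 0 j (fun k => - a k))//; last first.
    by move=> k _; rewrite opprK addrC.
  by rewrite /a subnn wQ0 mulr0 oppr0 add0r opprK addn0 subn0.
have G0 i j : (G i.+1 j).[0] = 0.
  rewrite horner_sum big1// => k _.
  by rewrite hornerM wpE addSn cw0n mul0r.
have Gm i j : (G i j.+1).[m] = cw m (i + j).+1.
  rewrite horner_sum big_ord_recr/= big1 ?add0r => [|k _]; last first.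
    rewrite hornerM wQE subrr (_ : (j.+1 - k) = (j.-1 - k).+2)%N ?cw0n ?mulr0//.
    by have := ltn_ord k; lia.
  by rewrite hornerM wQE wpE subrr subSnn /= expr0 divr1 mulr1.
pose P := \sum_(i < size p) \sum_(j < size q) (p`_i * q`_j) *: G i j.
have dP t : P^`().[t] = Lam t p * Lam (m - t) q.
  rewrite Lam_wp /Lam /P raddf_sum !horner_sum mulr_suml; apply: eq_bigr => i _.
  rewrite raddf_sum horner_sum mulr_sumr; apply: eq_bigr => j _ /=.
  by rewrite derivZ dG !hornerZ hornerM !wpE wQE; ring.
transitivity (\int[@lebesgue_measure R]_(t in [set t : R | (0 < t < m)%R]) (P^`().[t])%:E)%E.
  by apply: eq_integral => t _; rewrite dP.
rewrite integral_poly//; congr EFin.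
rewrite LamM /P !horner_sum -sumrB; apply: eq_bigr => i _.
rewrite !horner_sum -sumrB; apply: eq_bigr => j _.
rewrite !hornerZ -mulrBr.
case: i => [[|i] hi] /=; first by rewrite p0 !mul0r.
case: j => [[|j] hj] /=; first by rewrite q0 mulr0 !mul0r.
by rewrite G0 subr0 Gm addnS.
Qed.

(** The coordinates of a point of the simplex add up to m, so the exponentials combine to e^(-a m)
    and leave an iterated convolution of the [Lam] factors. The constant c is general so that the
    factors of the coordinate already fixed can be absorbed into it. *)
Lemma sint_prod (l : seq word) m (a : R) (C : word -> R) (P : word -> {poly R})
    (c : R) (f : (word -> R) -> \bar R) :
  uniq l -> l != [::] -> 0 < m -> (forall j, j \in l -> (P j)`_0 = 0) ->
  (forall g, (forall j, j \in l -> 0 < g j) ->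
     f g = (c * \prod_(j <- l) (C j * expR (- a * g j) * Lam (g j) (P j)))%:E) ->
  sint l m f = (c * \prod_(j <- l) C j * expR (- a * m) * Lam m (\prod_(j <- l) P j))%:E.
Proof.
elim: l m c f => [//|j l IH] m c f ul _ m0 P0 fE.
have /andP[jl ul'] : (j \notin l) && uniq l := ul.
case: l IH jl ul' ul P0 fE => [|j' l] IH jl ul' ul P0 fE.
  rewrite [sint _ _ _]/= fE => [|i _]//; rewrite !big_seq1; congr EFin; ring.
pose l' := j' :: l.
have PM0 (s : seq word) : {subset s <= j :: j' :: l} -> s != [::] -> (\prod_(i <- s) P i)`_0 = 0.
  case: s => // i s sl _; rewrite big_cons coefM big_ord1 P0 ?mul0r//.
  by apply: sl; rewrite mem_head.
transitivity (\int[@lebesgue_measure R]_(t in [set t : R | (0 < t < m)%R])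
   (sint l' (m - t) (fun g => f (fun k => if k == j then t else g k))))%E; first by [].
pose K := c * \prod_(i <- j :: l') C i * expR (- a * m).
transitivity (\int[@lebesgue_measure R]_(t in [set t : R | (0 < t < m)%R])
   (Lam t (K *: P j) * Lam (m - t) (\prod_(i <- l') P i))%:E)%E; last first.
  rewrite Lam_beta//; last 2 first.
  - by rewrite coefZ P0 ?mulr0// mem_head.
  - by apply: PM0 => // i il; rewrite inE il orbT.
  by rewrite -scalerAl LamZ [\prod_(i <- j :: _) P i]big_cons.
apply: eq_integral => t /set_mem/andP[t0 tm].
rewrite /K /l' (IH _ (c * (C j * expR (- a * t) * Lam t (P j))))//.
- congr EFin; rewrite LamZ [\prod_(i <- j :: _) C i]big_cons.
  have -> : expR (- a * m) = expR (- a * t) * expR (- a * (m - t)).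
    by rewrite -expRD; congr expR; ring.
  ring.
- by rewrite subr_gt0.
- by move=> i il; apply: P0; rewrite inE il orbT.
- move=> g g0; rewrite fE => [|i].
    rewrite big_cons eqxx mulrA; congr (_ * _)%:E.
    apply: eq_big_seq => i il; case: eqP => // ij.
    by rewrite -ij il in jl.
  rewrite inE; case: eqP => [//|_] /= ; exact: g0.
Qed.

End Dirichlet.

(** * Law of the branches *)

Section GapBranch.
Variables (T : tree) (w : word).
Local Notation Y := (spine_set T).
Hypothesis Yw : Y w.

Lemma gap_off_inj n i j : in_gap T Y w n i -> in_gap T Y w n j ->
  gap_off T Y w n i = gap_off T Y w n j -> i = j.
Proof.
wlog ij : i j / (i <= j)%N => [h gi gj e|gi gj e].
  by have [ij|/ltnW ji] := leqP i j; [exact: h|apply/esym; exact: h].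
apply/eqP; rewrite eqn_leq ij leqNgt; apply/negP => lt.
have := @gap_off_mono T Y w n _ _ lt; rewrite gap_offS asboolT// e; lia.
Qed.

Lemma is_tree_gap_branch n : is_tree (gap_branch T Y w n).
Proof.
have tT := tree_ok T; have [_ _ pT sT fT] := tT; split.
- by split; [left|right; left].
- by move=> [//|[//|[j [u' []]]]].
- move=> x k [/eqP|[e|[j [u' [gj e Tj]]]]]; first by rewrite -size_eq0 size_rcons.
    by case: x e => [|a [|b x]] //= [] *; left.
  case/lastP: u' e Tj => [|u' i] e Tj.
    right; left; move: e; rewrite -[[:: 0%N; _]]/(rcons [:: 0%N] (gap_off T Y w n j)).
    by move=> /rcons_inj[].
  move: e; rewrite -!rcons_cons => /rcons_inj[-> _]; right; right.
  by exists j, u'; split => //; apply: (pT _ i); rewrite rcons_cat.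
- move=> x k [/eqP|[e|[j [u' [gj e Tj]]]]]; first by rewrite -size_eq0 size_rcons.
    by case: x e => [|a [|b x]].
  case/lastP: u' e Tj => [|u' i] e Tj.
    move: e; rewrite -[[:: 0%N; _]]/(rcons [:: 0%N] (gap_off T Y w n j)).
    move=> /rcons_inj[-> e].
    have [|j' [_ gj' je]] := @gap_off_ivt T Y w n j k; first by rewrite -e.
    right; right; exists j', [::]; split => //; first by rewrite je.
    by rewrite cats0; case: gj'.
  move: e; rewrite -!rcons_cons => /rcons_inj[-> ki]; right; right.
  exists j, (rcons u' k); split => //; rewrite -rcons_cat; apply: sT.
  by rewrite ki rcons_cat.
- move=> x [->|[->|[j [u' [gj -> Tj]]]]].
  + by exists 1%N => -[//|[//|[j [u' []]]]].
  + have [m hm] := tree_children tT (proj1 Yw).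
    exists (gap_off T Y w n m) => -[//|[//|[j [u' [gj [e _] _]]]]].
    have jm : (j < m)%N by apply/hm; case: gj.
    have := @gap_off_mono T Y w n _ _ jm; rewrite gap_offS asboolT//; lia.
  + have [m hm] := fT _ Tj; exists m => -[//|[//|[j' [u1 [gj' [e ue] Tj']]]]].
    by apply: hm; rewrite rcons_cat ue (gap_off_inj gj gj' e).
Qed.

(** A vertex has finitely many children, and a child in a sector is not on the spine, so it has
    finitely many descendants. *)
Lemma finite_gap_branch n : finite_set (gap_branch T Y w n).
Proof.
have [m hm] := tree_children (tree_ok T) (proj1 Yw).
apply: (@sub_finite_set _ _ ([set [::]] `|` ([set [:: 0%N]] `|`
  \bigcup_(j in [set j | (j < m)%N /\ in_gap T Y w n j])
    ((fun u => [:: 0%N, gap_off T Y w n j & u]) @` [set u | tverts T (rcons w j ++ u)])))).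
  move=> x [->|[->|[j [u' [gj -> Tj]]]]]; [by left|by right; left|right; right].
  by exists j; [split => //; apply/hm; case: gj|exists u'].
rewrite !finite_setU; split => //; split => //; apply: bigcup_finite.
  by apply: (@sub_finite_set _ _ `I_m); [move=> j []|exact: finite_II].
move=> j [_ [Tj nYj _]]; apply: finite_image; apply: contrapT => ij.
by apply: nYj; split.
Qed.

End GapBranch.

Lemma relab_inj (T : tree) w w' : spine_set T w -> spine_set T w' ->
  relab (spine_set T) w = relab (spine_set T) w' -> w = w'.
Proof.
elim/last_ind: w w' => [|w j IH] w' Yw Yw' e.
  by apply/esym/eqP; rewrite -size_eq0 -(size_relab (spine_set T)) -e.
case/lastP: w' Yw' e => [|w' j'] Yw' e.
  by apply/eqP; rewrite -size_eq0 -(size_relab (spine_set T)) e.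
move: e; rewrite !relab_rcons => /rcons_inj[e n].
have Yw1 : spine_set T w by move: Yw; rewrite -cats1; exact: spine_cat.
have Yw1' : spine_set T w' by move: Yw'; rewrite -cats1; exact: spine_cat.
have we := IH _ Yw1 Yw1' e; rewrite -we in Yw' n *; congr rcons.
wlog jj : j j' Yw Yw' n {e} / (j <= j')%N => [h|].
  by have [jj|/ltnW jj] := leqP j j'; [exact: h|apply/esym; exact: h].
apply/eqP; rewrite eqn_leq jj leqNgt; apply/negP => lt.
have := @nsp_before_mono (spine_set T) w _ _ lt; rewrite nsp_beforeS asboolT// n; lia.
Qed.

Section Law.
Variable R : realType.
Variables (nu : R -> probability Tsp R).
Hypothesis Hnu : forall v, 0 < v -> forall s S,
  is_tree S -> finite_set S -> tree_height S s ->
  nu v (ball_ev s S) = (nu_ball v s S)%:E.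
Variable mu : R.
Hypothesis mu_gt0 : 0 < mu.
Variables (T0 : set word) (r : nat).
Hypothesis T0_tree : is_tree T0.
Hypothesis T0_fin : finite_set T0.
Hypothesis T0_height : tree_height T0 r.
Hypothesis T0_leaves : forall w, leaf T0 w -> size w = r.

Local Notation leaves := (leaves T0).
Local Notation internals := (internals T0 r).

Definition sector_seq : seq (word * nat) :=
  [seq (u, n) | u <- internals, n <- iota 0 (nchild T0 u).+1].

Definition F_ok (F : word -> nat -> set word) (x : word * nat) : Prop :=
  is_tree (F x.1 x.2) /\ finite_set (F x.1 x.2).

Lemma sector_seqP u n : (u, n) \in sector_seq <->
  [/\ T0 u, (0 < size u < r)%N & (n <= nchild T0 u)%N].
Proof.
split.
  move=> /allpairsPdep[u' [n' [/(internalsP r T0_fin)[Tu ur] nc [-> ->]]]].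
  by move: nc; rewrite mem_iota => /andP[_ nc].
move=> [Tu ur nc]; apply/allpairsPdep; exists u, n; split => //.
  exact/(internalsP r T0_fin).
by rewrite mem_iota.
Qed.

Lemma uniq_sector_seq : uniq sector_seq.
Proof.
apply: allpairs_uniq_dep.
- by rewrite filter_uniq// fset_uniq.
- by move=> u _; exact: iota_uniq.
- by move=> [u n] [u' n'] _ _ [-> ->].
Qed.

Definition leaf_weight (d : nat) (S : word -> set word) v : R :=
  2 ^+ (ncard [set x | S v x /\ size x = d]).+1 / 4 ^+ nedges (S v).

(** Subtracting 1 does not affect [Lam] of a single factor; in a product over several leaves it is
    what requires every branch to be infinite. *)
Definition leaf_poly (d : nat) (S : word -> set word) v : {poly R} :=
  (1 + 'X) ^+ ncard [set x | S v x /\ size x = d] - 1.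

Definition S_ok (d : nat) (S : word -> set word) v : Prop :=
  [/\ is_tree (S v), finite_set (S v) & tree_height (S v) d].

Lemma nu_branch_event d S F : (0 < d)%N ->
  (forall v, v \in leaves -> S_ok d S v) ->
  (forall x, x \in sector_seq -> F_ok F x) ->
  nu mu (branch_event T0 r d S F) =
  (expR (- mu * r.-1%:R) * \prod_(x <- sector_seq) rho R (F x.1 x.2) *
    (\prod_(v <- leaves) leaf_weight d S v * expR (- d.-1%:R * mu) *
     Lam mu (\prod_(v <- leaves) leaf_poly d S v)))%:E.
Proof.
move=> d0 Sok Fok.
have Fok' u n : T0 u -> (0 < size u < r)%N -> (n <= nchild T0 u)%N ->
    is_tree (F u n) /\ finite_set (F u n).
  by move=> Tu ur nc; apply: (Fok (u, n)); apply/sector_seqP.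
have lP v := leavesP T0_fin T0_height T0_leaves v.
have Sok' v : T0 v -> size v = r -> [/\ is_tree (S v), finite_set (S v) & tree_height (S v) d].
  by move=> Tv vr; apply: Sok; apply/lP.
have r0 := r_gt0 T0_tree T0_height.
rewrite (branch_event_cylinder T0_tree T0_fin T0_height T0_leaves Fok' d0 Sok').
rewrite (nu_infgroups Hnu mu_gt0 (s := r + d.-1)); last 5 first.
- by rewrite addn_gt0 r0.
- exact: (is_tree_glueS T0_tree T0_height Fok' Sok').
- by apply: (finite_glue T0_fin Fok') => v Tv vr; have [] := Sok' _ Tv vr.
- exact: (openleaves_groups T0_tree T0_fin T0_height T0_leaves Fok' d0 Sok').
- exact: (size_groups T0_fin T0_height T0_leaves d0 Sok').
congr EFin.
rewrite (glue_weight T0_tree T0_fin T0_height T0_leaves Fok' R); last first.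
  by move=> v Tv vr; have [] := Sok' _ Tv vr.
(* The exponential splits into the part e^(-mu (r - 1)) of the spine and the part e^(-mu (d - 1)) of
   the infinite branches. *)
have -> : (r + d.-1).-1 = (r.-1 + d.-1)%N by case: (r) r0.
rewrite natrD mulrDr expRD.
have gE : \prod_(G <- groups T0 F d S) ((1 + 'X) ^+ size G - 1) = \prod_(v <- leaves) leaf_poly d S v.
  rewrite big_map; apply: eq_big_seq => v /lP[Tv vr].
  by rewrite /leaf_poly (size_tops F Sok' Tv vr).
have lv : (0 < size leaves)%N.
  have [v [Tv vr]] := T0_height.2.
  have : v \in leaves by apply/lP.
  by case: (leaves).
(* The exponent R - 1 from the gluing and the exponent 1 + (number of tops) from the cylinder add up
   to one extra factor 2 per leaf, as in the ball formula of each branch. *)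
have wE : 2 ^+ (size leaves).-1 * 2 ^+ (size (flatten (groups T0 F d S))).+1 *
    \prod_(v <- leaves) (4 ^+ nedges (S v))^-1 = \prod_(v <- leaves) leaf_weight d S v :> R.
  rewrite -exprD addnS -addSn prednK// size_flatten sumnE !big_map.
  rewrite exprD (big_morph _ (exprD 2) (expr0 _)).
  have -> : 2 ^+ size leaves = \prod_(v <- leaves) 2 :> R.
    by rewrite big_const_seq count_predT iter_mulr_1.
  rewrite -!big_split; apply: eq_big_seq => v /lP[Tv vr] /=.
  by rewrite /leaf_weight exprS (size_tops F Sok' Tv vr).
rewrite gE -wE big_allpairs_dep/= [- mu * d.-1%:R]mulrC mulrN -mulNr; ring.
Qed.

Lemma sectors_prod F : \big[*%R/1%R]_(x \in sectors T0 r) rho R (F x.1 x.2)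
  = \prod_(x <- sector_seq) rho R (F x.1 x.2).
Proof.
rewrite (fsbig_seq _ _ uniq_sector_seq).
congr (\big[*%R/1%R]_(x \in _) _); apply/seteqP; split => -[u n].
  by move=> [/= Tu ur nc]; apply/sector_seqP.
by move=> /= /sector_seqP[].
Qed.

Lemma Bball1_tree (X : set word) : is_tree X -> Bball 1 X = Bball 1 path_verts.
Proof.
move=> tX; have [[X0 X00] _ _ _ _] := tX; apply/seteqP; split => w [Xw w1]; split => //.
  have [->//|w0] := eqVneq w [::].
  by have [[|a w'] we] := tree_root tX Xw w0; move: w1; rewrite we.
by case: w Xw w1 => [|a [|b w]] //=; rewrite /path_verts /= andbT => /eqP ->.
Qed.

(** The ball of radius 1 of any planted tree is a single edge. With d = 1 and this ball, a branch
    event prescribes the finite branches only. *)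
Definition edge_ball (_ : word) : set word := Bball 1 path_verts.

Lemma edge_ballE : Bball 1 path_verts = [set w | w \in [:: [::]; [:: 0%N]]].
Proof.
apply/seteqP; split => w; rewrite /Bball /path_verts /= !inE.
  by case: w => [|a [|b w]] //= [/andP[/eqP -> _]].
by case/orP => /eqP ->.
Qed.

Lemma S_ok_edge_ball v : S_ok 1 edge_ball v.
Proof.
split; first by apply: is_tree_Bball => //; exact: path_is_tree.
  by apply: Bball_finite; exact: path_is_tree.
by split; [move=> w []|exists [:: 0%N]].
Qed.

Lemma top_edge_ball v : [set x | edge_ball v x /\ size x = 1%N] = [set [:: 0%N]].
Proof.
apply/seteqP; split => x; last by move=> ->.
by case: x => [|a [|b x]] [[]] //=; rewrite /path_verts /= andbT => /eqP ->.
Qed.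

Lemma leaf_weight_edge_ball v : leaf_weight 1 edge_ball v = 1.
Proof.
rewrite /leaf_weight top_edge_ball ncard_set1 /nedges /edge_ball edge_ballE ncard_seq//=.
by field.
Qed.

Lemma leaf_poly_edge_ball v : leaf_poly 1 edge_ball v = 'X.
Proof. by rewrite /leaf_poly top_edge_ball ncard_set1 expr1 addrAC subrr add0r. Qed.

Lemma size_leaves_gt0 : (0 < size leaves)%N.
Proof.
have [v [Tv vr]] := T0_height.2.
have : v \in leaves by apply/(leavesP T0_fin T0_height T0_leaves).
by case: (leaves).
Qed.

Definition spine_mass : R :=
  expR (- mu * r.-1%:R) * (mu ^+ (size leaves).-1 / (size leaves).-1`!%:R).

Lemma nu_gap_branches F : (forall x, x \in sector_seq -> F_ok F x) ->
  nu mu (branch_event T0 r 1 edge_ball F) =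
  (spine_mass * \prod_(x <- sector_seq) rho R (F x.1 x.2))%:E.
Proof.
move=> Fok; rewrite nu_branch_event// => [|v _]; last exact: S_ok_edge_ball.
have -> : \prod_(v <- leaves) leaf_weight 1 edge_ball v = 1.
  by rewrite big1// => v _; exact: leaf_weight_edge_ball.
have -> : \prod_(v <- leaves) leaf_poly 1 edge_ball v = \prod_(v <- leaves) 'X.
  by apply: eq_bigr => v _; exact: leaf_poly_edge_ball.
rewrite big_const_seq count_predT iter_mulr_1 LamXn /= mulr0n oppr0 mul0r expR0.
rewrite /spine_mass; have := size_leaves_gt0; case: (size leaves) => // k _.
by congr EFin; rewrite /=; ring.
Qed.

(** Interpolates between prescribing the branch of every sector and prescribing only the ball of the
    spine, which is the case of the empty list. *)
Definition gap_event (l : seq (word * nat)) F : set Tsp := [set T : tree |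
  Bball r (chi T) = T0 /\
  forall w n, spine_set T w -> (relab (spine_set T) w, n) \in l ->
    gap_branch T (spine_set T) w n = F (relab (spine_set T) w) n].

Lemma gap_event_full F : gap_event sector_seq F = branch_event T0 r 1 edge_ball F.
Proof.
apply/seteqP; split => T.
  move=> [chiE gE]; split => //.
    move=> w [Tw _] _; rewrite /edge_ball -(Bball1_tree (X := plant T w))//.
    exact: is_tree_plant.
  move=> w Yw wr n nc; apply: gE => //; apply/sector_seqP; split => //.
    by rewrite -chiE; split; [exists w|rewrite size_relab; case/andP: wr => _ /ltnW].
  by rewrite size_relab.
move=> [chiE _ gE]; split => // w n Yw /sector_seqP[_ wr nc]; apply: gE => //.
by move: wr; rewrite size_relab.
Qed.

Lemma measurable_gap_branches F : (forall x, x \in sector_seq -> F_ok F x) ->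
  measurable (branch_event T0 r 1 edge_ball F : set Tsp).
Proof.
move=> Fok.
have Fok' u n : T0 u -> (0 < size u < r)%N -> (n <= nchild T0 u)%N ->
    is_tree (F u n) /\ finite_set (F u n).
  by move=> Tu ur nc; apply: (Fok (u, n)); apply/sector_seqP.
have Sok v : T0 v -> size v = r -> [/\ is_tree (edge_ball v), finite_set (edge_ball v)
    & tree_height (edge_ball v) 1] by move=> _ _; exact: S_ok_edge_ball.
rewrite (branch_event_cylinder T0_tree T0_fin T0_height T0_leaves Fok' (d := 1) isT Sok).
apply: measurableI; last exact: measurable_infgroups.
apply: measurable_cylinder; apply: (finite_glue T0_fin Fok') => v Tv vr.
by have [] := Sok _ Tv vr.
Qed.

(* Summing over the finite tree in one sector at a time, since [rho] has mass 1. *)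
Lemma nu_gap_event l1 l2 F : sector_seq = l1 ++ l2 ->
  (forall x, x \in l2 -> F_ok F x) ->
  measurable (gap_event l2 F) /\
  nu mu (gap_event l2 F) = (spine_mass * \prod_(x <- l2) rho R (F x.1 x.2))%:E.
Proof.
(* [l1] lists the sectors already summed out, so the base case prescribes all of them and each step
   frees the sector x. *)
elim/last_ind: l1 l2 F => [|l1 x IH] l2 F secE Fok.
  rewrite cat0s in secE; rewrite -secE in Fok *.
  rewrite gap_event_full; split; first exact: measurable_gap_branches.
  exact: nu_gap_branches.
have secE' : sector_seq = l1 ++ x :: l2 by rewrite -cat_rcons.
have xl2 : x \notin l2.
  have := uniq_sector_seq; rewrite secE' cat_uniq => /and3P[_ _ /=].
  by case/andP.
have [Tx1 xr xc] : [/\ T0 x.1, (0 < size x.1 < r)%N & (x.2 <= nchild T0 x.1)%N].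
  apply/sector_seqP; rewrite -surjective_pairing secE' mem_cat mem_head.
  by rewrite orbT.
pose F' (V : {fset word}) u n := if (u, n) == x then [set` V] else F u n.
have F'E V y : y \in l2 -> F' V y.1 y.2 = F y.1 y.2.
  move=> yl2; rewrite /F' -surjective_pairing; case: eqP => // yx.
  by rewrite -yx yl2 in xl2.
have F'x V : F' V x.1 x.2 = [set` V] by rewrite /F' -surjective_pairing eqxx.
have F'ok V : is_tree [set` V] -> forall y, y \in x :: l2 -> F_ok (F' V) y.
  move=> tV y; rewrite inE => /orP[/eqP ->|yl2]; last by rewrite /F_ok F'E//; exact: Fok.
  by rewrite /F_ok F'x; split => //; exact: finite_fset.
(* Sets of words V that are not trees get the empty event, in agreement with [rho] being 0 there. *)
pose A (V : {fset word}) := if `[< is_tree [set` V] >] then gap_event (x :: l2) (F' V) else set0.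
have spine_x (T : tree) : Bball r (chi T) = T0 ->
    exists2 w, spine_set T w & relab (spine_set T) w = x.1.
  by move=> chiE; move: Tx1; rewrite -chiE => -[[w Yw we] _]; exists w.
have AT V T : A V T -> gap_event (x :: l2) (F' V) T /\ is_tree [set` V].
  by rewrite /A; case: asboolP.
have AE : gap_event l2 F = \bigcup_V A V.
  apply/seteqP; split => T.
    move=> [chiE gE]; have [w Yw we] := spine_x T chiE.
    exists (fset_set (gap_branch T (spine_set T) w x.2)) => //.
    rewrite /A asboolT; last first.
      rewrite fset_setK; last exact: finite_gap_branch.
      exact: is_tree_gap_branch.
    split => // w' n Yw'; rewrite inE => /orP[/eqP xe|wl2].
      rewrite /F' xe eqxx fset_setK; last exact: finite_gap_branch.
      have -> : w' = w by apply: (@relab_inj T) => //; rewrite we -xe.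
      by rewrite -xe.
    have h := F'E (fset_set (gap_branch T (spine_set T) w x.2)) _ wl2.
    by rewrite [RHS]h; exact: gE.
  move=> [V _] /AT[[chiE gE] _]; split => // w n Yw wl2.
  by rewrite gE// ?inE ?wl2 ?orbT//; exact: (F'E V _ wl2).
have mA V : measurable (A V).
  rewrite /A; case: asboolP => // tV.
  by have [] := IH (x :: l2) (F' V) secE' (F'ok V tV).
have tA : trivIset setT A.
  apply/trivIsetP => V W _ _ /eqP VW; rewrite -subset0 => T [/AT[[chiE gV] _] /AT[[_ gW] _]].
  apply: VW; rewrite -(set_fsetK V) -(set_fsetK W) -(F'x V) -(F'x W).
  have [w Yw we] := spine_x T chiE.
  have xin : (relab (spine_set T) w, x.2) \in x :: l2.
    by rewrite we -surjective_pairing mem_head.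
  by rewrite -we -(gV _ _ Yw xin) -(gW _ _ Yw xin).
rewrite AE; split.
  by apply: countable_bigcupT_measurable => //; exact: countableP.
rewrite measure_csum//.
transitivity (csum (fun V : {fset word} => (spine_mass * \prod_(y <- l2) rho R (F y.1 y.2))%:E *
    (rho R [set` V])%:E)%E).
  apply: eq_csum => V; rewrite /A; case: asboolP => [tV|ntV]; last first.
    by rewrite measure0 /rho asboolF ?mule0// => -[].
  have [_ e] := IH (x :: l2) (F' V) secE' (F'ok V tV).
  apply: (etrans e); rewrite -EFinM big_cons F'x.
  rewrite (eq_big_seq (fun y => rho R (F y.1 y.2))); last by move=> y yl2; rewrite F'E.
  by congr EFin; ring.
rewrite csumZl; last by move=> V; rewrite lee_fin rho_ge0.
by rewrite (rho_mass Hnu) mule1.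
Qed.

Lemma nu_spine_ball : nu mu ([set T : tree | Bball r (chi T) = T0] : set Tsp) = spine_mass%:E.
Proof.
have h x : x \in [::] -> F_ok (fun _ _ => set0) x by [].
have [_] := nu_gap_event (esym (cats0 sector_seq)) h.
rewrite big_nil mulr1 => <-; congr (nu mu _).
by apply/seteqP; split => T; [split|case].
Qed.

Lemma tree_height_Bball (X : set word) d : is_tree X -> ~ finite_set X ->
  tree_height (Bball d X) d.
Proof.
move=> tX iX; split => [w []//|]; apply: contrapT => nw; apply: iX.
apply: (@sub_finite_set _ _ (Bball d X)); last exact: Bball_finite.
move=> w Xw; split => //; rewrite leqNgt; apply/negP => dw; apply: nw.
have sd : size (take d w) = d by rewrite size_take_min; apply/minn_idPl/ltnW.
exists (take d w); split => //; split; last by rewrite sd.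
by apply: (tree_cat (u := drop d w) tX); rewrite cat_take_drop.
Qed.

Section EventInhabited.
Variables (d : nat) (S : word -> set word) (F : word -> nat -> set word) (T : tree).
Hypothesis ET : branch_event T0 r d S F T.

Lemma spine_above u : T0 u -> exists2 w, spine_set T w & relab (spine_set T) w = u.
Proof. by have [chiE _ _] := ET; rewrite -{1}chiE => -[[w Yw we] _]; exists w. Qed.

(** A nonempty branch event forces its data to come from an actual tree. For all other S and F the
    event is empty, and the formula must vanish too. *)
Lemma branch_event_F_ok x : x \in sector_seq -> F_ok F x.
Proof.
case: x => u n /sector_seqP[Tu ur nc]; have [w Yw we] := spine_above Tu.
have [_ _ gE] := ET; have wr : (0 < size w < r)%N by rewrite -(size_relab (spine_set T)) we.
rewrite /F_ok /= -we -gE ?we//; split; first exact: is_tree_gap_branch.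
exact: finite_gap_branch.
Qed.

Lemma branch_event_plant v : v \in leaves -> exists2 X, is_tree X /\ ~ finite_set X & S v = Bball d X.
Proof.
move=> /(leavesP T0_fin T0_height T0_leaves)[Tv vr]; have [w Yw we] := spine_above Tv.
have [_ pE _] := ET; exists (plant T w).
  by split; [apply: is_tree_plant; case: Yw|exact: spine_infinite_plant].
by rewrite pE// ?we// -(size_relab (spine_set T)) we.
Qed.

Lemma branch_event_S_ok v : (0 < d)%N -> v \in leaves -> S_ok d S v.
Proof.
move=> d0 /branch_event_plant[X [tX iX] SE]; rewrite /S_ok SE; split.
- exact: is_tree_Bball.
- exact: Bball_finite.
- exact: tree_height_Bball.
Qed.

End EventInhabited.

Lemma Bball0 (X : set word) : is_tree X -> Bball 0 X = [set [::]].
Proof.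
move=> [[X0 _] _ _ _ _]; apply/seteqP; split => w; last by move=> ->.
by move=> [_]; rewrite leqn0 size_eq0 => /eqP.
Qed.

(* Law of the ball of radius [d] of an infinite branch as a function of its
   parameter t: [weight v * e^(-(d - 1) t) * Lam t (ball_poly v)]. *)
Definition weight d S v : R := if d == 0 then 1 else leaf_weight d S v.

(** The polynomial 0 is assigned to sets that are not balls of radius d of an infinite tree. At d =
    0 the ball is the bare root, an event of probability [Lam t 'X] = 1. *)
Definition ball_poly d S v : {poly R} :=
  if d == 0 then (if `[< S v = [set [::]] >] then 'X else 0)
  else (if `[< S_ok d S v >] then leaf_poly d S v else 0).

Lemma nu_leaf_ball d S v t : 0 < t ->
  nu t (ball_ev d (S v)) = (weight d S v * expR (- d.-1%:R * t) * Lam t (ball_poly d S v))%:E.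
Proof.
move=> t0; rewrite /weight /ball_poly; case: d => [|d] /=.
  rewrite oppr0 mul0r expR0 !mul1r; case: asboolP => [SE|nS].
    rewrite SE (_ : ball_ev 0 _ = setT) ?probability_setT; last first.
      by apply/seteqP; split => T // _; rewrite /ball_ev /= Bball0//; exact: tree_ok.
    by rewrite -(expr1 'X) LamXn /= expr0 fact0 divr1.
  rewrite (_ : ball_ev 0 _ = set0) ?measure0 ?Lam0//.
  by rewrite -subset0 => T TS; apply: nS; rewrite -TS Bball0//; exact: tree_ok.
case: asboolP => [[tS fS hS]|nS]; last first.
  rewrite Lam0 mulr0.
  have [[T TS]|nT] := pselect (exists T, ball_ev d.+1 (S v) T); last first.
    rewrite (_ : ball_ev _ _ = set0) ?measure0//.
    by rewrite -subset0 => T TS; apply: nT; exists T.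
  have tS : is_tree (S v) by rewrite -TS; apply: is_tree_Bball => //; exact: tree_ok.
  have fS : finite_set (S v) by rewrite -TS; apply: Bball_finite; exact: tree_ok.
  (* If S is a tree of height less than the radius, the ball event consists of that finite tree
     alone and is null. *)
  rewrite -(@cylinder_ball _ [::]) ?nu_finite_tree// => w Sw; right.
  have wd : (size w <= d.+1)%N by move: Sw; rewrite -TS => -[].
  rewrite ltn_neqAle wd andbT; apply/eqP => we; apply: nS; split => //; split.
    by move=> w'; rewrite -TS => -[].
  by exists w.
rewrite Hnu// nu_ballE; congr EFin; rewrite /cyl binw_Lam /leaf_poly LamB.
rewrite -(expr0 'X) LamXn subr0 /leaf_weight /=.
have -> : - t * d%:R = - d%:R * t by ring.
by ring.
Qed.

Lemma ball_poly0 d S v : (ball_poly d S v)`_0 = 0.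
Proof.
rewrite /ball_poly; case: ifP => _; case: ifP => _; rewrite ?coefX ?coef0//.
by rewrite -horner_coef0 /leaf_poly !hornerE ?addr0 ?expr1n subrr.
Qed.

Lemma prod_rho_eq0 F : ~ (forall x, x \in sector_seq -> F_ok F x) ->
  \prod_(x <- sector_seq) rho R (F x.1 x.2) = 0.
Proof.
move=> /existsNP[x /not_implyP[xs nF]]; apply/eqP; rewrite prodf_seq_eq0.
by apply/hasP; exists x => //=; rewrite /rho asboolF.
Qed.

Lemma prod_poly_eq0 d S : (exists2 v, v \in leaves & ball_poly d S v = 0) ->
  \prod_(v <- leaves) ball_poly d S v = 0.
Proof.
move=> [v vl v0]; apply/eqP; rewrite prodf_seq_eq0.
by apply/hasP; exists v => //=; rewrite v0.
Qed.

Lemma nu_branch_eventE d S F :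
  nu mu (branch_event T0 r d S F) =
  (expR (- mu * r.-1%:R) * \prod_(x <- sector_seq) rho R (F x.1 x.2) *
    (\prod_(v <- leaves) weight d S v * expR (- d.-1%:R * mu) *
     Lam mu (\prod_(v <- leaves) ball_poly d S v)))%:E.
Proof.
have [Fok|nF] := pselect (forall x, x \in sector_seq -> F_ok F x); last first.
  rewrite (prod_rho_eq0 nF) mulr0 mul0r (_ : branch_event _ _ _ _ _ = set0) ?measure0//.
  by rewrite -subset0 => T ET; apply: nF => x; exact: (branch_event_F_ok ET).
pose valid v := if d == 0%N then S v = [set [::]] else S_ok d S v.
have [Sok|/existsNP[v /not_implyP[vl nv]]] := pselect (forall v, v \in leaves -> valid v); last first.
  rewrite prod_poly_eq0 ?Lam0 ?mulr0; last first.
    by exists v => //; move: nv; rewrite /ball_poly /valid; case: ifP => _ ?; rewrite asboolF.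
  rewrite (_ : branch_event _ _ _ _ _ = set0) ?measure0//.
  rewrite -subset0 => T ET; apply: nv; rewrite /valid; case: eqP => d0.
    by have [X [tX _] ->] := branch_event_plant ET vl; rewrite d0 Bball0.
  by apply: (branch_event_S_ok ET) => //; rewrite lt0n; exact/eqP.
case: d => [|d'] in valid Sok *.
  (* Tops exist only for positive d, so d = 0 is reduced to d = 1 with single edges: neither
     constrains the infinite branches, and [d.-1] is 0 in both cases. *)
  rewrite (_ : branch_event T0 r 0 S F = branch_event T0 r 1 edge_ball F); last first.
    have chil (T : tree) w : Bball r (chi T) = T0 -> spine_set T w -> size w = r ->
        relab (spine_set T) w \in leaves.
      move=> chiE Yw wr; apply/(leavesP T0_fin T0_height T0_leaves).
      rewrite size_relab; split => //; rewrite -chiE; split; first by exists w.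
      by rewrite size_relab wr.
    apply/seteqP; split => T [chiE pE gE]; split => // w Yw wr.
      rewrite /edge_ball -(Bball1_tree (X := plant T w))//.
      by apply: is_tree_plant; case: Yw.
    rewrite (Sok _ (chil T w chiE Yw wr)) Bball0//.
    by apply: is_tree_plant; case: Yw.
  rewrite nu_gap_branches//; congr EFin.
  rewrite [\prod_(v <- leaves) weight 0 S v]big1 ?mul1r// oppr0 mul0r expR0 mul1r.
  have -> : \prod_(v <- leaves) ball_poly 0 S v = \prod_(v <- leaves) 'X.
    by apply: eq_big_seq => v /Sok SE; rewrite /ball_poly /= asboolT.
  rewrite big_const_seq count_predT iter_mulr_1 LamXn /spine_mass.
  by have := size_leaves_gt0; case: (size leaves) => // k _ /=; ring.
rewrite nu_branch_event//; congr (_ * (_ * _ * Lam _ _))%:E.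
by apply: eq_big_seq => v /Sok SE; rewrite /ball_poly /= asboolT.
Qed.

End Law.

(** Using one radius d for all infinite branches loses nothing, since a ball event of smaller radius
    is a countable disjoint union of ball events of radius d. *)
Theorem mainTheorem15 (R : realType) (nu : R -> probability Tsp R)
  (Hnu : forall (v : R), 0 < v -> forall (s : nat) (S : set word),
     is_tree S -> finite_set S -> tree_height S s ->
     nu v (ball_ev s S) = (nu_ball v s S)%:E)
  (mu : R) (mu_gt0 : 0 < mu)
  (T0 : set word) (r : nat)
  (T0_tree : is_tree T0) (T0_fin : finite_set T0) (T0_height : tree_height T0 r)
  (T0_leaves : forall w, leaf T0 w -> size w = r) :
  let Rl := ncard (leaf T0) in
  let C : set Tsp := [set T : tree | Bball r (chi T) = T0] in
  nu mu C = (expR (- (r.-1)%:R * mu) * mu ^+ Rl.-1 / (Rl.-1)`!%:R)%:E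
  /\
  forall (d : nat) (S : word -> set word) (F : word -> nat -> set word),
    cond_prob (nu mu) C (branch_event T0 r d S F) =
    (simplex_int (enum_fset (fset_set (leaf T0))) mu
       (fun g => \big[*%E/1%E]_(v <- enum_fset (fset_set (leaf T0)))
                   nu (g v) (ball_ev d (S v)))
     * (\big[*%R/1%R]_(x \in sectors T0 r) rho R (F x.1 x.2))%:E)%E.
Proof.
move=> Rl C.
have CE : nu mu C = (spine_mass mu T0 r)%:E by exact: nu_spine_ball.
have mE : - mu * r.-1%:R = - r.-1%:R * mu by ring.
split; first by rewrite CE /spine_mass mE mulrA.
move=> d S F.
have l0 := size_leaves_gt0 T0_fin T0_height T0_leaves.
rewrite /cond_prob (_ : _ `&` C = branch_event T0 r d S F); last first.
  by apply/setIidPl => T [].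
rewrite CE (nu_branch_eventE Hnu mu_gt0 T0_tree T0_fin T0_height T0_leaves) /=.
rewrite sectors_prod// /simplex_int.
rewrite (@sint_prod R (leaves T0) mu d.-1%:R (weight R d S) (ball_poly R d S) 1); last 5 first.
- exact: fset_uniq.
- by rewrite -size_eq0 -lt0n.
- exact: mu_gt0.
- by move=> v _; exact: ball_poly0.
- move=> g g0; rewrite mul1r -prodEFin; apply: eq_big_seq => v vl.
  by apply: (nu_leaf_ball Hnu); exact: g0.
(* The normalization (R - 1)! / mu^(R - 1) of the simplex integral is the inverse of the
   corresponding factor of the spine mass by which one conditions. *)
rewrite -!EFinM; congr EFin; rewrite /spine_mass.
have e0 : expR (- mu * r.-1%:R) != 0 by rewrite gt_eqF ?expR_gt0.
have m0 : mu != 0 by rewrite gt_eqF.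
field.
by rewrite e0 expf_neq0// pnatr_eq0 -lt0n fact_gt0.
Qed.
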